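(* Let $n\in\mathbb{N}$ and $1\le k\le n$. A $k$-regular set $E\subset\mathbb{H}^n$ admits a corona decomposition by horizontal planes (P-C) if and only if it admits a corona decomposition by intrinsic Lipschitz graphs (ILG-C).
   Context: **Heisenberg group.** $\mathbb{H}^n$ is $\mathbb{R}^{2n}\times\mathbb{R}$ with product $(z,t)\cdot(z',t')=(z+z',t+t'+\omega(z,z'))$, where $\omega(z,z')=\frac12\sum_{i=1}^n(z_iz'_{n+i}-z_{n+i}z'_i)$. The Korányi norm is $\|(z,t)\|=\sqrt[4]{|z|^4+16t^2}$ and the Korányi distance is $d(x,y)=\|y^{-1}\cdot x\|$. $B(x,r)$ is the closed $d$-ball; $\mathrm{diam}$, $d(x,A)=\inf_{a\in A}d(x,a)$ and the Hausdorff measures $\mathcal{H}^s$ are taken with respect to $d$. $\mathcal{V}_k^0$ is the family of horizontal subgroups $V=V_I\times\{0\}$ with $V_I\subset\mathbb{R}^{2n}$ a $k$-dimensional isotropic linear subspace ($\omega(z,z')=0$ for all $z,z'\in V_I$); $\mathcal{V}_k=\{x\cdot V_0:x\in\mathbb{H}^n,V_0\in\mathcal{V}_k^0\}$ is the family of affine horizontal $k$-planes. **Projections and intrinsic Lipschitz graphs.** For $V_0=V_I\times\{0\}\in\mathcal{V}_k^0$ let $P_{V_0}(z,t)=(\pi_{V_I}(z),0)$, with $\pi_{V_I}$ the Euclidean orthogonal projection onto $V_I$; for $V=x\cdot V_0\in\mathcal{V}_k$ let $P_V(y)=x\cdot P_{V_0}(x^{-1}\cdot y)$ (independent of $x\in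 V$). For $V\in\mathcal{V}_k^0$ let $W=V_I^\perp\times\mathbb{R}$ be the complementary orthogonal subgroup and $P_W(y)=P_V(y)^{-1}\cdot y$. A map $\phi:V\to W$ with graph map $\Phi(v)=v\cdot\phi(v)$ is intrinsic Lipschitz if for some $L>0$, $\|P_W(\Phi(v')^{-1}\Phi(v))\|\le L\|P_V(\Phi(v')^{-1}\Phi(v))\|$ for all $v,v'\in V$; the best such $L$ is its intrinsic Lipschitz constant. A $k$-dimensional intrinsic Lipschitz graph is a set $\Phi(V)$ for some $V\in\mathcal{V}_k^0$ and intrinsic Lipschitz $\phi:V\to W$. **Regular sets.** $E\subset\mathbb{H}^n$ is $k$-regular if it is closed and there is $C_E>1$ with $C_E^{-1}r^k\le\mathcal{H}^k(E\cap B(x,r))\le C_Er^k$ for all $x\in E$, $0<r\le\mathrm{diam}(E)$, $r<\infty$. **Dyadic systems.** A dyadic system on a $k$-regular set $E$ is a collection $\mathcal{D}=\bigcup_{j\in\mathbb{J}}\mathcal{D}_j$, with each $\mathcal{D}_j$ a family of pairwise disjoint Borel sets, together with constants $\varrho\in(0,1)$, $D\in(1,\infty)$ (such systems exist with $\varrho,D$ depending only on $k$ and $C_E$) such that: (1) $E=\bigcup_{Q\in\mathcal{D}_j}Q$ for each $j\in\mathbb{J}$; (2) if $Q_1,Q_2\in\mathcal{D}$ intersect, one contains the other; (3) $D^{-1}\varrho^j\le\mathrm{diam}(Q)\le D\varrho^j$ and $D^{-1}\varrho^{jk}\le\mathcal{H}^k(Q)\le D\varrho^{jk}$ for $Q\in\mathcal{D}_j$;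 (4) for each $Q\in\mathcal{D}_j$ there is $x_Q\in E$ with $B(x_Q,D^{-1}\varrho^j)\cap E\subset Q$; (5) $\mathcal{H}^k(\{x\in Q:d(x,E\setminus Q)\le\eta\varrho^j\})\le D\eta^{1/D}\mathcal{H}^k(Q)$ for all $Q\in\mathcal{D}_j$, $\eta>0$. Here $\mathbb{J}=\mathbb{Z}$ if $E$ is unbounded, and $\mathbb{J}=\{j\in\mathbb{Z}:j\ge J_0\}$ with $\varrho^{J_0+1}\le\mathrm{diam}(E)<\varrho^{J_0}$ otherwise. The children of $Q\in\mathcal{D}_j$ are the $R\in\mathcal{D}_{j+1}$ with $R\subset Q$. $\lambda Q=\{x\in E:d(x,Q)\le(\lambda-1)\mathrm{diam}(Q)\}$ for $\lambda>1$. The set $E$ is considered with a fixed dyadic system $\mathcal{D}$. **Coronization with constant $C>0$.** A decomposition $\mathcal{D}=\mathcal{G}\,\dot\cup\,\mathcal{B}$ such that $\sum_{Q\in\mathcal{B},Q\subseteq R}\mathcal{H}^k(Q)\le C\mathcal{H}^k(R)$ for all $R\in\mathcal{D}$, and $\mathcal{G}$ can be partitioned into a family $\mathcal{F}$ of disjoint trees $\mathcal{S}$ such that: (a) each $\mathcal{S}\in\mathcal{F}$ is coherent, i.e. it has a unique maximal element $Q(\mathcal{S})$ containing all other elements of $\mathcal{S}$; if $Q\in\mathcal{S}$, $Q'\in\mathcal{D}$, $Q\subseteq Q'\subseteq Q(\mathcal{S})$ then $Q'\in\mathcal{S}$; and if $Q\in\mathcal{S}$ then either all or none of the children of $Q$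 lie in $\mathcal{S}$; (b) $\sum_{\mathcal{S}\in\mathcal{F},Q(\mathcal{S})\subseteq R}\mathcal{H}^k(Q(\mathcal{S}))\le C\mathcal{H}^k(R)$ for all $R\in\mathcal{D}$. **(ILG-C).** For every $\eta>0$ there is $C=C(\eta)>0$ such that $E$ admits a coronization with constant $C$ in which for each $\mathcal{S}\in\mathcal{F}$ there is a $k$-dimensional intrinsic Lipschitz graph $\Gamma_{\mathcal{S}}$ with intrinsic Lipschitz constant at most $\eta$ such that for all $Q\in\mathcal{S}$: $d(x,\Gamma_{\mathcal{S}})\le\eta\,\mathrm{diam}(Q)$ whenever $x\in E$ and $d(x,Q)\le\mathrm{diam}(Q)$. **(P-C).** Let $K_0\ge2$ be a fixed constant, chosen large enough depending only on $k$ and $C_E$. For every $\eta>0$ there is $C=C(\eta)>0$ such that $E$ admits a coronization with constant $C$ in which for each $\mathcal{S}\in\mathcal{F}$ there is $V_{\mathcal{S}}\in\mathcal{V}_k$ such that for all $x,y\in K_0Q(\mathcal{S})$ with $d(x,y)>\eta\min\{h_{\mathcal{S}}(x),h_{\mathcal{S}}(y)\}$ one has $d(x,y)\le(1+2\eta)\,d(P_{V_{\mathcal{S}}}(x),P_{V_{\mathcal{S}}}(y))$, where $h_{\mathcal{S}}(x)=\inf\{d(x,Q)+\mathrm{diam}(Q):Q\in\mathcal{S}\}$. *)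

(* Defs.v *)
From HB Require Import structures.
From mathcomp Require Import all_boot all_order all_algebra.
From mathcomp Require Import all_classical all_reals all_analysis.
From mathcomp Require Import ring lra.

Set Implicit Arguments.
Unset Strict Implicit.
Unset Printing Implicit Defensive.

Import Order.TTheory GRing.Theory Num.Theory.
Import numFieldNormedType.Exports.

Local Open Scope classical_set_scope.
Local Open Scope ring_scope.

Section Metric.
Context {R : realType} {M : metricType R}.
Implicit Types (A E : set M) (x : M).

(* [closed_ball] of the library is the closure of the open ball. *)
Definition cball x (r : R) : set M := [set y | mdist x y <= r].

(* Extended-real valued, so that the distance to the empty set is +oo (a real
   infimum would be 0, and condition [ds_small_boundary] below would then fail
   for Q = E). *)
Definition dist_set x A : \bar R := ereal_inf [set (mdist x a)%:E | a in A].

(* 0 is added so that the empty set has diameter 0 and not -oo. *)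
Definition diam A : \bar R :=
  ereal_sup (0%E |` [set (mdist p.1 p.2)%:E | p in A `*` A]).

Definition dilate E (lambda : R) A : set M :=
  [set x | E x /\ (dist_set x A <= (lambda - 1)%:E * diam A)%E].

(* Unnormalised: a normalising factor would only change the constants. k is
   meant to be positive (for k = 0 the empty pieces of a cover would contribute
   0 ^ 0 = 1). *)
Definition hausdorff_pre (k : nat) (delta : R) A : \bar R :=
  ereal_inf [set (\sum_(0 <= i <oo) diam (U i) ^+ k)%E | U in
    [set U : nat -> set M |
      A `<=` \bigcup_i U i /\ forall i, (diam (U i) <= delta%:E)%E]].

(* [hausdorff_pre k delta A] increases as delta decreases to 0, so that the
   limit is a supremum. *)
Definition hausdorff (k : nat) A : \bar R :=
  ereal_sup [set hausdorff_pre k delta A | delta in [set d : R | 0 < d]].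

Definition regular_set (k : nat) (C : R) E : Prop :=
  [/\ closed E, 1 < C &
    forall x (r : R), E x -> 0 < r -> (r%:E <= diam E)%E ->
      ((C^-1 * r ^+ k)%:E <= hausdorff k (E `&` cball x r))%E /\
      (hausdorff k (E `&` cball x r) <= (C * r ^+ k)%:E)%E].

Record dyadic_system (k : nat) E := DyadicSystem {
  ds_rho : R;
  ds_D : R;
  ds_index : set int;
  ds_gen : int -> set (set M);
  ds_rho01 : 0 < ds_rho < 1;
  ds_D1 : 1 < ds_D;
  ds_index_unbounded : diam E = +oo%E -> ds_index = setT;
  ds_index_bounded : diam E <> +oo%E -> exists J0 : int,
    [/\ ds_index = [set j | J0 <= j],
        ((ds_rho ^ (J0 + 1))%:E <= diam E)%E &
        (diam E < (ds_rho ^ J0)%:E)%E];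
  ds_borel : forall j Q, ds_index j -> ds_gen j Q -> <<s @open M >> Q;
  ds_disjoint : forall j, ds_index j -> trivIset (ds_gen j) id;
  ds_cover : forall j, ds_index j -> E = \bigcup_(Q in ds_gen j) Q;
  ds_nested : forall i j Q1 Q2, ds_index i -> ds_index j ->
    ds_gen i Q1 -> ds_gen j Q2 -> Q1 `&` Q2 !=set0 ->
    Q1 `<=` Q2 \/ Q2 `<=` Q1;
  ds_diam : forall j Q, ds_index j -> ds_gen j Q ->
    ((ds_D^-1 * ds_rho ^ j)%:E <= diam Q)%E /\
    (diam Q <= (ds_D * ds_rho ^ j)%:E)%E;
  ds_measure : forall j Q, ds_index j -> ds_gen j Q ->
    ((ds_D^-1 * ds_rho ^ (j * k%:Z))%:E <= hausdorff k Q)%E /\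
    (hausdorff k Q <= (ds_D * ds_rho ^ (j * k%:Z))%:E)%E;
  ds_center : forall j Q, ds_index j -> ds_gen j Q ->
    exists2 x, E x & cball x (ds_D^-1 * ds_rho ^ j) `&` E `<=` Q;
  ds_small_boundary : forall j Q (eta : R), ds_index j -> ds_gen j Q ->
    0 < eta ->
    (hausdorff k
        [set x | Q x /\ (dist_set x (E `\` Q) <= (eta * ds_rho ^ j)%:E)%E]
      <= (ds_D * eta `^ ds_D^-1)%:E * hausdorff k Q)%E
}.

End Metric.

Section Corona.
Context {R : realType} {M : metricType R} {k : nat} {E : set M}.
Variable Dy : dyadic_system k E.
Implicit Types (S : set (set M)) (F : set (set (set M))) (Q T : set M).

Definition cubes : set (set M) :=
  \bigcup_(j in ds_index Dy) ds_gen Dy j.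

(* Cubes are plain sets and the same set may belong to several generations, so
   the children of Q depend on the generation j in which Q is considered. *)
Definition children (j : int) Q : set (set M) :=
  [set T | ds_gen Dy (j + 1) T /\ T `<=` Q].

Definition is_top S T : Prop := S T /\ forall Q, S Q -> Q `<=` T.

(* At most one T satisfies [is_top S T]; it is the cube Q(S) of a coherent S. *)
Definition top S : set M := get (is_top S).

Definition coherent S : Prop :=
  [/\ exists T, is_top S T,
      forall Q T, S Q -> cubes T -> Q `<=` T -> T `<=` top S -> S T &
      forall j Q, S Q -> ds_index Dy j -> ds_gen Dy j Q ->
        children j Q `<=` S \/ children j Q `<=` ~` S].

(* G and B are the good and the bad cubes, F is the family of trees. *)
Definition coronization (C : R) (G B : set (set M)) F : Prop :=
  [/\ cubes = G `|` B /\ G `&` B = set0,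
      forall T, cubes T ->
        (\esum_(Q in [set Q | B Q /\ Q `<=` T]) hausdorff k Q
          <= C%:E * hausdorff k T)%E,
      G = \bigcup_(S in F) S /\ trivIset F id,
      forall S, F S -> coherent S &
      forall T, cubes T ->
        (\esum_(S in [set S | F S /\ top S `<=` T]) hausdorff k (top S)
          <= C%:E * hausdorff k T)%E].

Definition tree_height S (x : M) : \bar R :=
  ereal_inf [set (dist_set x Q + diam Q)%E | Q in S].

End Corona.

(* Euclidean inner product; the library norm on 'rV is the sup norm. *)
Definition dotv {R : realType} {m : nat} (z w : 'rV[R]_m) : R :=
  \sum_i z 0 i * w 0 i.

Definition omega {R : realType} {n : nat} (z w : 'rV[R]_(n + n)) : R :=
  2^-1 * \sum_(i < n) (z 0 (lshift n i) * w 0 (rshift n i)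
                       - z 0 (rshift n i) * w 0 (lshift n i)).

(* A record, and not 'rV[R]_(n + n) * R, in order not to inherit the metric
   and the additive group of the product. *)
Record heis (R : realType) (n : nat) :=
  Heis { hz : 'rV[R]_(n + n); ht : R }.

HB.instance Definition _ (R : realType) (n : nat) :=
  gen_eqMixin (heis R n).
HB.instance Definition _ (R : realType) (n : nat) :=
  gen_choiceMixin (heis R n).

Section HeisGroup.
Context {R : realType} {n : nat}.
Implicit Types (x y : heis R n) (z w : 'rV[R]_(n + n)).

Definition hmul x y : heis R n :=
  Heis (hz x + hz y) (ht x + ht y + omega (hz x) (hz y)).
Definition hone : heis R n := Heis 0 0.
Definition hinv x : heis R n := Heis (- hz x) (- ht x).

Lemma omegaDl z z' w : omega (z + z') w = omega z w + omega z' w.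
Proof.
rewrite /omega -mulrDr -big_split/=; congr (_ * _); apply: eq_bigr => i _.
rewrite !mxE; ring.
Qed.

Lemma omega_anti z w : omega z w = - omega w z.
Proof.
rewrite /omega -mulrN -sumrN; congr (_ * _); apply: eq_bigr => i _; ring.
Qed.

Lemma omegaDr z w w' : omega z (w + w') = omega z w + omega z w'.
Proof. by rewrite omega_anti omegaDl opprD -!(omega_anti z). Qed.

Lemma omegaNl z w : omega (- z) w = - omega z w.
Proof.
rewrite /omega -mulrN -sumrN; congr (_ * _); apply: eq_bigr => i _.
rewrite !mxE; ring.
Qed.

Lemma omegaNr z w : omega z (- w) = - omega z w.
Proof. by rewrite omega_anti omegaNl opprK omega_anti. Qed.

Lemma omega0l z : omega 0 z = 0.
Proof. by rewrite /omega big1 ?mulr0// => i _; rewrite !mxE !mul0r subrr. Qed.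

Lemma omega0r z : omega z 0 = 0.
Proof. by rewrite omega_anti omega0l oppr0. Qed.

Lemma omegaxx z : omega z z = 0.
Proof. by rewrite /omega big1 ?mulr0// => i _; ring. Qed.

Lemma hmulA : associative hmul.
Proof.
move=> x y z; congr Heis => /=; first by rewrite addrA.
by rewrite omegaDl omegaDr; ring.
Qed.

Lemma hmul1 : left_id hone hmul.
Proof. by case=> z t; congr Heis => /=; rewrite ?omega0l ?addr0 add0r. Qed.

Lemma hmulr1 : right_id hone hmul.
Proof.
by case=> z t; congr Heis => /=; rewrite ?omega0r ?addr0.
Qed.

Lemma hmulV : left_inverse hone hinv hmul.
Proof.
move=> x; congr Heis => /=; first by rewrite addNr.
by rewrite omegaNl omegaxx oppr0 addr0 addNr.
Qed.

Lemma hmulrV : right_inverse hone hinv hmul.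
Proof.
move=> x; congr Heis => /=; first by rewrite subrr.
by rewrite omegaNr omegaxx oppr0 addr0 subrr.
Qed.

End HeisGroup.

HB.instance Definition _ (R : realType) (n : nat) :=
  isGroup.Build (heis R n) (@hmulA R n) (@hmul1 R n) (@hmulr1 R n)
    (@hmulV R n) (@hmulrV R n).

Section Koranyi.
Context {R : realType} {n : nat}.
Implicit Types (x y : heis R n).

(* dotv z z ^+ 2 is the fourth power of the Euclidean norm of z. *)
Definition knorm x : R :=
  (dotv (hz x) (hz x) ^+ 2 + 16 * ht x ^+ 2) `^ 4^-1.

Definition kdist x y : R := knorm (y^-1 * x)%g.

Lemma dotvv_ge0 m (z : 'rV[R]_m) : 0 <= dotv z z.
Proof. by apply: sumr_ge0 => i _; rewrite -expr2 sqr_ge0. Qed.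

Lemma dotvv_eq0 m (z : 'rV[R]_m) : dotv z z = 0 -> z = 0.
Proof.
move=> /eqP; rewrite psumr_eq0; last by move=> i _; rewrite -expr2 sqr_ge0.
move=> /allP z0; apply/rowP => i; rewrite mxE.
by have := z0 i (mem_index_enum i); rewrite /= mulf_eq0 orbb => /eqP.
Qed.

Lemma krad_ge0 (a t : R) : 0 <= a ^+ 2 + 16 * t ^+ 2.
Proof. by rewrite addr_ge0 ?sqr_ge0// mulr_ge0 ?sqr_ge0. Qed.

Lemma knormE x : knorm x =
  Num.sqrt (Num.sqrt (dotv (hz x) (hz x) ^+ 2 + 16 * ht x ^+ 2)).
Proof.
rewrite /knorm (_ : 4^-1 = 2^-1 * 2^-1); last by field.
by rewrite powRrM !powR12_sqrt ?sqrtr_ge0 ?krad_ge0.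
Qed.

Lemma knorm_ge0 x : 0 <= knorm x.
Proof. by rewrite powR_ge0. Qed.

Lemma knorm4 x : knorm x ^+ 4 = dotv (hz x) (hz x) ^+ 2 + 16 * ht x ^+ 2.
Proof.
by rewrite knormE (exprM _ 2 2) !sqr_sqrtr ?sqrtr_ge0 ?krad_ge0.
Qed.

Lemma knorm1 : knorm 1%g = 0.
Proof.
rewrite knormE /dotv /= big1; last by move=> i _; rewrite !mxE mul0r.
by rewrite !expr0n/= mulr0 addr0 !sqrtr0.
Qed.

Lemma knorm_eq0 x : knorm x = 0 -> x = 1%g.
Proof.
move=> x0; have := knorm4 x; rewrite x0 expr0n/= => /esym/eqP.
rewrite paddr_eq0 ?sqr_ge0//; last by rewrite mulr_ge0 ?sqr_ge0.
rewrite expf_eq0/= => /andP[/eqP z0]; rewrite mulf_eq0 pnatr_eq0 expf_eq0/=.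
move=> /eqP t0.
by case: x {x0} z0 t0 => z t /= /dotvv_eq0 -> ->.
Qed.

Lemma knormV x : knorm x^-1%g = knorm x.
Proof.
rewrite /knorm /= sqrrN; congr ((_ ^+ 2 + _) `^ _).
by apply: eq_bigr => i _; rewrite !mxE mulrNN.
Qed.

Lemma dotv_split (z w : 'rV[R]_(n + n)) : dotv z w =
  \sum_(i < n) (z 0 (lshift n i) * w 0 (lshift n i)
                + z 0 (rshift n i) * w 0 (rshift n i)).
Proof. by rewrite /dotv big_split_ord/= big_split. Qed.

Lemma dot_omega_le (z w : 'rV[R]_(n + n)) :
  dotv z w ^+ 2 + (2 * omega z w) ^+ 2 <= dotv z z * dotv w w.
Proof.
have [/dotvv_eq0 ->|z0] := eqVneq (dotv z z) 0.
  have dot0 u : dotv 0 u = 0 :> R.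
    by rewrite /dotv big1// => i _; rewrite mxE mul0r.
  by rewrite omega0l !dot0 mulr0 mul0r !expr0n/= addr0.
have zgt0 : 0 < dotv z z by rewrite lt_def z0 dotvv_ge0.
set p := dotv z w; set q := 2 * omega z w; set a := dotv z z.
rewrite -(ler_pM2l zgt0) -subr_ge0 -/a.
pose f i := (a * w 0 (lshift n i) - p * z 0 (lshift n i)
             + q * z 0 (rshift n i)) ^+ 2
          + (a * w 0 (rshift n i) - p * z 0 (rshift n i)
             - q * z 0 (lshift n i)) ^+ 2.
suff -> : a * (a * dotv w w) - a * (p ^+ 2 + q ^+ 2) = \sum_(i < n) f i.
  by apply: sumr_ge0 => i _; rewrite addr_ge0 ?sqr_ge0.
have qE : q = \sum_(i < n) (z 0 (lshift n i) * w 0 (rshift n i)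
                       - z 0 (rshift n i) * w 0 (lshift n i)).
  by rewrite /q /omega mulrA divff ?mul1r.
have pE : p = _ := dotv_split z w; have aE : a = _ := dotv_split z z.
clearbody a p q.
transitivity (a ^+ 2 * dotv w w - 2 * a * p * p - 2 * a * q * q
              + (p ^+ 2 + q ^+ 2) * a); first by ring.
transitivity (a ^+ 2 * \sum_(i < n) (w 0 (lshift n i) * w 0 (lshift n i)
                + w 0 (rshift n i) * w 0 (rshift n i))
  - 2 * a * p * \sum_(i < n) (z 0 (lshift n i) * w 0 (lshift n i)
                + z 0 (rshift n i) * w 0 (rshift n i))
  - 2 * a * q * \sum_(i < n) (z 0 (lshift n i) * w 0 (rshift n i)
                - z 0 (rshift n i) * w 0 (lshift n i))
  + (p ^+ 2 + q ^+ 2) * \sum_(i < n) (z 0 (lshift n i) * z 0 (lshift n i)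
                + z 0 (rshift n i) * z 0 (rshift n i))).
  by rewrite -dotv_split -pE -qE -aE.
rewrite !mulr_sumr -!sumrN -!big_split/=.
by apply: eq_bigr => i _; rewrite /f; ring.
Qed.

Lemma norm2D (a b c d m l : R) : 0 <= m -> 0 <= l ->
  a ^+ 2 + b ^+ 2 <= m ^+ 2 -> c ^+ 2 + d ^+ 2 <= l ^+ 2 ->
  (a + c) ^+ 2 + (b + d) ^+ 2 <= (m + l) ^+ 2.
Proof.
move=> m0 l0 ab cd.
suff : a * c + b * d <= m * l by nra.
have [|neg] := leP 0 (a * c + b * d); last by rewrite (le_trans (ltW neg)) ?mulr_ge0.
move=> pos; rewrite -(ler_pXn2r (ltn0Sn 1)) ?nnegrE ?mulr_ge0//.
apply: (@le_trans _ _ ((a ^+ 2 + b ^+ 2) * (c ^+ 2 + d ^+ 2))).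
  by have := sqr_ge0 (a * d - b * c); nra.
by rewrite exprMn ler_pM ?addr_ge0 ?sqr_ge0.
Qed.

Lemma knormM x y : knorm (x * y)%g <= knorm x + knorm y.
Proof.
have x0 := knorm_ge0 x; have y0 := knorm_ge0 y.
rewrite -(ler_pXn2r (ltn0Sn 3)) ?nnegrE ?addr_ge0 ?knorm_ge0// knorm4.
set a := dotv (hz x) (hz x); set b := dotv (hz y) (hz y).
set p := dotv (hz x) (hz y); set q := 2 * omega (hz x) (hz y).
have -> : dotv (hz (x * y)%g) (hz (x * y)%g) = a + b + 2 * p.
  rewrite /a /b /p /dotv mulr_sumr -!big_split/=.
  by apply: eq_bigr => i _; rewrite !mxE; ring.
have -> : 16 * ht (x * y)%g ^+ 2 = (4 * ht x + 4 * ht y + 2 * q) ^+ 2.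
  by rewrite /q /=; ring.
rewrite (_ : (_ + _) ^+ 4 =
  (knorm x ^+ 2 + knorm y ^+ 2 + 2 * (knorm x * knorm y)) ^+ 2); last by ring.
have hx : a ^+ 2 + (4 * ht x) ^+ 2 <= (knorm x ^+ 2) ^+ 2.
  by rewrite -exprM knorm4 -/a; lra.
have hy : b ^+ 2 + (4 * ht y) ^+ 2 <= (knorm y ^+ 2) ^+ 2.
  by rewrite -exprM knorm4 -/b; lra.
have a0 : 0 <= a := dotvv_ge0 _; have b0 : 0 <= b := dotvv_ge0 _.
apply: norm2D; rewrite ?addr_ge0 ?mulr_ge0 ?sqr_ge0//.
  by apply: norm2D; rewrite ?sqr_ge0.
have pq : p ^+ 2 + q ^+ 2 <= a * b := dot_omega_le _ _.
suff : a * b <= (knorm x * knorm y) ^+ 2 by nra.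
rewrite exprMn ler_pM// -(ler_pXn2r (ltn0Sn 1)) ?nnegrE ?sqr_ge0//.
- by apply: le_trans hx; rewrite lerDl sqr_ge0.
- by apply: le_trans hy; rewrite lerDl sqr_ge0.
Qed.

Lemma kdistxx x : kdist x x = 0.
Proof. by rewrite /kdist mulVg knorm1. Qed.

Lemma kdist_eq0 x y : kdist x y = 0 -> x = y.
Proof. by move/knorm_eq0 => xy; rewrite -(mulVKg y x) xy mulg1. Qed.

Lemma kdist_sym x y : kdist x y = kdist y x.
Proof. by rewrite /kdist -knormV invgM invgK. Qed.

Lemma kdist_triangle y x z : kdist x z <= kdist x y + kdist y z.
Proof.
rewrite addrC /kdist; suff -> : (z^-1 * x = (z^-1 * y) * (y^-1 * x))%g.
  exact: knormM.
by rewrite mulgA mulgK.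
Qed.

End Koranyi.

(* From here on [mdist] on the Heisenberg group is the Koranyi distance, and
   [closed], [open] refer to its topology. *)
HB.instance Definition _ (R : realType) (n : nat) :=
  isMetric.Build R (heis R n) (@kdistxx R n) (@kdist_eq0 R n)
    (@kdist_sym R n) (@kdist_triangle R n).

Section Projections.
Context {R : realType} {n : nat}.
Implicit Types (V : {vspace 'rV[R]_(n + n)}) (x y v : heis R n).

Definition isotropic V : Prop :=
  forall z w, z \in V -> w \in V -> omega z w = 0.

(* [horizontal k V] says that V x {0} is a k-dimensional horizontal subgroup;
   such a subgroup is represented by the subspace V throughout. *)
Definition horizontal (k : nat) V : Prop := \dim V = k /\ isotropic V.

Definition hsubgroup V : set (heis R n) := [set v | hz v \in V /\ ht v = 0].

Definition vsubgroup V : set (heis R n) :=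
  [set y | forall z, z \in V -> dotv (hz y) z = 0].

(* Well defined by [orthprojP]. *)
Definition orthproj V (z : 'rV[R]_(n + n)) : 'rV[R]_(n + n) :=
  get [set p | p \in V /\ forall w, w \in V -> dotv (z - p) w = 0].

Definition hproj V y : heis R n := Heis (orthproj V (hz y)) 0.

Definition vproj V y : heis R n := ((hproj V y)^-1 * y)%g.

(* An affine horizontal plane is given by a base point x and a direction V;
   the projection does not depend on the choice of x in the plane. *)
Definition affproj x V y : heis R n := (x * hproj V (x^-1 * y))%g.

Definition graph_map (phi : heis R n -> heis R n) v : heis R n :=
  (v * phi v)%g.

Definition ilip_bound V (phi : heis R n -> heis R n) (L : R) : Prop :=
  0 < L /\ forall v v', hsubgroup V v -> hsubgroup V v' ->
    knorm (vproj V ((graph_map phi v')^-1 * graph_map phi v)%g)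
      <= L * knorm (hproj V ((graph_map phi v')^-1 * graph_map phi v)%g).

Definition intrinsic_lipschitz V (phi : heis R n -> heis R n) : Prop :=
  exists L, ilip_bound V phi L.

Definition ilip_constant V (phi : heis R n -> heis R n) : R :=
  inf [set L | ilip_bound V phi L].

(* Only the values of phi on V x {0} matter. *)
Definition ilip_graph (k : nat) (eta : R) (Gamma : set (heis R n)) : Prop :=
  exists V phi,
    [/\ horizontal k V, set_fun (hsubgroup V) (vsubgroup V) phi,
        intrinsic_lipschitz V phi, ilip_constant V phi <= eta &
        Gamma = graph_map phi @` hsubgroup V].

Lemma orthprojP V (z : 'rV[R]_(n + n)) : orthproj V z \in V /\
  forall w, w \in V -> dotv (z - orthproj V z) w = 0.
Proof.
pose P := [set p | p \in V /\ forall w, w \in V -> dotv (z - p) w = 0].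
suff [p Pp] : exists p, P p by exact: (@getPex _ P (ex_intro _ p Pp)).
pose X := vbasis V.
have lin w : linear (dotv^~ w : 'rV[R]_(n + n) -> R^o).
  move=> a u v; rewrite /dotv scaler_sumr -big_split/=.
  by apply: eq_bigr => i _; rewrite !mxE mulrDl -mulrA.
pose f0 u : 'rV[R]_(\dim V) := \row_i dotv u X`_i.
have f0lin : linear f0.
  by move=> a u v; apply/rowP => i; rewrite !mxE lin.
pose fL := GRing.isLinear.Build _ _ _ _ f0 f0lin.
pose fl : {linear _ -> _} := HB.pack f0 fL.
pose f := linfun fl.
have fE u i : f u 0 i = dotv u X`_i by rewrite lfunE/= mxE.
have fperp u : f u = 0 -> forall w, w \in V -> dotv u w = 0.
  move=> fu0 w /coord_vbasis ->.
  have dotC a b : dotv a b = dotv b a :> R.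
    by apply: eq_bigr => i _; rewrite mulrC.
  have dot0 (v : 'rV[R]_(n + n)) : dotv 0 v = 0 :> R.
    by rewrite /dotv big1// => i _; rewrite mxE mul0r.
  rewrite dotC; elim/big_rec: _ => [//|i v _ v0].
  by rewrite lin v0 addr0 dotC -fE fu0 mxE scaler0.
have inj : (V :&: lker f = 0)%VS.
  apply/eqP; rewrite -subv0; apply/subvP => u.
  rewrite memv_cap memv_ker memv0 => /andP[uV /eqP fu0].
  by apply/eqP/dotvv_eq0/fperp.
have full : (f @: V = fullv)%VS.
  apply/eqP; rewrite eqEdim subvf/=.
  by rewrite limg_dim_eq// dimvf /dim/= mul1n.
have : f z \in (f @: V)%VS by rewrite full memvf.
move=> /memv_imgP[p pV fzp]; exists p; split => // w wV.
by apply: fperp wV; rewrite linearB/= fzp subrr.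
Qed.

End Projections.

Section CoronaDecompositions.
Context {R : realType} {n k : nat} {E : set (heis R n)}.
Variable Dy : dyadic_system k E.

Definition corona_ilg : Prop :=
  forall eta : R, 0 < eta -> exists2 C : R, 0 < C &
  exists G B F, coronization Dy C G B F /\
  forall S, F S -> exists2 Gamma, ilip_graph k eta Gamma &
  forall Q x, S Q -> E x -> (dist_set x Q <= diam Q)%E ->
    (dist_set x Gamma <= eta%:E * diam Q)%E.

Definition corona_planes (K0 : R) : Prop :=
  forall eta : R, 0 < eta -> exists2 C : R, 0 < C &
  exists G B F, coronization Dy C G B F /\
  forall S, F S -> exists a V, horizontal k V /\
  forall x y, dilate E K0 (top S) x -> dilate E K0 (top S) y ->
    (eta%:E * Order.min (tree_height S x) (tree_height S y)
      < (mdist x y)%:E)%E ->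
    mdist x y <= (1 + 2 * eta) * mdist (affproj a V x) (affproj a V y).

End CoronaDecompositions.

(* Main.v *)
Require Import Defs.
From mathcomp Require Import all_boot all_order all_algebra.
From mathcomp Require Import all_classical all_reals all_analysis.
From mathcomp Require Import ring lra zify.

Set Implicit Arguments.
Unset Strict Implicit.
Unset Printing Implicit Defensive.

Import Order.TTheory GRing.Theory Num.Theory.
Import numFieldNormedType.Exports.
Local Open Scope classical_set_scope.
Local Open Scope ring_scope.

(** Coordinates. For an isotropic subspace V a point of the group is written
    v.(w, t) with v in V, w orthogonal to V and t real. Up to constants, q^-1 p
    projects onto V with length |v_p - v_q|, and onto the complementary subgroup
    with size |w_p - w_q| plus the square root of |defect p q|, where [defect] is
    an explicit twisted difference of the heights t. Being small relative to V is
    thus the relation [cone], which composes ([cone_trans]). Since V is isotropic,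
    distances between projections to an affine plane only depend on the direction
    of the plane ([affproj_dist]).

    From planes to graphs. The coronization is not changed. The separation
    inequality says that the points near the top of a tree lie in cones of small
    aperture of each other, up to errors of the size of the height function of the
    tree ([cone_planar], [cone_near]). What is needed is therefore a Whitney type
    extension theorem for intrinsic Lipschitz data given up to a height function,
    [lipschitz_extension], in which the extension misses each point by a small
    multiple of its height.

    Its proof glues the horizontal planes through suitable data points by a
    partition of unity on V that varies at the scale H of the heights. The average
    of the vertical parts w is Lipschitz, but the resulting section is not
    horizontal: its defect is only differentiable, with a small gradient q
    ([glued_gradient]). Since V is isotropic, the complex structure J maps it into
    its orthogonal complement, and 2 omega (v, J q) is the inner product of v and
    q; replacing w by w - J q removes the first-order part of the defect. That q is
    Lipschitz follows by comparing the expansions of the defect at three points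
    ([horizontal_section]). Points that are far apart compared with H are compared
    through the data, by the composition of cones. Heights that vanish are reached
    by an ultrafilter limit.

    From graphs to planes. A graph of constant L over V projects to V almost
    isometrically ([ilip_graph_dist]), so that two points x, y which a graph
    approximates with an error small compared with d(x, y) satisfy the required
    inequality for the direction V. A cube of the tree near x and y with diameter
    comparable to d(x, y) exists when d(x, y) is not small compared with the height
    ([intermediate_cube]), provided that x and y are near the top of the tree. The
    points of the enlarged top are not, so the large cubes are removed from each
    tree ([pruned_coronization]), which replaces the tree by the trees below the
    maximal remaining cubes. The cubes concerned have diameters comparable to that
    of the old top, and a cube contains boundedly many cubes of comparable
    diameter ([cube_count]); hence the packing conditions persist. *)

(** * Euclidean and symplectic geometry of the horizontal space *)

Section Dot.
Context {R : realType} {m : nat}.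
Implicit Types (z w u : 'rV[R]_m) (a : R).

Lemma dotvC z w : dotv z w = dotv w z.
Proof. by apply: eq_bigr => i _; rewrite mulrC. Qed.

Lemma dotvDl z u w : dotv (z + u) w = dotv z w + dotv u w.
Proof. by rewrite /dotv -big_split; apply: eq_bigr => i _; rewrite mxE mulrDl. Qed.

Lemma dotvZl a z w : dotv (a *: z) w = a * dotv z w.
Proof. by rewrite /dotv mulr_sumr; apply: eq_bigr => i _; rewrite mxE mulrA. Qed.

Lemma dotvNl z w : dotv (- z) w = - dotv z w.
Proof. by rewrite -scaleN1r dotvZl mulN1r. Qed.

Lemma dotvDr z u w : dotv z (u + w) = dotv z u + dotv z w.
Proof. by rewrite dotvC dotvDl !(dotvC z). Qed.

Lemma dotvZr a z w : dotv z (a *: w) = a * dotv z w.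
Proof. by rewrite dotvC dotvZl dotvC. Qed.

Lemma dotvNr z w : dotv z (- w) = - dotv z w.
Proof. by rewrite dotvC dotvNl dotvC. Qed.

Lemma dotv0l z : dotv 0 z = 0.
Proof. by rewrite -(scale0r 0) dotvZl mul0r. Qed.

Lemma dotv0r z : dotv z 0 = 0.
Proof. by rewrite dotvC dotv0l. Qed.

Definition enorm z : R := Num.sqrt (dotv z z).

Lemma enorm_ge0 z : 0 <= enorm z. Proof. exact: sqrtr_ge0. Qed.

Lemma enorm2 z : enorm z ^+ 2 = dotv z z.
Proof. by rewrite sqr_sqrtr ?dotvv_ge0. Qed.

Lemma enorm0 : enorm 0 = 0. Proof. by rewrite /enorm dotv0l sqrtr0. Qed.

Lemma enormN z : enorm (- z) = enorm z.
Proof. by rewrite /enorm dotvNl dotvNr opprK. Qed.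

Lemma enormB z w : enorm (z - w) = enorm (w - z).
Proof. by rewrite -enormN opprB. Qed.

Lemma enormZ a z : enorm (a *: z) = `|a| * enorm z.
Proof.
by rewrite /enorm dotvZl dotvZr mulrA -expr2 sqrtrM ?sqr_ge0// sqrtr_sqr.
Qed.

Lemma enorm_eq0 z : enorm z = 0 -> z = 0.
Proof. by move=> z0; apply: dotvv_eq0; rewrite -enorm2 z0 expr0n. Qed.

Lemma enorm_le z (r : R) : 0 <= r -> dotv z z <= r ^+ 2 -> enorm z <= r.
Proof.
by move=> r0 zr; rewrite -(ler_pXn2r (ltn0Sn 1)) ?nnegrE ?enorm_ge0// enorm2.
Qed.

Lemma dotv_le z w : `|dotv z w| <= enorm z * enorm w.
Proof.
have [->|z0] := eqVneq z 0; first by rewrite dotv0l enorm0 mul0r normr0.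
have pos : 0 < dotv z z.
  by rewrite lt_def dotvv_ge0 andbT; apply: contra_neq z0; exact: dotvv_eq0.
rewrite -(ler_pXn2r (ltn0Sn 1)) ?nnegrE ?mulr_ge0 ?enorm_ge0//.
rewrite exprMn !enorm2 real_normK ?num_real//.
have := dotvv_ge0 (dotv z z *: w - dotv z w *: z).
rewrite !(dotvDl, dotvDr, dotvNl, dotvNr, dotvZl, dotvZr) (dotvC w z).
set a := dotv z z in pos *; set p := dotv z w; set b := dotv w w => h.
by rewrite -(ler_pM2l pos); nra.
Qed.

Lemma enormD z w : enorm (z + w) <= enorm z + enorm w.
Proof.
apply: enorm_le; first by rewrite addr_ge0 ?enorm_ge0.
rewrite dotvDl !dotvDr (dotvC w z) sqrrD !enorm2.
have := le_trans (ler_norm _) (dotv_le z w); lra.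
Qed.

Lemma enorm_triangle u z w : enorm (z - w) <= enorm (z - u) + enorm (u - w).
Proof. by rewrite -{1}(subrK u z) -addrA enormD. Qed.

Lemma enorm_sum (I : Type) (s : seq I) (P : pred I) (F : I -> 'rV[R]_m) :
  enorm (\sum_(i <- s | P i) F i) <= \sum_(i <- s | P i) enorm (F i).
Proof.
elim/big_rec2: _ => [|i a u _ ih]; first by rewrite enorm0.
by rewrite (le_trans (enormD _ _)) ?lerD2l.
Qed.

Lemma coord_le_enorm z i : `|z 0 i| <= enorm z.
Proof.
rewrite -(ler_pXn2r (ltn0Sn 1)) ?nnegrE ?enorm_ge0// enorm2 real_normK ?num_real//.
rewrite /dotv (bigD1 i)//= expr2 lerDl sumr_ge0// => j _.
by rewrite -expr2 sqr_ge0.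
Qed.

Lemma enorm_le_coord z (r : R) : (forall i, `|z 0 i| <= r) ->
  enorm z ^+ 2 <= m%:R * r ^+ 2.
Proof.
move=> zr; rewrite enorm2 mulr_natl -[leRHS](_ : \sum_(i < m) r ^+ 2 = _).
  apply: ler_sum => i _; rewrite -expr2 -(real_normK (num_real (z 0 i))).
  by rewrite ler_pXn2r ?nnegrE// (le_trans _ (zr i)).
by rewrite sumr_const card_ord.
Qed.

End Dot.

Section Symplectic.
Context {R : realType} {n : nat}.
Implicit Types (z w u : 'rV[R]_(n + n)) (a : R).

Lemma omegaZl a z w : omega (a *: z) w = a * omega z w.
Proof.
rewrite /omega [RHS]mulrCA; congr (_ * _); rewrite mulr_sumr; apply: eq_bigr => i _.
by rewrite !mxE; ring.
Qed.

Lemma omegaZr a z w : omega z (a *: w) = a * omega z w.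
Proof. by rewrite omega_anti omegaZl -mulrN -omega_anti. Qed.

Lemma omega_sumr (I : Type) (s : seq I) (F : I -> 'rV[R]_(n + n)) z :
  omega z (\sum_(i <- s) F i) = \sum_(i <- s) omega z (F i).
Proof.
by apply: (big_morph (omega z)) => [u w|]; rewrite ?omegaDr ?omega0r.
Qed.

Lemma omega_le z w : `|omega z w| <= 2^-1 * (enorm z * enorm w).
Proof.
have h := dot_omega_le z w.
suff : `|2 * omega z w| <= enorm z * enorm w by rewrite normrM gtr0_norm//; lra.
rewrite -(ler_pXn2r (ltn0Sn 1)) ?nnegrE ?mulr_ge0 ?enorm_ge0//.
rewrite exprMn !enorm2 real_normK ?num_real//.
by apply: le_trans h; rewrite lerDr sqr_ge0.
Qed.

(** The complex structure that turns [omega] into half the inner product; it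
    maps an isotropic subspace into its orthogonal complement. *)
Definition cplx z : 'rV[R]_(n + n) := row_mx (- rsubmx z) (lsubmx z).

Lemma dotv_cplx z w : dotv (cplx z) w = 2 * omega z w.
Proof.
rewrite /omega mulrA divff// mul1r dotv_split; apply: eq_bigr => i _.
by rewrite row_mxEl row_mxEr !mxE mulNr addrC.
Qed.

Lemma cplxD z w : cplx (z + w) = cplx z + cplx w.
Proof. by rewrite /cplx add_row_mx -opprD !linearD. Qed.

Lemma cplxN z : cplx (- z) = - cplx z.
Proof. by rewrite /cplx opp_row_mx !linearN. Qed.

Lemma cplx_cplx z : cplx (cplx z) = - z.
Proof. by rewrite /cplx row_mxKl row_mxKr -opp_row_mx hsubmxK. Qed.

Lemma dotv_cplx2 z w : dotv (cplx z) (cplx w) = dotv z w.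
Proof.
by rewrite dotv_cplx omega_anti mulrN -dotv_cplx cplx_cplx dotvNl opprK dotvC.
Qed.

Lemma enorm_cplx z : enorm (cplx z) = enorm z.
Proof. by rewrite /enorm dotv_cplx2. Qed.

Lemma omega_cplxr z w : 2 * omega z (cplx w) = dotv z w.
Proof. by rewrite -dotv_cplx dotv_cplx2. Qed.

End Symplectic.

(** * Orthogonal projections *)

Section Orthproj.
Context {R : realType} {n : nat}.
Variable V : {vspace 'rV[R]_(n + n)}.
Implicit Types (z w p : 'rV[R]_(n + n)).

Lemma orthproj_in z : orthproj V z \in V. Proof. by case: (orthprojP V z). Qed.

Lemma dotv_perp z w : w \in V -> dotv (z - orthproj V z) w = 0.
Proof. by case: (orthprojP V z) => _; apply. Qed.

Lemma dotv_orthproj z w : w \in V -> dotv (orthproj V z) w = dotv z w.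
Proof.
move=> wV; apply/esym/eqP; rewrite -subr_eq0 -dotvNl -dotvDl.
by rewrite dotv_perp.
Qed.

Lemma orthproj_unique z p : p \in V ->
  (forall w, w \in V -> dotv (z - p) w = 0) -> orthproj V z = p.
Proof.
move=> pV zp; apply/eqP; rewrite -subr_eq0; apply/eqP/dotvv_eq0.
have dV : orthproj V z - p \in V by rewrite memvB// orthproj_in.
rewrite {1}(_ : orthproj V z - p = (z - p) - (z - orthproj V z)).
  by rewrite dotvDl dotvNl zp// dotv_perp// subrr.
by apply/rowP => i; rewrite !mxE; ring.
Qed.

Lemma orthprojB z w : orthproj V (z - w) = orthproj V z - orthproj V w.
Proof.
apply: orthproj_unique; first by rewrite memvB// orthproj_in.
move=> u uV; rewrite (_ : _ - _ = (z - orthproj V z) - (w - orthproj V w)).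
  by rewrite dotvDl dotvNl !dotv_perp// subrr.
by apply/rowP => i; rewrite !mxE; ring.
Qed.

Lemma pythagoras z :
  dotv z z = dotv (orthproj V z) (orthproj V z)
    + dotv (z - orthproj V z) (z - orthproj V z).
Proof.
have zp := dotv_perp z (orthproj_in z).
move: (orthproj V z) zp => p; rewrite dotvDl dotvNl => zp.
by rewrite !(dotvDl, dotvDr, dotvNl, dotvNr) (dotvC p z); lra.
Qed.

Lemma enorm_orthproj z : enorm (orthproj V z) <= enorm z.
Proof.
apply: enorm_le; first exact: enorm_ge0.
by rewrite enorm2 [leRHS]pythagoras lerDl dotvv_ge0.
Qed.

End Orthproj.

(** * Points of a complementary splitting and their quasi-distance *)

(** The coordinates of the point v.(w, t), where v runs through an isotropic
    subspace and (w, t) through the complementary vertical subgroup. *)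
Record gpt (R : realType) (n : nat) :=
  GPt { pv : 'rV[R]_(n + n); pw : 'rV[R]_(n + n); pt : R }.

Section Cone.
Context {R : realType} {n : nat}.
Implicit Types (p q o : gpt R n) (L r : R).

(** The vertical coordinate of the projection of q^-1 p to the complementary
    subgroup: it vanishes when p and q lie on a common translate of V. *)
Definition defect p q : R :=
  pt p - pt q + 2 * omega (pv p - pv q) (pw q) - omega (pw q) (pw p).

(** The point p lies in the intrinsic cone of aperture about L with vertex q,
    up to errors at scale r: this is the relation in which both the hypothesis
    and the conclusion of the extension theorem are phrased. *)
Definition cone L r p q : Prop :=
  [/\ enorm (pv p - pv q) <= r, enorm (pw p - pw q) <= L * r &
      `|defect p q| <= L * r ^+ 2].

Lemma cone_ge0 L r p q : cone L r p q -> 0 <= r.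
Proof. by case=> h _ _; rewrite (le_trans (enorm_ge0 _) h). Qed.

Lemma defect_chain p o q : defect p q = defect p o + defect o q
  + 2 * omega (pv p - pv o) (pw q - pw o)
  + omega (pw o - pw q) (pw p - pw o).
Proof.
rewrite /defect !(omegaDl, omegaDr, omegaNl, omegaNr) omegaxx.
by ring.
Qed.

Lemma defect_swap p q : defect q p =
  - defect p q + 2 * omega (pv p - pv q) (pw q - pw p).
Proof.
rewrite /defect !(omegaDl, omegaDr, omegaNl, omegaNr) (omega_anti (pw p)).
by ring.
Qed.

(** The radii add up exactly because the twisting terms in [defect_chain] are
    absorbed by the mixed term of (r + r') ^ 2. *)
Lemma cone_trans L r r' o p q : 0 <= L <= 1 ->
  cone L r p o -> cone L r' o q -> cone L (r + r') p q.
Proof.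
move=> /andP[L0 L1] po oq.
have r0 := cone_ge0 po; have r'0 := cone_ge0 oq.
case: po => v1 w1 d1; case: oq => v2 w2 d2; split.
- by rewrite (le_trans (enorm_triangle (pv o) _ _))// lerD.
- by rewrite (le_trans (enorm_triangle (pw o) _ _))// mulrDr lerD.
rewrite (defect_chain p o q).
have h1 : `|2 * omega (pv p - pv o) (pw q - pw o)| <= L * (r * r').
  rewrite normrM gtr0_norm//.
  have := omega_le (pv p - pv o) (pw q - pw o).
  have : enorm (pv p - pv o) * enorm (pw q - pw o) <= r * (L * r').
    by rewrite ler_pM ?enorm_ge0// enormB.
  lra.
have h2 : `|omega (pw o - pw q) (pw p - pw o)| <= L * (r * r').
  have := omega_le (pw o - pw q) (pw p - pw o).
  have : enorm (pw o - pw q) * enorm (pw p - pw o) <= (L * r') * (1 * r).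
    by rewrite ler_pM ?enorm_ge0// (le_trans w1)// ler_wpM2r.
  have : 0 <= L * (r * r') by rewrite !mulr_ge0.
  lra.
have := ler_normD (defect p o + defect o q
  + 2 * omega (pv p - pv o) (pw q - pw o)) (omega (pw o - pw q) (pw p - pw o)).
have := ler_normD (defect p o + defect o q)
  (2 * omega (pv p - pv o) (pw q - pw o)).
have := ler_normD (defect p o) (defect o q).
by rewrite sqrrD !mulrDr; lra.
Qed.

Lemma cone_le L r r' p q : 0 <= L -> r <= r' -> cone L r p q -> cone L r' p q.
Proof.
move=> L0 rr' pq; have r0 := cone_ge0 pq; case: pq => v1 w1 d1; split.
- exact: le_trans rr'.
- by rewrite (le_trans w1)// ler_wpM2l.
- by rewrite (le_trans d1)// ler_wpM2l// ler_pXn2r// nnegrE// (le_trans r0).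
Qed.

Lemma cone_sym L r p q : 0 <= L -> cone L r p q -> cone L (2 * r) q p.
Proof.
move=> L0 pq; have r0 := cone_ge0 pq.
case: pq => v1 w1 d1.
have Lr0 : 0 <= L * r by rewrite mulr_ge0.
split; [by rewrite enormB; lra|by rewrite enormB; lra|].
rewrite defect_swap exprMn.
have h1 : `|2 * omega (pv p - pv q) (pw q - pw p)| <= L * r ^+ 2.
  rewrite normrM gtr0_norm//.
  have := omega_le (pv p - pv q) (pw q - pw p).
  have : enorm (pv p - pv q) * enorm (pw q - pw p) <= r * (L * r).
    by rewrite ler_pM ?enorm_ge0// enormB.
  rewrite expr2; lra.
have := ler_normD (- defect p q) (2 * omega (pv p - pv q) (pw q - pw p)).
rewrite normrN; have : 0 <= L * r ^+ 2 by rewrite mulr_ge0 ?sqr_ge0.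
lra.
Qed.

Lemma cone_rescale L r c p q : 0 <= L -> 0 <= r -> 1 <= c ->
  enorm (pv p - pv q) <= r -> cone L (c * r) p q -> cone (c ^+ 2 * L) r p q.
Proof.
move=> L0 r0 c1 v1 [_ w1 d1]; split => //.
- apply: le_trans w1 _; rewrite mulrA ler_wpM2r// mulrC ler_wpM2r//.
  by rewrite expr2 ler_peMr// (le_trans ler01).
- by apply: le_trans d1 _; rewrite exprMn mulrA (mulrC L).
Qed.

End Cone.

(** * Packing *)

Section Packing.
Context {R : realType}.

Lemma truncn_near (x y : R) : 0 <= x -> 0 <= y ->
  Num.truncn x = Num.truncn y -> `|x - y| <= 1.
Proof.
move=> x0 y0 xy; have /andP[] := truncn_itv x0; have /andP[] := truncn_itv y0.
by rewrite xy -natr1 ler_norml => *; apply/andP; split; lra.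
Qed.

(** Sorting the points into the cells of a grid of mesh r / (m + 1) leaves at
    most one point in each cell. *)
Lemma euclidean_packing (m : nat) (a : R) : exists N : nat,
  forall (s : seq 'rV[R]_m) (y : 'rV[R]_m) (r : R), 0 < r -> uniq s ->
    {in s, forall x, enorm (x - y) <= a * r} ->
    {in s &, forall x x', x != x' -> r <= enorm (x - x')} -> (size s <= N)%N.
Proof.
pose K := (Num.truncn (2 * a * m.+1%:R)).+1.
exists #|{ffun 'I_m -> 'I_K}| => s y r r0 us sy ss.
have m0 : 0 < m.+1%:R :> R by rewrite ltr0n.
pose c (x : 'rV[R]_m) i := ((x - y) 0 i + a * r) * (m.+1%:R / r).
have c0 x i : x \in s -> 0 <= c x i.
  move=> /sy xy; apply: mulr_ge0; last by rewrite divr_ge0 ?ltW.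
  by have := coord_le_enorm (x - y) i; rewrite ler_norml => /andP[+ _]; lra.
have cK x i : x \in s -> (Num.truncn (c x i) < K)%N.
  move=> xs; rewrite ltnS le_truncn//.
  have xy := sy _ xs.
  have := coord_le_enorm (x - y) i; rewrite ler_norml => /andP[_ h].
  apply: (@le_trans _ _ ((2 * (a * r)) * (m.+1%:R / r))).
    apply: ler_wpM2r; first by rewrite divr_ge0 ?ltW.
    by lra.
  by rewrite le_eqVlt; apply/orP; left; apply/eqP; field; rewrite gt_eqF.
pose f (x : 'rV[R]_m) : {ffun 'I_m -> 'I_K} :=
  [ffun i => inord (Num.truncn (c x i))].
have finj : {in s &, injective f}.
  move=> x x' xs xs' fxx'; apply/eqP; apply: contraT => xx'.
  have := ss _ _ xs xs' xx'; rewrite leNgt => /negP; case.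
  have cl i : `|(x - x') 0 i| <= r / m.+1%:R.
    move/ffunP/(_ i): fxx'; rewrite !ffunE => /(congr1 val).
    rewrite /= !inordK ?cK// => /truncn_near.
    move=> /(_ (c0 _ _ xs) (c0 _ _ xs')).
    rewrite /c -mulrBl normrM (gtr0_norm (divr_gt0 m0 r0)).
    rewrite (_ : _ - _ = (x - x') 0 i); last by rewrite !mxE; ring.
    by rewrite -ler_pdivlMr ?divr_gt0// invf_div mul1r.
  have := enorm_le_coord cl; move=> h.
  rewrite -(ltr_pXn2r (ltn0Sn 1)) ?nnegrE ?enorm_ge0 ?ltW//.
  apply: le_lt_trans h _; rewrite expr_div_n mulrCA gtr_pMr ?exprn_gt0//.
  rewrite ltr_pdivrMr ?exprn_gt0// mul1r -natr1.
  by have := ler0n R m; nra.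
rewrite -(size_map f) -(card_uniqP _) ?max_card//.
by rewrite map_inj_in_uniq.
Qed.

End Packing.

(** * First-order Taylor expansions at a given scale *)

Section Jets.
Context {R : realType} {m : nat}.
Variables (D : set 'rV[R]_m) (y : 'rV[R]_m) (s : R).
Hypothesis s0 : 0 < s.
Implicit Types (f : 'rV[R]_m -> R) (A : R) (v : 'rV[R]_m).

(** On the points of D within s of y, the function f agrees with an affine
    function up to a quadratic error; all three bounds are normalised by the
    powers of s that make the constant A invariant under dilations. *)
Definition jet f A : Prop := `|f y| <= A /\
  exists2 g : 'rV[R]_m, enorm g * s <= A &
    forall v, D v -> enorm (v - y) <= s ->
      `|f v - f y - dotv g (v - y)| * s ^+ 2 <= A * enorm (v - y) ^+ 2.

Lemma jet_ge0 f A : jet f A -> 0 <= A.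
Proof. by case=> h _; exact: le_trans h. Qed.

Lemma jet_le f A A' : A <= A' -> jet f A -> jet f A'.
Proof.
move=> AA' [f0 [g g0 fg]]; split; first exact: le_trans AA'.
exists g; first exact: le_trans AA'.
by move=> v Dv vs; rewrite (le_trans (fg _ Dv vs))// ler_wpM2r// sqr_ge0.
Qed.

Lemma eq_jet f f' A : D y -> (forall v, D v -> enorm (v - y) <= s -> f v = f' v) ->
  jet f A -> jet f' A.
Proof.
move=> Dy ff'.
have yy : enorm (y - y) <= s by rewrite subrr enorm0 ltW.
move=> [f0 [g g0 fg]]; split; first by rewrite -ff'.
by exists g => // v Dv vs; rewrite -!ff'//; exact: fg.
Qed.

Lemma jet0 : jet (fun=> 0) 0.
Proof.
split; first by rewrite normr0.
exists 0; first by rewrite enorm0 mul0r.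
by move=> v _ _; rewrite dotv0l !subr0 normr0 !mul0r.
Qed.

Lemma jet_cst c : jet (fun=> c) `|c|.
Proof.
split => //; exists 0; first by rewrite enorm0 mul0r.
by move=> v _ _; rewrite dotv0l subrr !subr0 normr0 !mul0r mulr_ge0 ?sqr_ge0.
Qed.

Lemma jetD f f' A A' : jet f A -> jet f' A' -> jet (fun v => f v + f' v) (A + A').
Proof.
move=> [f0 [g g0 fg]] [f0' [g' g0' fg']]; split.
  by rewrite (le_trans (ler_normD _ _))// lerD.
exists (g + g').
  by rewrite (le_trans _ (lerD g0 g0'))// -mulrDl ler_wpM2r ?enormD// ltW.
move=> v Dv vs.
rewrite (_ : _ - _ = (f v - f y - dotv g (v - y))
  + (f' v - f' y - dotv g' (v - y))); last by rewrite dotvDl; ring.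
rewrite mulrDl (le_trans _ (lerD (fg _ Dv vs) (fg' _ Dv vs)))// -mulrDl.
by rewrite ler_wpM2r ?sqr_ge0// ler_normD.
Qed.

Lemma jet_sum (I : Type) (r : seq I) (f : I -> 'rV[R]_m -> R) (A : I -> R) :
  (forall i, jet (f i) (A i)) ->
  jet (fun v => \sum_(i <- r) f i v) (\sum_(i <- r) A i).
Proof.
move=> fA; elim: r => [|i r ih].
  rewrite big_nil (_ : (fun _ => _) = fun=> 0); first exact: jet0.
  by apply: funext => v; rewrite big_nil.
rewrite big_cons (_ : (fun _ => _) = fun v => f i v + \sum_(i <- r) f i v).
  exact: jetD.
by apply: funext => v; rewrite big_cons.
Qed.

Lemma jet_linear g : jet (fun v => dotv g (v - y)) (enorm g * s).
Proof.
split; first by rewrite subrr dotv0r normr0 mulr_ge0 ?enorm_ge0// ltW.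
exists g => // v _ _.
rewrite subrr dotv0r subr0 subrr normr0 mul0r.
by rewrite !mulr_ge0 ?enorm_ge0 ?exprn_ge0 ?enorm_ge0// ltW.
Qed.

Lemma jet_var f A v : jet f A -> D v -> enorm (v - y) <= s ->
  `|f v - f y| * s <= 2 * A * enorm (v - y).
Proof.
move=> fA Dv vs; have A0 := jet_ge0 fA; case: fA => f0 [g g0 fg].
have h := fg v Dv vs; set x := enorm (v - y) in h vs *.
have x0 : 0 <= x := enorm_ge0 _.
have h1 : `|f v - f y - dotv g (v - y)| * s <= A * x.
  rewrite -(ler_pM2r s0) -mulrA -expr2 (le_trans h)// expr2 mulrA.
  by rewrite ler_wpM2l// mulr_ge0.
have h2 : `|dotv g (v - y)| * s <= A * x.
  apply: le_trans (_ : enorm g * x * s <= _).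
    by rewrite ler_wpM2r ?dotv_le// ltW.
  by rewrite mulrAC ler_wpM2r.
apply: le_trans (_ : (`|f v - f y - dotv g (v - y)| + `|dotv g (v - y)|) * s <= _).
  by rewrite ler_wpM2r ?(ltW s0)// (le_trans _ (ler_normD _ _))// subrK.
by rewrite mulrDl; lra.
Qed.

Lemma jetM f f' A A' : jet f A -> jet f' A' ->
  jet (fun v => f v * f' v) (6 * (A * A')).
Proof.
move=> fA fA'; have A0 := jet_ge0 fA; have A'0 := jet_ge0 fA'.
have var := jet_var fA; have var' := jet_var fA'.
have AA' : 0 <= A * A' by rewrite mulr_ge0.
case: fA => f0 [g g0 fg]; case: fA' => f0' [g' g0' fg']; split.
  rewrite normrM; have : `|f y| * `|f' y| <= A * A' by rewrite ler_pM.
  lra.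
exists (f y *: g' + f' y *: g).
  apply: le_trans (_ : (`|f y| * enorm g' + `|f' y| * enorm g) * s <= _).
    by rewrite ler_wpM2r ?(ltW s0)// -!enormZ enormD.
  rewrite mulrDl -!mulrA.
  have : `|f y| * (enorm g' * s) <= A * A'.
    by rewrite ler_pM// mulr_ge0 ?enorm_ge0// ltW.
  have : `|f' y| * (enorm g * s) <= A' * A.
    by rewrite ler_pM// mulr_ge0 ?enorm_ge0// ltW.
  by rewrite (mulrC A'); lra.
move=> v Dv vs.
have {}var := var v Dv vs; have {}var' := var' v Dv vs.
have {}fg := fg v Dv vs; have {}fg' := fg' v Dv vs.
have x0 : 0 <= enorm (v - y) := enorm_ge0 _.
rewrite dotvDl !dotvZl; move: (enorm (v - y)) x0 vs var var' fg fg' => x x0 vs.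
move: (dotv g _) (dotv g' _) => d d' var var' fg fg'.
rewrite (_ : _ - _ = (f v - f y) * (f' v - f' y) + f y * (f' v - f' y - d')
  + f' y * (f v - f y - d)); last by ring.
have h1 : `|(f v - f y) * (f' v - f' y)| * s ^+ 2 <= 4 * (A * A') * x ^+ 2.
  rewrite normrM expr2 mulrACA (_ : 4 * _ * _ = (2 * A * x) * (2 * A' * x)); last by ring.
  by rewrite ler_pM// mulr_ge0// ltW.
have h2 : `|f y * (f' v - f' y - d')| * s ^+ 2 <= A * A' * x ^+ 2.
  by rewrite normrM -!mulrA ler_pM// mulr_ge0// exprn_ge0// ltW.
have h3 : `|f' y * (f v - f y - d)| * s ^+ 2 <= A * A' * x ^+ 2.
  by rewrite (mulrC A) normrM -!mulrA ler_pM// mulr_ge0// exprn_ge0// ltW.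
move: (_ * (_ - _)) (f y * _) (f' y * _) h1 h2 h3 => e1 e2 e3 h1 h2 h3.
apply: le_trans (_ : (`|e1| + `|e2| + `|e3|) * s ^+ 2 <= _).
  rewrite ler_wpM2r ?sqr_ge0// (le_trans (ler_normD _ _))// lerD2r.
  exact: ler_normD.
by rewrite !mulrDl; lra.
Qed.

Lemma jetV f A : D y -> (forall v, D v -> enorm (v - y) <= s -> 2^-1 <= f v) ->
  1 <= A -> jet f A -> jet (fun v => (f v)^-1) (24 * A ^+ 2).
Proof.
move=> Dy f2 A1 fA; have A0 := jet_ge0 fA.
have var := jet_var fA.
have fy2 : 2^-1 <= f y by apply: f2 => //; rewrite subrr enorm0 ltW.
have A2 : 1 <= A ^+ 2 by rewrite exprn_ege1.
have inv2 v : 2^-1 <= f v -> 0 < (f v)^-1 <= 2.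
  move=> h; rewrite invr_gt0 (lt_le_trans _ h) ?invr_gt0//=.
  by rewrite -[leRHS]invrK lef_pV2// posrE ?invr_gt0// (lt_le_trans _ h) ?invr_gt0.
have /andP[iy0 iy2] := inv2 _ fy2.
have fy0 : f y != 0 by rewrite gt_eqF// (lt_le_trans _ fy2) ?invr_gt0.
case: fA => fyA [g g0 fg]; split; first by rewrite gtr0_norm//; lra.
have iyy : (f y)^-1 ^+ 2 <= 4 by rewrite expr2; nra.
exists (- (f y)^-1 ^+ 2 *: g).
  rewrite enormZ normrN normrX (gtr0_norm iy0) -mulrA.
  apply: (@le_trans _ _ (4 * A)); last by rewrite expr2; nra.
  by rewrite ler_pM ?exprn_ge0 ?(ltW iy0)// mulr_ge0 ?enorm_ge0// ltW.
move=> v Dv vs; have {}var := var v Dv vs; have {}fg := fg v Dv vs.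
have fv2 := f2 v Dv vs; have /andP[iv0 iv2] := inv2 _ fv2.
have fv0 : f v != 0 by rewrite gt_eqF// (lt_le_trans _ fv2) ?invr_gt0.
have x0 : 0 <= enorm (v - y) := enorm_ge0 _.
have dg : `|dotv g (v - y)| * s <= A * enorm (v - y).
  apply: le_trans (_ : enorm g * enorm (v - y) * s <= _).
    by rewrite ler_wpM2r ?dotv_le// ltW.
  by rewrite mulrAC ler_wpM2r.
rewrite dotvZl; move: (enorm (v - y)) x0 vs var fg dg => x x0 vs.
move: (dotv g _) => d var fg dg.
rewrite (_ : _ - _ = (f v)^-1 * (f y)^-1 ^+ 2 *
   (- (f y * (f v - f y - d)) + d * (f v - f y))); last by field; rewrite fv0 fy0.
rewrite normrM.
have c8 : `|(f v)^-1 * (f y)^-1 ^+ 2| <= 8.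
  rewrite gtr0_norm; last by rewrite mulr_gt0// exprn_gt0.
  rewrite (_ : 8 = 2 * 4); last by ring.
  by rewrite ler_pM// ?exprn_ge0// ltW.
have h1 : `|f y * (f v - f y - d)| * s ^+ 2 <= A ^+ 2 * x ^+ 2.
  by rewrite normrM (expr2 A) -!mulrA ler_pM// mulr_ge0// sqr_ge0.
have h2 : `|d * (f v - f y)| * s ^+ 2 <= 2 * A ^+ 2 * x ^+ 2.
  rewrite normrM expr2 mulrACA (_ : _ * _ * _ = (A * x) * (2 * A * x)); last by ring.
  by rewrite ler_pM// mulr_ge0// ltW.
rewrite -[leLHS]mulrA [leRHS](_ : _ = 8 * (3 * A ^+ 2 * x ^+ 2)); last by ring.
apply: ler_pM => //; first by rewrite mulr_ge0 ?sqr_ge0.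
apply: le_trans (_ : (`|f y * (f v - f y - d)| + `|d * (f v - f y)|) * s ^+ 2 <= _).
  by rewrite ler_wpM2r ?sqr_ge0// (le_trans (ler_normD _ _))// normrN.
by rewrite mulrDl; lra.
Qed.

End Jets.

(** * Cutoff functions *)

Section Cutoff.
Context {R : realType} {m : nat}.
Implicit Types (b v y : 'rV[R]_m).

Definition cutoff b (r : R) v : R := Num.max 0 (1 - (enorm (v - b) / r) ^+ 2) ^+ 2.

Lemma cutoff_ge0 b r v : 0 <= cutoff b r v. Proof. exact: sqr_ge0. Qed.

Lemma cutoff_out b r v : 0 < r -> r <= enorm (v - b) -> cutoff b r v = 0.
Proof.
move=> r0 rv; rewrite /cutoff max_l ?expr0n//.
by rewrite subr_le0 exprn_ege1// ler_pdivlMr// mul1r.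
Qed.

Lemma cutoff_in b r v : 0 < r -> enorm (v - b) <= r / 2 -> 2^-1 <= cutoff b r v.
Proof.
move=> r0 rv; rewrite /cutoff.
have h : (enorm (v - b) / r) ^+ 2 <= 4^-1.
  rewrite (_ : 4^-1 = (2^-1) ^+ 2); last by field.
  rewrite ler_pXn2r ?nnegrE ?divr_ge0 ?enorm_ge0 ?(ltW r0)//.
  by rewrite ler_pdivrMr// mulrC.
rewrite max_r; last by rewrite subr_ge0 (le_trans h)//; lra.
set x := _ ^+ 2 in h *; have : 3 / 4 <= 1 - x by lra.
by nra.
Qed.

Lemma sqr_pos_part_taylor (x x' : R) :
  `|Num.max 0 x' ^+ 2 - Num.max 0 x ^+ 2 - 2 * Num.max 0 x * (x' - x)|
    <= (x' - x) ^+ 2.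
Proof.
have p0 (z : R) : (Num.max 0 z = z /\ 0 <= z) \/ (Num.max 0 z = 0 /\ z <= 0).
  by case: (leP 0 z) => h; [left|right; split => //; exact: ltW].
have sq := sqr_ge0 (x' - x).
by case: (p0 x) => [[-> x0]|[-> x0]]; case: (p0 x') => [[-> x0']|[-> x0']];
  rewrite ler_norml; apply/andP; split; nra.
Qed.

(** As r is at least s / 2, the derivatives of the cutoff at scale s are bounded;
    2000 is a crude bound. *)
Lemma cutoff_jet (D : set 'rV[R]_m) y b (s r : R) : 0 < s -> s / 2 <= r ->
  enorm (y - b) <= 4 * s -> jet D y s (cutoff b r) 2000.
Proof.
move=> s0 sr yb.
have r0 : 0 < r by lra.
have qr : s / r <= 2 by rewrite ler_pdivrMr//; lra.
have q0 : 0 <= s / r by rewrite divr_ge0// ltW.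
pose X v : R := 1 - (enorm (v - b) / r) ^+ 2.
have X1 v : X v <= 1 by rewrite /X lerBlDr lerDl sqr_ge0.
have P0 v : 0 <= Num.max 0 (X v) <= 1.
  by rewrite le_max lexx/= ge_max ler01 X1.
have /andP[P0y P1y] := P0 y.
have by1 : `|cutoff b r y| <= 1.
  rewrite ger0_norm ?cutoff_ge0// /cutoff -/(X y) expr2.
  by nra.
split; first by rewrite (le_trans by1)//; lra.
pose P := Num.max 0 (X y).
exists ((- 4 * P / r ^+ 2) *: (y - b)).
  rewrite enormZ !normrM normrN normr_nat (ger0_norm P0y) normrV ?unitfE ?expf_neq0 ?gt_eqF//.
  rewrite (ger0_norm (sqr_ge0 r)).
  rewrite [leLHS](_ : _ = 4 * P * ((enorm (y - b) / r) * (s / r))); last first.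
    rewrite -/P.
    by field; rewrite gt_eqF.
  have : (enorm (y - b) / r) <= 8.
    rewrite ler_pdivrMr//; lra.
  have : 0 <= enorm (y - b) / r by rewrite divr_ge0 ?enorm_ge0// ltW.
  rewrite -/P in P0y P1y.
  move: (_ / r) (s / r) q0 qr => a c c0 c2 a0 a8.
  have : a * c <= 16 by nra.
  have : 0 <= a * c by rewrite mulr_ge0.
  by move: (a * c) => e; nra.
move=> v _ vs.
have x0 := enorm_ge0 (v - y).
pose d := (v - y).
have XE : X v - X y = - (2 * dotv (y - b) d + enorm d ^+ 2) / r ^+ 2.
  rewrite /X !expr_div_n !enorm2 (_ : v - b = (y - b) + d); last by rewrite /d; apply/rowP => i; rewrite !mxE; ring.
  move: (y - b) d => c d; rewrite dotvDl !dotvDr (dotvC d c); field.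
  by rewrite gt_eqF.
have T := sqr_pos_part_taylor (X y) (X v).
rewrite /cutoff -/(X v) -/(X y) -/P -/d dotvZl.
rewrite -/P in P0y P1y T; rewrite -/d in x0 vs.
rewrite (_ : _ - _ = (Num.max 0 (X v) ^+ 2 - P ^+ 2 - 2 * P * (X v - X y))
   - 2 * P * (enorm d ^+ 2 / r ^+ 2)); last first.
  by rewrite XE; field; rewrite gt_eqF.
set T1 := _ - 2 * P * (X v - X y) in T *.
have db := dotv_le (y - b) d.
have h1 : `|X v - X y| * s <= 36 * enorm d.
  rewrite XE mulNr normrN normrM normrV ?unitfE ?expf_neq0 ?gt_eqF//.
  rewrite (ger0_norm (sqr_ge0 r)) mulrAC.
  rewrite (_ : _ * s / r ^+ 2 = `|2 * dotv (y - b) d + enorm d ^+ 2| / s * (s / r) ^+ 2); last first.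
    by field; rewrite !gt_eqF.
  have h : `|2 * dotv (y - b) d + enorm d ^+ 2| / s <= 9 * enorm d.
    rewrite ler_pdivrMr//; have := ler_normD (2 * dotv (y - b) d) (enorm d ^+ 2).
    rewrite normrM (ger0_norm (sqr_ge0 _)) gtr0_norm//.
    have : enorm (y - b) * enorm d <= 4 * s * enorm d by rewrite ler_wpM2r.
    rewrite expr2; have : enorm d * enorm d <= s * enorm d by rewrite ler_wpM2r.
    by lra.
  have : (s / r) ^+ 2 <= 4 by rewrite expr2; clear -q0 qr; nra.
  have : 0 <= `|2 * dotv (y - b) d + enorm d ^+ 2| / s by rewrite divr_ge0// ltW.
  have : 0 <= (s / r) ^+ 2 by rewrite sqr_ge0.
  move: (_ / s) h ((s / r) ^+ 2) => e he c c0 e0 c4.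
  rewrite (_ : 36 * _ = 9 * enorm d * 4); last by ring.
  by rewrite ler_pM.
have h2 : (X v - X y) ^+ 2 * s ^+ 2 <= 1296 * enorm d ^+ 2.
  rewrite -(real_normK (num_real (X v - X y))) -!exprMn (_ : 1296 * _ = (36 * enorm d) ^+ 2); last by ring.
  by rewrite ler_pXn2r// nnegrE mulr_ge0// ltW.
have h3 : `|2 * P * (enorm d ^+ 2 / r ^+ 2)| * s ^+ 2 <= 8 * enorm d ^+ 2.
  rewrite ger0_norm; last by rewrite mulr_ge0 ?divr_ge0 ?sqr_ge0// mulr_ge0.
  rewrite [leLHS](_ : _ = 2 * P * enorm d ^+ 2 * (s / r) ^+ 2); last by field; rewrite gt_eqF.
  have : (s / r) ^+ 2 <= 4 by rewrite expr2; clear -q0 qr; nra.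
  have e0 := sqr_ge0 (enorm d); have c0 := sqr_ge0 (s / r).
  move: (_ ^+ 2) ((s / r) ^+ 2) e0 c0 => e c e0 c0 c4.
  have : P * e * c <= 1 * e * 4 by rewrite !ler_pM// mulr_ge0.
  by clear; lra.
apply: le_trans (_ : (`|T1| + `|2 * P * (enorm d ^+ 2 / r ^+ 2)|) * s ^+ 2 <= _).
  by rewrite ler_wpM2r ?sqr_ge0// (le_trans (ler_normB _ _)).
have : `|T1| * s ^+ 2 <= (X v - X y) ^+ 2 * s ^+ 2 by rewrite ler_wpM2r ?sqr_ge0.
have := sqr_ge0 (enorm d).
by rewrite mulrDl; clear -h2 h3; lra.
Qed.

End Cutoff.

(** * Gluing horizontal planes with a partition of unity *)

Section Gluing.
Context {R : realType} {n : nat}.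
Local Notation rV := 'rV[R]_(n + n).
Variables (V : {vspace rV}) (Om : set rV) (H : rV -> R) (x : rV -> gpt R n).
Variables (B : seq rV) (L J : R) (N : nat).
Hypothesis J1 : 1 <= J.
Hypothesis cutoffJ : forall (D : set rV) y b s r, 0 < s -> s / 2 <= r ->
  enorm (y - b) <= 4 * s -> jet D y s (cutoff b r) J.
Hypothesis isoV : isotropic V.
Hypothesis OmV : forall v, Om v -> v \in V.
Hypothesis L01 : 0 <= L <= 1.
Hypothesis H0 : forall v, 0 < H v.
Hypothesis Hlip : forall u v, H u <= H v + enorm (u - v).
Hypothesis xw : forall u z, z \in V -> dotv (pw (x u)) z = 0.
Hypothesis xnear : forall u, enorm (u - pv (x u)) <= 2 * H u.
Hypothesis xcone : forall u v,
  cone L (enorm (u - v) + 4 * (H u + H v)) (x u) (x v).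
Hypothesis Bcover : forall v, Om v ->
  exists2 b, b \in B & enorm (v - b) <= H b / 8.
Hypothesis Bcount : forall y,
  (size [seq b <- B | ((enorm (b - y) <= H y) && (3 / 5 * H y <= H b))%R] <= N)%N.

Let L0 : 0 <= L. Proof. by case/andP: L01. Qed.
Let J0 : 0 <= J. Proof. exact: le_trans J1. Qed.

(** Since H is 1-Lipschitz, a cutoff of radius H b / 4 that meets the ball of
    radius H y / 4 about y has its centre b within H y of y, and H b is at least
    3 / 5 of H y. *)
Let near (y b : rV) := (enorm (b - y) <= H y) && (3 / 5 * H y <= H b).
Let th (b v : rV) : R := cutoff b (H b / 4) v.
Let Th (v : rV) : R := \sum_(b <- B) th b v.
Let phi (b v : rV) : R := th b v / Th v.

Definition glued_w (v : rV) : rV := \sum_(b <- B) phi b v *: pw (x b).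

(** The last component averages the heights over v of the horizontal planes
    through the points x b. *)
Definition glued (v : rV) : gpt R n := GPt v (glued_w v)
  (\sum_(b <- B) phi b v * (pt (x b) - 2 * omega (v - pv (x b)) (pw (x b)))).

Let th_ge0 b v : 0 <= th b v. Proof. exact: cutoff_ge0. Qed.

Let Th_ge v : Om v -> 2^-1 <= Th v.
Proof.
move=> /Bcover[b bB vb]; rewrite /Th (big_rem b)//=.
apply: le_trans (_ : th b v <= _).
  apply: cutoff_in; first by rewrite divr_gt0.
  by apply: le_trans vb _; lra.
by rewrite lerDl sumr_ge0.
Qed.

Let Th_gt0 v : Om v -> 0 < Th v.
Proof. by move/Th_ge => h; rewrite (lt_le_trans _ h)// invr_gt0. Qed.

Let phi_ge0 b v : 0 <= phi b v.
Proof. by rewrite divr_ge0// sumr_ge0. Qed.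

Let phi_sum v : Om v -> \sum_(b <- B) phi b v = 1.
Proof. by move=> /Th_gt0 h; rewrite -mulr_suml divff// gt_eqF. Qed.

Let th_far y b v : enorm (v - y) <= H y / 4 -> ~~ near y b -> th b v = 0.
Proof.
move=> vy; apply: contraNeq => thb.
have vb : enorm (v - b) < H b / 4.
  rewrite ltNge; apply: contra thb => vb; apply/eqP; apply: cutoff_out => //.
  by rewrite divr_gt0.
have h1 := Hlip b v; have h2 := Hlip v b; have h3 := Hlip v y.
have h4 := Hlip y v; rewrite (enormB b v) in h1; rewrite (enormB y v) in h4.
have h5 := enorm_triangle v b y; rewrite (enormB b v) in h5.
by apply/andP; split; lra.
Qed.

Let phi_far y b v : enorm (v - y) <= H y / 4 -> ~~ near y b -> phi b v = 0.
Proof. by move=> vy /(th_far vy) h; rewrite /phi h mul0r. Qed.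

Let near_self y : enorm (y - y) <= H y / 4.
Proof. by rewrite subrr enorm0 divr_ge0// ltW. Qed.

Let near_dist y b : near y b -> [/\ enorm (b - y) <= H y,
  H y / 4 / 2 <= H b / 4, enorm (pw (x b) - pw (x y)) <= 13 * (L * H y),
  `|defect (x b) (x y)| <= 169 * (L * H y ^+ 2) &
  enorm (y - pv (x b)) <= 5 * H y].
Proof.
move=> /andP[yb Hb]; have h := Hlip b y.
have Hy := H0 y; have Hbb := H0 b.
have [_ w d] := xcone b y.
have rr : enorm (b - y) + 4 * (H b + H y) <= 13 * H y by lra.
have r0 : 0 <= enorm (b - y) + 4 * (H b + H y) by rewrite addr_ge0 ?enorm_ge0//; lra.
split => //; try lra.
- by apply: le_trans w _; rewrite mulrCA ler_wpM2l.
- apply: le_trans d _; rewrite (_ : 169 * _ = L * (13 * H y) ^+ 2); last by ring.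
  by rewrite ler_wpM2l// ler_pXn2r// nnegrE; lra.
- have := enorm_triangle b y (pv (x b)); rewrite (enormB y b).
  by have := xnear b; lra.
Qed.

(** A sum over the net reduces to the at most N terms that matter near y. *)
Let sum_near y (F : rV -> R) (a : R) : 0 <= a ->
  (forall b, near y b -> F b <= a) -> (forall b, ~~ near y b -> F b = 0) ->
  \sum_(b <- B) F b <= N%:R * a.
Proof.
move=> a0 Fa F0; rewrite (bigID (near y))/= [X in _ + X]big1 ?addr0//.
apply: (@le_trans _ _ (\sum_(b <- B | near y b) a)).
  by apply: ler_sum => b; exact: Fa.
rewrite -big_filter big_const_seq iter_addr_0 count_predT.
by rewrite mulr_natl; apply: ler_wpMn2l => //; exact: Bcount.

Qed.

Let dw (y b : rV) : rV := pw (x b) - pw (x y).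
Let dl (y v : rV) : rV := \sum_(b <- B) phi b v *: dw y b.
Let aff (y b v : rV) : R := defect (x b) (x y) - 2 * omega (v - pv (x b)) (dw y b).
Let gl (y v : rV) : R := \sum_(b <- B) phi b v * aff y b v.

Let dlE y v : Om v -> dl y v = glued_w v - pw (x y).
Proof.
move=> Ov; rewrite /dl /glued_w -[X in _ = _ - X]scale1r -(phi_sum Ov).
rewrite scaler_suml -sumrB; apply: eq_bigr => b _.
by rewrite /dw scalerBr.
Qed.

(** Relative to the plane through x y, the height of the glued section is small
    up to the twist of its vertical part. *)
Let gluedE y v : Om v -> pt (glued v) = pt (x y)
  - 2 * omega (v - pv (x y)) (pw (x y)) + gl y v + omega (pw (x y)) (dl y v).
Proof.
move=> Ov; rewrite /= /gl /dl omega_sumr -addrA -big_split/=.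
rewrite -[X in _ = X + _]mul1r -[X in _ = X * _ + _](phi_sum Ov).
rewrite mulr_suml -big_split/=.
apply: eq_bigr => b _; rewrite omegaZr -!mulrDr; congr (_ * _).
rewrite /aff /defect /dw !(omegaDl, omegaDr, omegaNl, omegaNr) omegaxx.
by ring.
Qed.

(** The left-invariant form of the previous identity: every term on the right is
    small, even though the section may be far from the origin. *)
Let defect_glued y v : Om y -> Om v -> defect (glued v) (glued y) =
  gl y v - gl y y + 2 * omega (v - y) (dl y y) - omega (dl y y) (dl y v - dl y y).
Proof.
move=> Oy Ov; rewrite /defect !(gluedE y)//.
have vE u : pv (glued u) = u by [].
have wE u : Om u -> pw (glued u) = dl y u + pw (x y).
  by move=> /(dlE y) ->; rewrite subrK.
rewrite !vE !wE//; move: (dl y v) (dl y y) (gl y v) (gl y y) => a b g g'.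
rewrite !(omegaDl, omegaDr, omegaNl, omegaNr) !omegaxx.
rewrite (omega_anti b (pw (x y))).
by ring.
Qed.

Let defect_glued_x y : Om y -> defect (glued y) (x y) = gl y y.
Proof.
move=> Oy; rewrite /defect (gluedE y)// [pv _]/= [pw _]/= (dlE y Oy).
by rewrite !(omegaDr, omegaNr) omegaxx; ring.
Qed.

Let average_le y (F : rV -> R) (a : R) : Om y ->
  (forall b, near y b -> F b <= a) -> \sum_(b <- B) phi b y * F b <= a.
Proof.
move=> Oy Fa; rewrite -[leRHS]mul1r -[X in _ <= X * _](phi_sum Oy) mulr_suml.
apply: ler_sum => b _; have [nb|nb] := boolP (near y b).
  by rewrite ler_wpM2l// Fa.
by rewrite (phi_far (near_self y) nb) !mul0r.
Qed.

Let dl_le y : Om y -> enorm (dl y y) <= 13 * (L * H y).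
Proof.
move=> Oy; apply: le_trans (enorm_sum _ _ _) _.
under eq_bigr do rewrite enormZ ger0_norm//.
by apply: average_le => // b; case/near_dist.
Qed.

Let aff_le y b : near y b -> `|aff y b y| <= 234 * (L * H y ^+ 2).
Proof.
move=> /near_dist[_ _ w d p].
have := omega_le (y - pv (x b)) (dw y b).
have : enorm (y - pv (x b)) * enorm (dw y b) <= 5 * H y * (13 * (L * H y)).
  by rewrite ler_pM// enorm_ge0.
have := ler_normB (defect (x b) (x y)) (2 * omega (y - pv (x b)) (dw y b)).
rewrite /aff normrM gtr0_norm// (_ : 5 * _ * _ = 65 * (L * H y ^+ 2)); last by ring.
by lra.
Qed.

(** Over y the section is an average of data that all agree with x y up to
    errors of order L at the scale H y. *)
Lemma glued_near y : Om y -> enorm (glued_w y - pw (x y)) <= 13 * (L * H y)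
  /\ `|defect (glued y) (x y)| <= 234 * (L * H y ^+ 2).
Proof.
move=> Oy; split; first by rewrite -dlE// dl_le.
rewrite defect_glued_x// /gl; apply: le_trans (ler_norm_sum _ _ _) _.
under eq_bigr do rewrite normrM ger0_norm//.
by apply: average_le => // b; exact: aff_le.
Qed.

Let N1 : R := N.+1%:R.
Let N1_ge1 : 1 <= N1. Proof. by rewrite ler1n. Qed.
Let NN1 : N%:R <= N1. Proof. by rewrite ler_nat. Qed.
Let JV := 24 * (J * N1) ^+ 2.

Let s_gt0 y : 0 < H y / 4. Proof. by rewrite divr_gt0. Qed.

Let th_jet y b : near y b -> jet Om y (H y / 4) (th b) J.
Proof.
move=> /near_dist[yb r _ _ _].
apply: cutoffJ => //; rewrite enormB (le_trans yb)//.
by have := H0 y; lra.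
Qed.

Let far_jet y b (f : rV -> R) : Om y -> ~~ near y b ->
  jet Om y (H y / 4) (fun v => th b v * f v) 0.
Proof.
move=> Oy nb; apply: (@eq_jet _ _ _ _ _ _ (fun=> 0)) => //; last exact: jet0.
by move=> v Ov vy; rewrite (th_far vy nb) mul0r.
Qed.

(** Only the boundedly many cutoffs that live near y contribute, and the
    denominator is bounded below: the constant depends on N and J alone. *)
Let jet_glue y (f : rV -> rV -> R) (a : R) : Om y -> 0 <= a ->
  (forall b, near y b -> jet Om y (H y / 4) (f b) a) ->
  jet Om y (H y / 4) (fun v => (\sum_(b <- B) th b v * f b v) * (Th v)^-1)
    (6 * (N1 * (6 * (J * a)) * JV)).
Proof.
move=> Oy a0 fa; apply: jetM => //.
- have := @jet_sum _ _ Om y (H y / 4) (s_gt0 y) _ B (fun b v => th b v * f b v)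
    (fun b => if near y b then 6 * (J * a) else 0).
  move=> /(_ _)/jet_le; apply.
    apply: le_trans (@sum_near y _ (6 * (J * a)) _ _ _) _.
    + by rewrite !mulr_ge0.
    + by move=> b ->.
    + by move=> b /negbTE ->.
    + by rewrite ler_wpM2r// !mulr_ge0.
  move=> b; case: ifPn => [nb|nb]; last exact: far_jet.
  by apply: jetM => //; [exact: th_jet|exact: fa].
- apply: jetV => //.
  + by move=> v Ov _; exact: Th_ge.
  + by rewrite mulr_ege1.
  have := @jet_sum _ _ Om y (H y / 4) (s_gt0 y) _ B th
    (fun b => if near y b then J else 0).
  move=> /(_ _)/jet_le; apply.
    apply: le_trans (@sum_near y _ J _ _ _) _ => //.
    + by move=> b ->.
    + by move=> b /negbTE ->.
    + by rewrite mulrC ler_wpM2l.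
  move=> b; case: ifPn => [nb|nb]; first exact: th_jet.
  have := @far_jet y b (fun=> 1) Oy nb; apply: eq_jet => // v _ _.
  by rewrite mulr1.
Qed.

Let KG := 6 * (N1 * (6 * J) * JV).

Let KG_ge1 : 1 <= KG.
Proof.
have h : 1 <= JV.
  by rewrite /JV mulr_ege1 ?ler1n// exprn_ege1// mulr_ege1.
rewrite /KG; have := mulr_ege1 (mulr_ege1 N1_ge1 J1) h.
rewrite -mulrA (mulrC J); lra.
Qed.

Let affE y b v : aff y b v = aff y b y + dotv (cplx (dw y b)) (v - y).
Proof.
rewrite dotv_cplx /aff; move: (dw y b) => d.
rewrite !(omegaDl, omegaDr, omegaNl, omegaNr).
by rewrite (omega_anti v) (omega_anti y); ring.
Qed.

Definition glue_const : R := 16 * (KG * 1000).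

Lemma glue_const_ge250 : 250 <= glue_const.
Proof. by rewrite /glue_const; have := KG_ge1; lra. Qed.

(** The section [glued] need not be horizontal, but its defect is
    differentiable at the scale H, with a small gradient. *)
Lemma glued_gradient y : Om y -> exists q : rV,
  [/\ q \in V, enorm q <= glue_const * L * H y &
  forall v, Om v -> enorm (v - y) <= H y / 4 ->
    `|defect (glued v) (glued y) - dotv q (v - y)|
      <= glue_const * L * enorm (v - y) ^+ 2].
Proof.
move=> Oy; have Hy := H0 y.
pose cb b := omega (dl y y) (dw y b).
pose F v := (\sum_(b <- B) th b v * (aff y b v - cb b)) * (Th v)^-1
  + dotv (- cplx (dl y y)) (v - y).
have FE v : Om v -> defect (glued v) (glued y) = F v - F y.
  move=> Ov; rewrite defect_glued//.
  have glE u : Om u -> (\sum_(b <- B) th b u * (aff y b u - cb b)) * (Th u)^-1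
      = gl y u - omega (dl y y) (dl y u).
    move=> Ou; rewrite [in X in _ - X]/dl omega_sumr -sumrB mulr_suml.
    by apply: eq_bigr => b _; rewrite omegaZr /phi /cb; ring.
  rewrite /F !glE// dotvNl dotv_cplx subrr dotv0r omegaDr omegaNr.
  by rewrite (omega_anti (v - y)); ring.
pose a := 330 * (L * H y ^+ 2).
have LH0 : 0 <= L * H y ^+ 2 by rewrite mulr_ge0 ?sqr_ge0.
have a0 : 0 <= a by rewrite /a; lra.
have LL : L * (L * H y ^+ 2) <= L * H y ^+ 2.
  by rewrite ler_piMl//; case/andP: L01.
have jetc b : near y b -> jet Om y (H y / 4) (fun v => aff y b v - cb b) a.
  move=> nb; have [_ _ w _ _] := near_dist nb.
  have cbA : `|cb b| <= 85 * (L * H y ^+ 2).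
    have := omega_le (dl y y) (dw y b).
    have : enorm (dl y y) * enorm (dw y b) <= 13 * (L * H y) * (13 * (L * H y)).
      by rewrite ler_pM ?enorm_ge0// dl_le.
    rewrite (_ : _ * (13 * _) = 169 * (L * (L * H y ^+ 2))); last by ring.
    by rewrite /cb; lra.
  apply: (@eq_jet _ _ _ _ _ _ (fun v => (aff y b y - cb b)
      + dotv (cplx (dw y b)) (v - y))) => //.
    by move=> v _ _; rewrite [in RHS]affE; ring.
  have := jetD (s_gt0 y) (jet_cst Om y (H y / 4) (aff y b y - cb b))
    (jet_linear Om y (s_gt0 y) (cplx (dw y b))).
  apply: jet_le; rewrite enorm_cplx.
  have : enorm (dw y b) * (H y / 4) <= 4 * (L * H y ^+ 2).
    apply: le_trans (_ : 13 * (L * H y) * (H y / 4) <= _).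
      by rewrite ler_wpM2r// divr_ge0// ltW.
    by move: LH0; rewrite expr2; lra.
  have := aff_le nb; have := ler_normB (aff y b y) (cb b).
  by rewrite /a; lra.
have jetF : jet Om y (H y / 4) F (KG * 1000 * (L * H y ^+ 2)).
  have := jetD (s_gt0 y) (jet_glue Oy a0 jetc)
    (jet_linear Om y (s_gt0 y) (- cplx (dl y y))).
  apply: jet_le; rewrite enormN enorm_cplx.
  have dly : enorm (dl y y) * (H y / 4) <= 4 * (L * H y ^+ 2).
    apply: le_trans (_ : 13 * (L * H y) * (H y / 4) <= _).
      by rewrite ler_wpM2r ?dl_le// divr_ge0// ltW.
    by move: LH0; rewrite expr2; lra.
  rewrite [X in X + _ <= _](_ : _ = KG * a); last by rewrite /KG; ring.
  have : L * H y ^+ 2 <= KG * (L * H y ^+ 2) by rewrite ler_peMl.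
  by rewrite /a; lra.
case: jetF => _ [g g0 gF].
exists (orthproj V g); split; first exact: orthproj_in.
  apply: le_trans (enorm_orthproj _ _) _.
  rewrite -(ler_pM2r (s_gt0 y)) (le_trans g0)// /glue_const.
  have : 0 <= KG * (L * H y ^+ 2) by rewrite mulr_ge0// (le_trans ler01).
  by rewrite expr2; lra.
move=> v Ov vy; rewrite FE//.
rewrite dotv_orthproj ?memvB ?OmV//.
have := gF v Ov vy.
rewrite (_ : (H y / 4) ^+ 2 = H y ^+ 2 / 16); last by field.
rewrite (_ : KG * 1000 * (L * H y ^+ 2) * enorm (v - y) ^+ 2
  = (glue_const * L * enorm (v - y) ^+ 2) * (H y ^+ 2 / 16)); last first.
  by rewrite /glue_const; field.
by rewrite ler_pM2r// divr_gt0// exprn_gt0.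
Qed.

Lemma glued_w_lip y v : Om y -> Om v -> enorm (v - y) <= H y / 4 ->
  enorm (glued_w v - glued_w y) <= glue_const * L * enorm (v - y).
Proof.
move=> Oy Ov vy; have Hy := H0 y.
have -> : glued_w v - glued_w y = \sum_(b <- B) (phi b v - phi b y) *: dw y b.
  have -> : glued_w v - glued_w y = dl y v - dl y y by rewrite !dlE//; apply/rowP => i; rewrite !mxE; ring.
  by rewrite /dl -sumrB; apply: eq_bigr => b _; rewrite scalerBl.
apply: le_trans (enorm_sum _ _ _) _.
have d0 := enorm_ge0 (v - y).
have KG0 : 0 <= KG by rewrite (le_trans ler01).
have Ld : 0 <= L * enorm (v - y) by rewrite mulr_ge0.
have phiL b : near y b ->
    `|phi b v - phi b y| * (H y / 4) <= 2 * (6 * (J * JV)) * enorm (v - y).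
  move=> nb; apply: (@jet_var _ _ Om _ _ (s_gt0 y) (phi b)) => //.
  apply: jetM => //; first exact: th_jet.
  apply: jetV => //.
  + by move=> u Ou _; exact: Th_ge.
  + by rewrite mulr_ege1.
  have := @jet_sum _ _ Om y (H y / 4) (s_gt0 y) _ B th
    (fun b => if near y b then J else 0).
  move=> /(_ _)/jet_le; apply.
    apply: le_trans (@sum_near y _ J _ _ _) _ => //.
    + by move=> c ->.
    + by move=> c /negbTE ->.
    + by rewrite mulrC ler_wpM2l.
  move=> c; case: ifPn => [nc|nc]; first exact: th_jet.
  have := @far_jet y c (fun=> 1) Oy nc; apply: eq_jet => // u _ _.
  by rewrite mulr1.
have JV0 : 0 <= JV by rewrite /JV mulr_ge0 ?sqr_ge0.
apply: le_trans (@sum_near y _ (13 * (L * (8 * (6 * (J * JV)) * enorm (v - y)))) _ _ _) _.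
- by rewrite !mulr_ge0.
- move=> b nb; rewrite enormZ; have [_ _ w _ _] := near_dist nb.
  apply: le_trans (_ : `|phi b v - phi b y| * (13 * (L * H y)) <= _).
    by rewrite ler_wpM2l.
  have := phiL _ nb; move: `|_| => e he.
  rewrite (_ : e * _ = 13 * (L * (4 * (e * (H y / 4))))); last by field.
  by do 2 rewrite ler_wpM2l//; lra.
- by move=> b nb; rewrite (phi_far vy nb) (phi_far (near_self y) nb) subrr scale0r enorm0.
apply: le_trans (_ : N1 * (13 * (L * (8 * (6 * (J * JV)) * enorm (v - y)))) <= _).
  by rewrite ler_wpM2r// !mulr_ge0.
rewrite [leLHS](_ : _ = (104 / 6) * KG * (L * enorm (v - y))); last first.
  by rewrite /KG; field.
rewrite -[leRHS]mulrA ler_wpM2r// /glue_const.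
by have := KG_ge1; lra.
Qed.

Lemma glued_perp v z : z \in V -> dotv (glued_w v) z = 0.
Proof.
move=> zV; rewrite /glued_w; elim/big_rec: _ => [|b w _ h]; first by rewrite dotv0l.
by rewrite dotvDl dotvZl xw// mulr0 add0r.
Qed.

End Gluing.

(** * Making the glued section horizontal *)

Lemma norm_combination_le (R : realType) (a b c d e x : R) :
  `|a| <= x -> `|b| <= 4 * x -> `|c| <= x -> `|d| <= x -> `|e| <= x ->
  `|- a + b - c - d - e| <= 8 * x.
Proof.
rewrite !ler_norml => /andP[? ?] /andP[? ?] /andP[? ?] /andP[? ?] /andP[? ?].
by apply/andP; split; lra.
Qed.

Section Horizontal.
Context {R : realType} {n : nat}.
Local Notation rV := 'rV[R]_(n + n).
Variables (V : {vspace rV}) (Om Om' : set rV) (H : rV -> R).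
Variables (x G : rV -> gpt R n) (L K : R).
Hypothesis isoV : isotropic V.
Hypothesis OmV : forall v, Om v -> v \in V.
Hypothesis Om'V : forall v, Om' v -> v \in V.
Hypothesis Om'_Om : forall v y u, Om' v -> Om' y -> u \in V ->
  enorm u <= enorm (v - y) -> Om (v + u).
Hypothesis L01 : 0 <= L <= 1.
(* this absorbs the constants 13 and 234 below *)
Hypothesis K250 : 250 <= K.
Hypothesis H0 : forall v, 0 < H v.
Hypothesis Hlip : forall u v, H u <= H v + enorm (u - v).
Hypothesis xw : forall u z, z \in V -> dotv (pw (x u)) z = 0.
Hypothesis xnear : forall u, enorm (u - pv (x u)) <= 2 * H u.
Hypothesis xcone : forall u v,
  cone L (enorm (u - v) + 4 * (H u + H v)) (x u) (x v).
Hypothesis Gv : forall v, pv (G v) = v.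
Hypothesis Gw : forall v z, z \in V -> dotv (pw (G v)) z = 0.
Hypothesis Gnear : forall y, Om y -> enorm (pw (G y) - pw (x y)) <= 13 * (L * H y)
  /\ `|defect (G y) (x y)| <= 234 * (L * H y ^+ 2).
Hypothesis Glip : forall y v, Om y -> Om v -> enorm (v - y) <= H y / 4 ->
  enorm (pw (G v) - pw (G y)) <= K * L * enorm (v - y).
Hypothesis Ggrad : forall y, Om y -> exists q : rV,
  [/\ q \in V, enorm q <= K * L * H y &
  forall v, Om v -> enorm (v - y) <= H y / 4 ->
    `|defect (G v) (G y) - dotv q (v - y)| <= K * L * enorm (v - y) ^+ 2].

Let L0 : 0 <= L. Proof. by case/andP: L01. Qed.
Let K0 : 0 <= K. Proof. by have := K250; lra. Qed.
Let K1 : 1 <= K. Proof. by have := K250; lra. Qed.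
Let Om'W v : Om' v -> Om v.
Proof.
move=> Ov; rewrite -[v]addr0; apply: (Om'_Om Ov Ov); first exact: mem0v.
by rewrite enorm0 enorm_ge0.
Qed.

(** Moving the vertical part by the complex structure applied to the gradient q
    cancels the first-order term of the defect. The gradient is Lipschitz by
    comparing the expansions of the defect at three points. *)
Lemma horizontal_section : exists f : rV -> gpt R n,
  [/\ forall v, pv (f v) = v,
      forall v z, z \in V -> dotv (pw (f v)) z = 0,
      forall v y, Om' v -> Om' y ->
        cone ((300 * K) ^+ 2 * L) (enorm (v - y)) (f v) (f y) &
      forall v, Om' v -> cone L (2 * K * H v) (f v) (x v)].
Proof.
have /choice[q qP] : forall y, exists q : rV, q \in V /\ (Om y ->
    enorm q <= K * L * H y /\
    forall v, Om v -> enorm (v - y) <= H y / 4 ->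
    `|defect (G v) (G y) - dotv q (v - y)| <= K * L * enorm (v - y) ^+ 2).
  move=> y; have [Oy|nOy] := pselect (Om y); last by exists 0; split; [exact: mem0v|].
  by have [q [qV q1 q2]] := Ggrad Oy; exists q; split.
have qV y : q y \in V by case: (qP y).
pose f v := GPt v (pw (G v) - cplx (q v)) (pt (G v)).
have perp_cplx w u : (forall z, z \in V -> dotv w z = 0) -> u \in V ->
    omega w (cplx u) = 0.
  by move=> wp uV; have := omega_cplxr w u; rewrite wp//; lra.
have fw v z : z \in V -> dotv (pw (f v)) z = 0.
  by move=> zV; rewrite /= dotvDl dotvNl dotv_cplx isoV// Gw// mulr0 subr0.
have fv v : pv (f v) = v by [].
have fwE v : pw (f v) = pw (G v) - cplx (q v) by [].
have ft v : pt (f v) = pt (G v) by [].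
have defect_f v y : defect (f v) (f y) = defect (G v) (G y) - dotv (q y) (v - y).
  rewrite /defect !fv !fwE !ft !Gv; move: (v - y) => d.
  have c0 (v' y' : rV) : omega (pw (G v')) (cplx (q y')) = 0.
    by apply: perp_cplx => //; exact: Gw.
  have cc : omega (cplx (q y)) (cplx (q v)) = 0.
    by apply: perp_cplx => // z zV; rewrite dotv_cplx isoV// mulr0.
  rewrite !(omegaDl, omegaDr, omegaNl, omegaNr) c0 cc (omega_anti (cplx (q y))) c0.
  by have := omega_cplxr d (q y); rewrite dotvC; lra.
have fx_near v : Om' v -> cone L (2 * K * H v) (f v) (x v).
  move=> /Om'W Ov; have [w d] := Gnear Ov; have Hv := H0 v.
  have [qle _] := (qP v).2 Ov.
  have LH : 0 <= L * H v by rewrite mulr_ge0// ltW.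
  split.
  - apply: le_trans (xnear v) _; rewrite ler_wpM2r ?(ltW Hv)//.
    by have := K1; lra.
  - rewrite fwE (_ : _ - _ = (pw (G v) - pw (x v)) - cplx (q v)); last first.
      by apply/rowP => i; rewrite !mxE; ring.
    apply: le_trans (enormD _ _) _; rewrite enormN enorm_cplx.
    rewrite (_ : L * _ = 2 * (K * (L * H v))); last by ring.
    have : 13 * (L * H v) <= K * (L * H v).
      by rewrite ler_wpM2r//; have := K250; lra.
    by rewrite -mulrA in qle; lra.
  - rewrite (_ : defect _ _ = defect (G v) (x v)).
      apply: le_trans d _; rewrite !exprMn mulrCA ler_wpM2l//.
      rewrite ler_wpM2r ?sqr_ge0//.
      by have := K250; nra.
    rewrite /defect ft fv Gv fwE omegaDr omegaNr.
    rewrite perp_cplx ?oppr0 ?addr0//.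
    by move=> z; exact: xw.
exists f; split => // v y Ov Oy.
have [vO yO] := (Om'W Ov, Om'W Oy).
have Hv := H0 v; have Hy := H0 y.
have r0 := enorm_ge0 (v - y); set r := enorm (v - y) in r0 *.
have K2 : 1 <= K ^+ 2 by rewrite exprn_ege1.
have KK : K <= K ^+ 2 by rewrite expr2 ler_peMl.
have [near|far] := leP r (H y / 16); last first.
  apply: cone_rescale => //; first by have := K1; lra.
  have h := Hlip v y; rewrite -/r in h.
  have c1 := fx_near _ Ov; have c3 := cone_sym L0 (fx_near _ Oy).
  have c := cone_trans L01 (cone_trans L01 c1 (xcone v y)) c3.
  apply: cone_le c => //; rewrite -/r.
  have Hy16 : H y <= 16 * r by lra.
  have Hv17 : H v <= 17 * r by lra.
  have : K * H y <= K * (16 * r) by rewrite ler_wpM2l.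
  have : K * H v <= K * (17 * r) by rewrite ler_wpM2l.
  have : r <= K * r by rewrite ler_peMl.
  by lra.
have vy4 : enorm (v - y) <= H y / 4 by rewrite -/r; lra.
have lipw := Glip yO vO vy4; rewrite -/r in lipw.
have [_ qy] := (qP y).2 yO; have [_ qv] := (qP v).2 vO.
have LK0 : 0 <= K * L by rewrite mulr_ge0.
have LKK : (K * L) * (K * L) <= K ^+ 2 * L.
  rewrite (_ : _ * _ = K ^+ 2 * L * L); last by ring.
  by rewrite ler_piMr ?mulr_ge0 ?sqr_ge0//; case/andP: L01.
have KLKK : K * L <= K ^+ 2 * L by rewrite ler_wpM2r.
have qlip : enorm (q v - q y) <= 8 * K ^+ 2 * L * r.
  have [q0|q0] := eqVneq (enorm (q v - q y)) 0; first by rewrite q0 !mulr_ge0 ?sqr_ge0.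
  have [rz|rz] := eqVneq r 0.
    by rewrite /r in rz; move/enorm_eq0/subr0_eq: rz => ->; rewrite subrr enorm0 !mulr_ge0 ?sqr_ge0.
  have dq0 : 0 < enorm (q v - q y) by rewrite lt_def q0 enorm_ge0.
  have rpos : 0 < r by rewrite lt_def rz.
  pose u := (r / enorm (q v - q y)) *: (q v - q y).
  have uV : u \in V by rewrite memvZ// memvB.
  have ur : enorm u = r.
    by rewrite /u enormZ ger0_norm ?divr_ge0// ?(ltW dq0)// divfK.
  have Ovu : Om (v + u) by apply: (Om'_Om Ov Oy) => //; rewrite ur.
  have vu : v + u - v = u by rewrite addrAC subrr add0r.
  have vuy : v + u - y = u + (v - y) by rewrite addrAC addrC.
  have HvHy := Hlip y v; rewrite (enormB y v) -/r in HvHy.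
  have uv4 : enorm (v + u - v) <= H v / 4 by rewrite vu ur; lra.
  have uy2r : enorm (v + u - y) <= 2 * r.
    by rewrite vuy (le_trans (enormD _ _))// ur -/r mulr2n mulrDl mul1r.
  have uy4 : enorm (v + u - y) <= H y / 4 by rewrite (le_trans uy2r)//; lra.
  have e1 := qv _ Ovu uv4; have e2 := qy _ Ovu uy4; have e3 := qy _ vO vy4.
  have l1 := Glip vO Ovu uv4.
  rewrite vu ur in e1 l1; rewrite -/r in e3.
  have e2' : `|defect (G (v + u)) (G y) - dotv (q y) (v + u - y)|
      <= K * L * (4 * r ^+ 2).
    apply: le_trans e2 _; rewrite ler_wpM2l// (_ : 4 * _ = (2 * r) ^+ 2); last by ring.
    by rewrite ler_pXn2r// nnegrE ?enorm_ge0// mulr_ge0.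
  have ch := defect_chain (G (v + u)) (G v) (G y).
  rewrite !Gv vu in ch.
  have o1 := omega_le u (pw (G y) - pw (G v)).
  have o2 := omega_le (pw (G v) - pw (G y)) (pw (G (v + u)) - pw (G v)).
  have o1' : enorm u * enorm (pw (G y) - pw (G v)) <= r * (K * L * r).
    by rewrite ur ler_wpM2l// enormB.
  have o2' : enorm (pw (G v) - pw (G y)) * enorm (pw (G (v + u)) - pw (G v))
      <= (K * L * r) * (K * L * r) by rewrite ler_pM// enorm_ge0.
  have dqu : dotv (q v - q y) u = enorm (q v - q y) * r.
    by rewrite /u dotvZr -enorm2 expr2 mulrA divfK// mulrC.
  have : `|dotv (q v - q y) u| <= 8 * K ^+ 2 * L * r * r.
    have -> : dotv (q v - q y) u =
      - (defect (G (v + u)) (G v) - dotv (q v) u)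
      + (defect (G (v + u)) (G y) - dotv (q y) (v + u - y))
      - (defect (G v) (G y) - dotv (q y) (v - y))
      - 2 * omega u (pw (G y) - pw (G v))
      - omega (pw (G v) - pw (G y)) (pw (G (v + u)) - pw (G v)).
      by rewrite ch vuy (dotvDr (q y) u) (dotvDl (q v)) dotvNl; ring.
    have rr0 : 0 <= r * r by rewrite mulr_ge0.
    rewrite [X in _ <= X](_ : _ = K * L * (r * r)) in o1'; last by ring.
    rewrite [X in _ <= X](_ : _ = (K * L * (K * L)) * (r * r)) in o2'; last by ring.
    rewrite expr2 in e1 e2' e3.
    have b1 : K * L * (r * r) <= K ^+ 2 * L * (r * r) by rewrite ler_wpM2r.
    have b2 : K * L * (K * L) * (r * r) <= K ^+ 2 * L * (r * r) by rewrite ler_wpM2r.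
    rewrite [leRHS](_ : _ = 8 * (K ^+ 2 * L * (r * r))); last by ring.
    rewrite mulrCA in e2'.
    apply: norm_combination_le.
    - exact: le_trans e1 b1.
    - by apply: le_trans e2' _; rewrite ler_pM2l.
    - exact: le_trans e3 b1.
    - apply: le_trans b1; rewrite normrM gtr0_norm// -ler_pdivlMl//.
      by apply: le_trans o1 _; rewrite ler_pM2l ?invr_gt0.
    - apply: le_trans b2; apply: le_trans o2' ; apply: le_trans o2 _.
      by apply: ler_piMl; rewrite ?mulr_ge0 ?enorm_ge0// invf_le1// ler1n.
  by rewrite dqu ger0_norm ?mulr_ge0 ?enorm_ge0// ler_pM2r.
split.
- by [].
- rewrite !fwE.
  rewrite (_ : _ - _ - _ = (pw (G v) - pw (G y)) - cplx (q v - q y)); last first.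
    by rewrite cplxD cplxN; apply/rowP => i; rewrite !mxE; ring.
  apply: le_trans (enormD _ _) _; rewrite enormN enorm_cplx.
  rewrite -/r exprMn.
  have : K * L * r <= K ^+ 2 * L * r by rewrite ler_wpM2r.
  have : 0 <= K ^+ 2 * L * r by rewrite !mulr_ge0 ?sqr_ge0.
  by lra.
- rewrite defect_f; apply: le_trans (qy _ vO vy4) _.
  rewrite -/r ler_wpM2r ?sqr_ge0// ler_wpM2r// exprMn.
  by have := sqr_ge0 K; lra.
Qed.

End Horizontal.

(** * Extension from sets with positive height *)

Section Net.
Context {R : realType} {m : nat}.

(** Separated families in a ball have bounded cardinality, because the scale H is
    bounded below; one of maximal cardinality cannot miss a point. *)
Lemma maximal_net (Om : set 'rV[R]_m) (H : 'rV[R]_m -> R) (s0 M : R) :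
  0 < s0 -> (forall v, s0 <= H v) -> (forall v, Om v -> enorm v <= M) ->
  exists B : seq 'rV[R]_m, [/\ uniq B,
    {in B &, forall b c, b != c -> Num.min (H b) (H c) / 8 <= enorm (b - c)} &
    forall v, Om v -> exists2 b, b \in B & enorm (v - b) <= H b / 8].
Proof.
move=> s00 Hs OmM.
pose separated (B : seq 'rV[R]_m) := [/\ uniq B, forall b, b \in B -> Om b &
  {in B &, forall b c, b != c -> Num.min (H b) (H c) / 8 <= enorm (b - c)}].
have [N packN] := euclidean_packing m (8 * M / s0).
have bounded B : separated B -> (size B <= N)%N.
  case=> uB OB sB; apply: (packN B 0 (s0 / 8)) => //; first by rewrite divr_gt0.
    move=> b /OB /OmM bM; rewrite subr0 (le_trans bM)// le_eqVlt.
    by apply/orP; left; apply/eqP; field; rewrite gt_eqF.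
  move=> b c bB cB bc; apply: le_trans (sB _ _ bB cB bc).
  by rewrite ler_wpM2r// le_min !Hs.
pose P k := `[< exists2 B, separated B & size B = k >].
have exP : exists k, P k by exists 0%N; apply/asboolP; exists [::].
have ubP k : P k -> (k <= N)%N by move=> /asboolP[B sB <-]; exact: bounded.
have [k /asboolP[B [uB OB sB] sizeB] kmax] := ex_maxnP exP ubP.
exists B; split => // v Ov; apply: contrapT => nb.
have far b : b \in B -> H b / 8 < enorm (v - b).
  by move=> bB; rewrite ltNge; apply/negP => vb; apply: nb; exists b.
suff : P k.+1 by move=> /kmax; rewrite ltnn.
apply/asboolP; exists (v :: B); last by rewrite /= sizeB.
split.
- rewrite /= uB andbT; apply/negP => /far; rewrite subrr enorm0.
  by rewrite ltNge divr_ge0// (le_trans (ltW s00)).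
- by move=> b; rewrite inE => /predU1P[->//|/OB].
- move=> b c; rewrite !inE => /predU1P[->|bB] /predU1P[->|cB]; rewrite ?eqxx//.
  + move=> _; rewrite (le_trans _ (ltW (far _ cB)))// ler_wpM2r//.
    by rewrite ge_min lexx orbT.
  + move=> _; rewrite enormB (le_trans _ (ltW (far _ bB)))// ler_wpM2r//.
    by rewrite ge_min lexx.
  + exact: sB.
Qed.

End Net.

Section ExtensionBounded.
Context {R : realType} {n : nat}.
Local Notation rV := 'rV[R]_(n + n).

Section Height.
Variables (X : set (gpt R n)) (h : gpt R n -> R) (s0 : R).
Hypothesis X0 : X !=set0.
Hypothesis s00 : 0 < s0.
Hypothesis hs : forall p, X p -> s0 <= h p.

(** The scale at which the data in X determine a section over v. *)
Definition height (v : rV) : R := inf [set h p + enorm (v - pv p) | p in X].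

Let has_inf_height v : has_inf [set h p + enorm (v - pv p) | p in X].
Proof.
split; first by case: X0 => p Xp; exists (h p + enorm (v - pv p)), p.
exists 0 => _ [p Xp <-]; rewrite addr_ge0 ?enorm_ge0//.
by rewrite (le_trans (ltW s00)) ?hs.
Qed.

Lemma height_le v p : X p -> height v <= h p + enorm (v - pv p).
Proof. by move=> Xp; apply: inf_lbound; [case: (has_inf_height v)|exists p]. Qed.

Lemma height_ge v (a : R) :
  (forall p, X p -> a <= h p + enorm (v - pv p)) -> a <= height v.
Proof.
move=> ah; apply: lb_le_inf; first by case: (has_inf_height v).
by move=> _ [p Xp <-]; exact: ah.
Qed.

Lemma height_ge_s0 v : s0 <= height v.
Proof.
by apply: height_ge => p Xp; rewrite (le_trans (hs Xp))// lerDl enorm_ge0.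
Qed.

Lemma height_lip u v : height u <= height v + enorm (u - v).
Proof.
rewrite -lerBlDr; apply: height_ge => p Xp.
rewrite lerBlDr (le_trans (height_le u Xp))// -addrA lerD2l addrC.
exact: enorm_triangle.
Qed.

Lemma height_attained v : exists2 p, X p & h p + enorm (v - pv p) <= 2 * height v.
Proof.
have h0 : 0 < height v by exact: lt_le_trans (height_ge_s0 v).
have [_ [p Xp <-] lt2] := inf_adherent h0 (has_inf_height v).
by exists p => //; rewrite mulr2n mulrDl mul1r ltW.
Qed.

End Height.

(** The lower bound s0 for the heights and the restriction to a ball of radius M
    only serve to make the net finite: the constant K depends on n alone. *)
Lemma extension_bounded : exists2 K : R, 1 <= K &
  forall (V : {vspace rV}) (X : set (gpt R n)) (h : gpt R n -> R) (s0 L M : R),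
    isotropic V -> X !=set0 -> 0 < s0 -> (forall p, X p -> s0 <= h p) ->
    (forall p, X p -> pv p \in V /\ forall z, z \in V -> dotv (pw p) z = 0) ->
    0 <= L <= 1 ->
    (forall p q, X p -> X q -> cone L (enorm (pv p - pv q) + h p + h q) p q) ->
    exists f : rV -> gpt R n,
    [/\ forall v, pv (f v) = v,
        forall v z, z \in V -> dotv (pw (f v)) z = 0,
        forall v y, v \in V -> y \in V -> enorm v <= M -> enorm y <= M ->
          cone (K * L) (enorm (v - y)) (f v) (f y) &
        forall p, X p -> enorm (pv p) <= M -> cone (K * L) (h p) (f (pv p)) p].
Proof.
have [N packN] := @euclidean_packing R (n + n) (40 / 3).
have [J J1 cutoffJ] : exists2 J : R, 1 <= J & forall (D : set rV) y b (s r : R),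
    0 < s -> s / 2 <= r -> enorm (y - b) <= 4 * s -> jet D y s (cutoff b r) J.
  exists 2000; first by lra.
  by move=> D y b s r; exact: cutoff_jet.
pose K := glue_const J N.
have K250 : 250 <= K by exact: glue_const_ge250.
have K1 : 1 <= K by lra.
exists ((300 * K) ^+ 2); first by rewrite exprn_ege1//; clear -K1; lra.
move=> V X h s0 L M isoV X0 s00 hs XV L01 Xcone.
have L0 : 0 <= L by case/andP: L01.
pose H := height X h.
have Hs v : s0 <= H v by exact: height_ge_s0.
have H0 v : 0 < H v by exact: lt_le_trans (Hs v).
have Hlip u v : H u <= H v + enorm (u - v) by exact: height_lip hs u v.
have /choice[x xP] : forall v, exists p, X p /\ h p + enorm (v - pv p) <= 2 * H v.
  by move=> v; have [p] := height_attained X0 s00 hs v; exists p.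
have h0 p : X p -> 0 <= h p by move=> /hs; exact: le_trans (ltW s00).
have xnear v : enorm (v - pv (x v)) <= 2 * H v.
  by have [Xx xv] := xP v; have := h0 _ Xx; lra.
have xw v z : z \in V -> dotv (pw (x v)) z = 0 by move=> zV; have [/XV[_ xw] _] := xP v; exact: xw.
have xcone u v : cone L (enorm (u - v) + 4 * (H u + H v)) (x u) (x v).
  have [Xu hu] := xP u; have [Xv hv] := xP v.
  apply: cone_le (Xcone _ _ Xu Xv) => //.
  have := enorm_triangle u (pv (x u)) (pv (x v)).
  have := enorm_triangle v u (pv (x v)).
  rewrite (enormB (pv (x u)) u).
  by clear -hu hv H0; have := H0 u; have := H0 v; lra.
(* the section is controlled on the ball of radius M, which needs the net on a
   larger ball *)
pose Om v := v \in V /\ enorm v <= 3 * M.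
pose Om' v := v \in V /\ enorm v <= M.
have [B [uB sepB coverB]] := @maximal_net _ _ Om H s0 (3 * M) s00 Hs (fun v => @proj2 _ _).
have Bcount y :
    (size [seq b <- B | ((enorm (b - y) <= H y) && (3 / 5 * H y <= H b))%R] <= N)%N.
  apply: (packN _ y (3 / 40 * H y)) => //.
  - by rewrite mulr_gt0// divr_gt0.
  - exact: filter_uniq.
  - by move=> b; rewrite mem_filter => /andP[/andP[bd _] _]; clear -bd; lra.
  - move=> b c; rewrite !mem_filter => /andP[/andP[_ Hb] bB] /andP[/andP[_ Hc] cB] bc.
    apply: le_trans (sepB _ _ bB cB bc).
    have : 3 / 5 * H y <= Num.min (H b) (H c) by rewrite le_min Hb.
    by clear; lra.
have OmV v : Om v -> v \in V by case.
have Om'_Om v y u : Om' v -> Om' y -> u \in V -> enorm u <= enorm (v - y) ->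
    Om (v + u).
  move=> [vV vM] [yV yM] uV uvy; split; first by rewrite memvD.
  have := enormD v u; have := enormD v (- y); rewrite enormN.
  by clear -vM yM uvy; lra.
have [f [fv fw fcone fx]] := @horizontal_section R n V Om Om' H x
  (glued H x B) L K isoV Om'_Om L01 K250 H0 Hlip xw xnear xcone
  (fun=> erefl)
  (fun v z => @glued_perp R n V H x B xw v z)
  (glued_near L01 H0 Hlip xnear xcone coverB)
  (@glued_w_lip R n Om H x B L J N J1 cutoffJ L01 H0 Hlip xnear xcone coverB Bcount)
  (@glued_gradient R n V Om H x B L J N J1 cutoffJ OmV L01 H0 Hlip xnear xcone coverB Bcount).
clearbody K; exists f; split => //.
  by move=> v y vV yV vM yM; exact: fcone.
move=> p Xp pM; have [pV _] := XV _ Xp.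
have hp := h0 _ Xp.
have Hp : H (pv p) <= h p.
  by have := height_le X0 s00 hs (pv p) Xp; rewrite subrr enorm0 addr0.
have [Xx hx] := xP (pv p).
have c1 : cone L (2 * K * h p) (f (pv p)) (x (pv p)).
  apply: cone_le (fx _ (conj pV pM)) => //; apply: ler_wpM2l => //.
  by clear -K1; lra.
have c2 : cone L (3 * h p) (x (pv p)) p.
  by apply: cone_le (Xcone _ _ Xx Xp) => //; rewrite enormB; clear -hx Hp; lra.
have c := cone_trans L01 c1 c2.
apply: cone_rescale => //; first by clear -K1; lra.
  by rewrite fv subrr enorm0.
have hK : h p <= K * h p by rewrite ler_peMl.
by apply: cone_le c => //; clear -hK hp; lra.
Qed.

End ExtensionBounded.

(** * Extension from arbitrary sets *)

Section UltraLimit.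
Context {R : realType}.
Variable U : set_system nat.
Hypothesis ultraU : UltraFilter U.
Let properU : ProperFilter U := ultra_proper.

Lemma bounded_ultra_cvg (f : nat -> R) (M : R) :
  (\forall i \near U, `|f i| <= M) -> exists l : R, f @ U --> l.
Proof.
move=> fM.
have fU : (f @ U) `[- M, M]%classic.
  by apply: filterS fM => i; rewrite /= in_itv/= ler_norml.
have [l [_ cl]] := @segment_compact R (- M) M (f @ U) _ fU.
exists l => A Al.
have [//|UA] := in_ultra_setVsetC (f @^-1` A) ultraU.
have [z [Az nAz]] := cl (~` A) A UA Al.
by case: Az.
Qed.

Lemma ultra_cvg_sum (I : Type) (s : seq I) (f : I -> nat -> R) (l : I -> R) :
  (forall i, f i @ U --> l i) ->
  (fun k => \sum_(i <- s) f i k) @ U --> \sum_(i <- s) l i.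
Proof.
move=> fl; elim: s => [|i s ih].
  rewrite big_nil (_ : (fun _ => _) = fun=> 0); first exact: cvg_cst.
  by apply: funext => k; rewrite big_nil.
rewrite big_cons (_ : (fun _ => _) = f i \+ (fun k => \sum_(i <- s) f i k)).
  exact: cvgD.
by apply: funext => k; rewrite big_cons.
Qed.

Section Vectors.
Context {n : nat}.
Implicit Types (F G : nat -> 'rV[R]_(n + n)) (z w : 'rV[R]_(n + n)).

Definition vcvg F z := forall i, (fun k => F k 0 i) @ U --> z 0 i.

Lemma vcvg_cst z : vcvg (fun=> z) z. Proof. by move=> i; exact: cvg_cst. Qed.

Lemma vcvgB F G z w : vcvg F z -> vcvg G w -> vcvg (fun k => F k - G k) (z - w).
Proof.
move=> Fz Gw i; rewrite !mxE (_ : (fun _ => _) = (fun k => F k 0 i - G k 0 i)).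
  exact: cvgB.
by apply: funext => k; rewrite !mxE.
Qed.

Lemma cvg_dotv F G z w : vcvg F z -> vcvg G w ->
  (fun k => dotv (F k) (G k)) @ U --> dotv z w.
Proof. by move=> Fz Gw; apply: ultra_cvg_sum => i; exact: cvgM. Qed.

Lemma cvg_omega F G z w : vcvg F z -> vcvg G w ->
  (fun k => omega (F k) (G k)) @ U --> omega z w.
Proof.
move=> Fz Gw; apply: cvgMl_tmp; apply: ultra_cvg_sum => i.
by apply: cvgB; apply: cvgM.
Qed.

Lemma vcvg_bounded F (M : R) : (\forall k \near U, enorm (F k) <= M) ->
  exists z, vcvg F z.
Proof.
move=> FM; have /choice[l lP] : forall i, exists l : R, (fun k => F k 0 i) @ U --> l.
  move=> i; apply: (@bounded_ultra_cvg _ M); apply: filterS FM => k.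
  exact/le_trans/coord_le_enorm.
by exists (\row_i l i) => i; rewrite mxE.
Qed.

Definition pcvg (P : nat -> gpt R n) (p : gpt R n) :=
  [/\ forall k, pv (P k) = pv p, vcvg (fun k => pw (P k)) (pw p) &
      (fun k => pt (P k)) @ U --> pt p].

Lemma cone_ultra_lim L (r : nat -> R) (l : R) P Q p q : 0 <= L ->
  pcvg P p -> pcvg Q q -> r @ U --> l ->
  (\forall k \near U, cone L (r k) (P k) (Q k)) -> cone L l p q.
Proof.
move=> L0 [Pv Pw Pt] [Qv Qw Qt] rl PQ.
have dw : (fun k => dotv (pw (P k) - pw (Q k)) (pw (P k) - pw (Q k))) @ U -->
    dotv (pw p - pw q) (pw p - pw q) by apply: cvg_dotv; exact: vcvgB.
have dd : (fun k => defect (P k) (Q k)) @ U --> defect p q.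
  rewrite /defect; apply: cvgB; last exact: cvg_omega.
  apply: cvgD; first exact: cvgB.
  apply: cvgMl_tmp; apply: cvg_omega => //.
  rewrite (_ : (fun _ => _) = fun=> pv p - pv q); first exact: vcvg_cst.
  by apply: funext => k; rewrite Pv Qv.
have l0 : 0 <= l.
  apply: (@ler_cvg_to _ U _ _ (fun=> 0) r) => //; first exact: cvg_cst.
  by apply: filterS PQ => k; exact: cone_ge0.
split.
- apply: (@ler_cvg_to _ U _ _ (fun=> enorm (pv p - pv q)) r) => //.
    exact: cvg_cst.
  by apply: filterS PQ => k [+ _ _]; rewrite Pv Qv.
- apply: enorm_le; first by rewrite mulr_ge0.
  apply: (@ler_cvg_to _ U _ _ _ (fun k => L * r k * (L * r k)) _ _ dw).
    by rewrite expr2; apply: cvgM; exact: cvgMl_tmp.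
  apply: filterS PQ => k PQ; have rk := cone_ge0 PQ; case: PQ => _ w _.
  by rewrite -enorm2 expr2 ler_pM// enorm_ge0.
- apply: (@ler_cvg_to _ U _ _ (fun k => `|defect (P k) (Q k)|)
    (fun k => L * (r k * r k))).
  + exact: cvg_norm.
  + by rewrite expr2; apply: cvgMl_tmp; exact: cvgM.
  + by apply: filterS PQ => k [_ _]; rewrite expr2.
Qed.

End Vectors.

End UltraLimit.

Section Extension.
Context {R : realType} {n : nat}.
Local Notation rV := 'rV[R]_(n + n).

Lemma cone_bounded (L r M : R) : 0 <= L -> 0 <= r -> 0 <= M -> exists M' : R,
  0 <= M' /\ forall p q : gpt R n, cone L r p q ->
    enorm (pw q) <= M -> `|pt q| <= M -> enorm (pw p) <= M' /\ `|pt p| <= M'.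
Proof.
move=> L0 r0 M0.
exists (L * r + M + (L * r ^+ 2 + M + r * M + M * (L * r + M))).
have Lr : 0 <= L * r by rewrite mulr_ge0.
have Lr2 : 0 <= L * r ^+ 2 by rewrite mulr_ge0 ?sqr_ge0.
have rM : 0 <= r * M by rewrite mulr_ge0.
have MM : 0 <= M * (L * r + M) by rewrite mulr_ge0// addr_ge0.
split; first by rewrite !addr_ge0.
move=> p q [v w d] wq tq.
have wp : enorm (pw p) <= L * r + M.
  by rewrite -(subrK (pw q) (pw p)) (le_trans (enormD _ _))// lerD.
split; first by lra.
have o1 := omega_le (pv p - pv q) (pw q).
have o2 := omega_le (pw q) (pw p).
have o1' : enorm (pv p - pv q) * enorm (pw q) <= r * M.
  by rewrite ler_pM ?enorm_ge0.
have o2' : enorm (pw q) * enorm (pw p) <= M * (L * r + M).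
  by rewrite ler_pM ?enorm_ge0.
have -> : pt p = defect p q + pt q - 2 * omega (pv p - pv q) (pw q)
    + omega (pw q) (pw p) by rewrite /defect; ring.
move: d tq o1 o2; rewrite !ler_norml => /andP[d1 d2] /andP[t1 t2].
move=> /andP[u1 u2] /andP[w1 w2].
by clear -Lr Lr2 rM MM M0 o1' o2' d1 d2 t1 t2 u1 u2 w1 w2; apply/andP; split; lra.
Qed.

(** Intrinsic Lipschitz data of small constant extend to a whole horizontal
    subgroup, with an error at each point that is small relative to its height.
    The heights may vanish: the extension is a limit, along an ultrafilter, of
    the extensions for the heights h + 1 / k. *)
Lemma lipschitz_extension : exists2 K : R, 1 <= K &
  forall (V : {vspace rV}) (X : set (gpt R n)) (h : gpt R n -> R) (L : R),
    isotropic V -> X !=set0 -> (forall p, X p -> 0 <= h p) ->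
    (forall p, X p -> pv p \in V /\ forall z, z \in V -> dotv (pw p) z = 0) ->
    0 <= L <= 1 ->
    (forall p q, X p -> X q -> cone L (enorm (pv p - pv q) + h p + h q) p q) ->
    exists f : rV -> gpt R n,
    [/\ forall v, pv (f v) = v,
        forall v z, v \in V -> z \in V -> dotv (pw (f v)) z = 0,
        forall v y, v \in V -> y \in V ->
          cone (K * L) (enorm (v - y)) (f v) (f y) &
        forall p, X p -> cone (K * L) (h p) (f (pv p)) p].
Proof.
have [K K1 ext] := @extension_bounded R n; exists K => //.
move=> V X h L isoV X0 h0 XV L01 Xcone.
have L0 : 0 <= L by case/andP: L01.
have KL0 : 0 <= K * L by rewrite mulr_ge0// (le_trans ler01).
pose e k : R := k.+1%:R^-1.
have e0 k : 0 < e k by rewrite invr_gt0.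
have e1 k : e k <= 1 by rewrite invf_le1 ?ler1n// ltr0n.
have /choice[f fP] : forall k : nat, exists f : rV -> gpt R n,
    [/\ forall v, pv (f v) = v,
        forall v z, z \in V -> dotv (pw (f v)) z = 0,
        forall v y, v \in V -> y \in V -> enorm v <= k%:R -> enorm y <= k%:R ->
          cone (K * L) (enorm (v - y)) (f v) (f y) &
        forall p, X p -> enorm (pv p) <= k%:R ->
          cone (K * L) (h p + e k) (f (pv p)) p].
  move=> k; apply: (ext V X (fun p => h p + e k) (e k) L k%:R) => //.
    by move=> p Xp; rewrite lerDr h0.
  move=> p q Xp Xq; apply: cone_le (Xcone p q Xp Xq) => //.
  have := e0 k; lra.
have [U [ultraU Uoo]] := ultraFilterLemma (@eventually_filter).
have properU : ProperFilter U := ultra_proper.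
have Ubig (a : R) : \forall k \near U, a <= k%:R.
  apply: Uoo; exists (Num.truncn a).+1 => // k /= ka.
  apply: ltW; apply: lt_le_trans (truncnS_gt a) _.
  by rewrite ler_nat.
have Ue : e @ U --> (0 : R).
  have : e @ \oo --> (0 : R) by exact: cvg_harmonic.
  by apply: cvg_trans => A /Uoo.
have [p0 Xp0] := X0; have [p0V _] := XV _ Xp0.
have /choice[g gP] : forall v, exists q : gpt R n,
    v \in V -> pcvg U (fun k => f k v) q.
  move=> v; have [vV|] := boolP (v \in V); last by exists p0.
  pose M := Num.max (enorm (pw p0)) `|pt p0|.
  have M0 : 0 <= M by rewrite le_max enorm_ge0.
  have r1 : 0 <= h p0 + 1 by rewrite addr_ge0// h0.
  have [M1 [M10 b1]] := cone_bounded KL0 r1 M0.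
  have [M2 [M20 b2]] := cone_bounded KL0 (enorm_ge0 (v - pv p0)) M10.
  have bnd : \forall k \near U,
      enorm (pw (f k v)) <= M2 /\ `|pt (f k v)| <= M2.
    apply: filterS2 (Ubig (enorm v)) (Ubig (enorm (pv p0))) => k vk pk.
    have [_ _ f1 f2] := fP k.
    have c2 : cone (K * L) (h p0 + 1) (f k (pv p0)) p0.
      by apply: cone_le (f2 _ Xp0 pk) => //; rewrite lerD2l.
    have [h1 h2] : enorm (pw (f k (pv p0))) <= M1 /\ `|pt (f k (pv p0))| <= M1.
      by apply: b1 c2 _ _; rewrite le_max lexx// orbT.
    exact: b2 (f1 _ _ vV p0V vk pk) h1 h2.
  have [z zP] := vcvg_bounded ultraU (filterS (fun k => @proj1 _ _) bnd).
  have [t tP] := bounded_ultra_cvg ultraU (filterS (fun k => @proj2 _ _) bnd).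
  by exists (GPt v z t); split => // k; case: (fP k) => ->.
pose F v := GPt v (pw (g v)) (pt (g v)).
have FP v : v \in V -> pcvg U (fun k => f k v) (F v).
  by move=> /gP[_ ? ?]; split => // k; case: (fP k) => ->.
exists F; split => //.
- move=> v z vV zV; have [_ wv _] := FP v vV.
  have dz : (fun k => dotv (pw (f k v)) z) @ U --> dotv (pw (F v)) z.
    by apply: cvg_dotv wv _; exact: vcvg_cst.
  rewrite (_ : (fun _ => _) = fun=> 0) in dz; last first.
    by apply: funext => k; case: (fP k) => _ ->.
  by apply: (norm_cvg_unique dz); exact: cvg_cst.
- move=> v y vV yV.
  apply: (cone_ultra_lim ultraU KL0 (FP v vV) (FP y yV) (cvg_cst _)).
  apply: filterS2 (Ubig (enorm v)) (Ubig (enorm y)) => k vk yk.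
  by case: (fP k) => _ _ + _; apply.
- move=> p Xp; have [pV _] := XV _ Xp.
  have pp : pcvg U (fun=> p) p.
    by split => //; [exact: vcvg_cst|exact: cvg_cst].
  have rp : (fun k => h p + e k) @ U --> h p.
    by rewrite -[X in _ --> X]addr0; apply: cvgD => //; exact: cvg_cst.
  apply: (cone_ultra_lim ultraU KL0 (FP _ pV) pp rp).
  apply: filterS (Ubig (enorm (pv p))) => k pk.
  by case: (fP k) => _ _ _; apply.
Qed.

End Extension.

(** * Split coordinates in the Heisenberg group *)

Section Coordinates.
Context {R : realType} {n : nat}.
Local Notation rV := 'rV[R]_(n + n).
Variable V : {vspace rV}.
Hypothesis isoV : isotropic V.
Implicit Types (x y g : heis R n) (p q : gpt R n).

Definition coords x : gpt R n :=
  let v := orthproj V (hz x) in let w := hz x - v in GPt v w (ht x - omega v w).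

Definition of_coords p : heis R n := Heis (pv p + pw p) (pt p + omega (pv p) (pw p)).

Lemma coordsK x : of_coords (coords x) = x.
Proof. by case: x => z t; rewrite /of_coords /coords/= subrK addrC subrK. Qed.

Lemma of_coordsK p : pv p \in V -> (forall z, z \in V -> dotv (pw p) z = 0) ->
  coords (of_coords p) = p.
Proof.
case: p => v w t /= vV wV; rewrite /coords /of_coords /=.
have -> : orthproj V (v + w) = v.
  by apply: orthproj_unique => // u uV; rewrite addrAC subrr add0r wV.
by rewrite (_ : v + w - v = w) ?addrK// addrAC subrr add0r.
Qed.

Lemma coords_in x : pv (coords x) \in V. Proof. exact: orthproj_in. Qed.

Lemma coords_perp x z : z \in V -> dotv (pw (coords x)) z = 0.
Proof. exact: dotv_perp. Qed.

Lemma hz_diff x y : hz (y^-1 * x)%g = hz x - hz y.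
Proof. by rewrite /= addrC. Qed.

Lemma hz_hproj x y : hz (hproj V (y^-1 * x)%g) = pv (coords x) - pv (coords y).
Proof. by rewrite /= -orthprojB addrC. Qed.

Lemma hz_vprojE g : hz (vproj V g) = hz g - orthproj V (hz g).
Proof. by rewrite /= addrC. Qed.

Lemma ht_vprojE g : ht (vproj V g) = ht g - omega (orthproj V (hz g)) (hz g).
Proof. by rewrite /= oppr0 add0r omegaNl. Qed.

Lemma hz_vproj x y : hz (vproj V (y^-1 * x)%g) = pw (coords x) - pw (coords y).
Proof.
rewrite [LHS]/= addrC (addrC (- hz y)) orthprojB /=.
by apply/rowP => i; rewrite !mxE; ring.
Qed.

(** This identity is what ties [defect] to the group: the twist of the product
    and the non-commutativity of the projections combine into it. *)
Lemma ht_vproj x y : ht (vproj V (y^-1 * x)%g) = defect (coords x) (coords y).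
Proof.
rewrite [LHS]/= oppr0 add0r (addrC (- hz y)) orthprojB /defect /coords /=.
have := coords_in x; have := coords_in y; rewrite /coords /=.
move: (orthproj V (hz x)) (orthproj V (hz y)) => v v' v'V vV.
have [w ->] : exists w, hz x = w + v by exists (hz x - v); rewrite subrK.
have [w' ->] : exists w', hz y = w' + v' by exists (hz y - v'); rewrite subrK.
rewrite !addrK.
have vv' := isoV vV v'V; have v'v := isoV v'V vV.
rewrite !(omegaDl, omegaDr, omegaNl, omegaNr) !omegaxx vv' v'v.
by rewrite (omega_anti w' v); ring.
Qed.

Lemma knorm_hor (z : rV) : knorm (Heis z 0 : heis R n) = enorm z.
Proof.
apply: (@pexpIrn R 4) => //; rewrite ?nnegrE ?knorm_ge0 ?enorm_ge0//.
by rewrite knorm4 /= expr0n/= mulr0 addr0 -enorm2 -exprM.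
Qed.

Lemma knorm_hproj x y :
  knorm (hproj V (y^-1 * x)%g) = enorm (pv (coords x) - pv (coords y)).
Proof. by rewrite -hz_hproj knorm_hor. Qed.

Lemma affproj_dist (a : heis R n) x y :
  mdist (affproj a V x) (affproj a V y) = enorm (pv (coords x) - pv (coords y)).
Proof.
rewrite -[LHS]/(knorm ((affproj a V y)^-1 * affproj a V x)%g) /affproj.
rewrite invgM -mulgA mulKg.
set u := hproj V (a^-1 * x)%g; set u' := hproj V (a^-1 * y)%g.
rewrite (_ : (u'^-1 * u)%g = Heis (hz u - hz u') 0) ?knorm_hor.
  by congr enorm; rewrite !hz_hproj opprB addrA subrK.
rewrite /u /u'; congr Heis; rewrite /= ?oppr0 ?add0r.
  by rewrite addrC.
by rewrite omegaNl isoV ?oppr0//; exact: orthproj_in.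
Qed.

Lemma enorm_hz_le g : enorm (hz g) <= knorm g.
Proof.
rewrite -(ler_pXn2r (ltn0Sn 3)) ?nnegrE ?knorm_ge0 ?enorm_ge0// knorm4.
by rewrite (exprM _ 2 2) enorm2 lerDl mulr_ge0 ?sqr_ge0.
Qed.

Lemma ht_le g : 4 * `|ht g| <= knorm g ^+ 2.
Proof.
rewrite -(ler_pXn2r (ltn0Sn 1)) ?nnegrE ?sqr_ge0 ?mulr_ge0//.
rewrite -exprM knorm4 exprMn real_normK ?num_real//.
have := sqr_ge0 (dotv (hz g) (hz g)); lra.
Qed.

Lemma vproj_le x y (lam r : R) : 0 <= lam <= 1 -> cone lam r (coords x) (coords y) ->
  knorm (vproj V (y^-1 * x)%g) ^+ 4 <= 17 * lam ^+ 2 * r ^+ 4.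
Proof.
move=> /andP[l0 l1] c; have r0 := cone_ge0 c; case: c => _ w d.
rewrite knorm4 hz_vproj ht_vproj -enorm2.
have h1 : (enorm (pw (coords x) - pw (coords y)) ^+ 2) ^+ 2 <= lam ^+ 2 * r ^+ 4.
  rewrite -exprM; apply: le_trans (_ : (lam * r) ^+ 4 <= _).
    by rewrite ler_pXn2r// nnegrE ?enorm_ge0// mulr_ge0.
  rewrite exprMn ler_wpM2r ?exprn_ge0// (exprD _ 2 2) ler_piMr ?sqr_ge0//.
  by rewrite exprn_ile1.
have h2 : defect (coords x) (coords y) ^+ 2 <= lam ^+ 2 * r ^+ 4.
  rewrite -real_normK ?num_real// (_ : _ * _ = (lam * r ^+ 2) ^+ 2); last by ring.
  by rewrite ler_pXn2r// nnegrE// mulr_ge0 ?sqr_ge0.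
lra.
Qed.

Lemma vproj_le_small x y (eta lam r : R) : 0 <= eta -> 0 <= lam <= 1 ->
  lam <= eta ^+ 2 / 20 -> cone lam r (coords x) (coords y) ->
  knorm (vproj V (y^-1 * x)%g) <= eta * r.
Proof.
move=> eta0 l01 le c; have r0 := cone_ge0 c; have h := vproj_le l01 c.
have l0 : 0 <= lam by case/andP: l01.
rewrite -(ler_pXn2r (ltn0Sn 3)) ?nnegrE ?knorm_ge0 ?mulr_ge0//.
apply: le_trans h _; rewrite exprMn ler_wpM2r ?exprn_ge0//.
have : lam ^+ 2 <= (eta ^+ 2 / 20) ^+ 2.
  by rewrite ler_pXn2r// nnegrE divr_ge0 ?sqr_ge0.
rewrite expr_div_n -exprM; have : 0 <= eta ^+ 4 by rewrite exprn_ge0.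
by lra.
Qed.

(** With equal feet the horizontal part along V of y^-1 x vanishes, so the
    distance is exactly the vertical projection that the cone condition bounds. *)
Lemma dist_same_foot x y (eta lam r : R) : 0 <= eta -> 0 <= lam <= 1 ->
  lam <= eta ^+ 2 / 20 -> pv (coords x) = pv (coords y) ->
  cone lam r (coords x) (coords y) -> mdist y x <= eta * r.
Proof.
move=> eta0 l01 le xy c; apply: le_trans (vproj_le_small eta0 l01 le c).
rewrite -[mdist y x]/(kdist y x) kdist_sym /kdist le_eqVlt; apply/orP; left; apply/eqP.
congr knorm; rewrite /vproj (_ : hproj V _ = 1%g) ?invg1 ?mul1g//.
have := hz_hproj x y; rewrite xy subrr => h0.
by rewrite [LHS](_ : _ = Heis (hz (hproj V (y^-1 * x)%g)) 0)// h0.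
Qed.

(** Two points whose distance is almost that of their projections lie in a small
    cone of each other: the vertical part and the horizontal part of y^-1 x
    transversal to V have to compete with its part along V. *)
Lemma cone_planar x y (eps L : R) : 0 <= eps <= 1 -> 0 <= L ->
  60 * eps <= L ^+ 2 ->
  mdist x y <= (1 + eps) * enorm (pv (coords x) - pv (coords y)) ->
  cone L (enorm (pv (coords x) - pv (coords y))) (coords x) (coords y).
Proof.
move=> /andP[e0 e1] L0 eL; rewrite -[mdist x y]/(knorm (y^-1 * x)%g) => xy.
set g := (y^-1 * x)%g in xy.
set a := enorm (pv (coords x) - pv (coords y)) in xy *.
pose b := enorm (pw (coords x) - pw (coords y)).
have a0 : 0 <= a := enorm_ge0 _; have b0 : 0 <= b := enorm_ge0 _.
have gE : dotv (hz g) (hz g) = a ^+ 2 + b ^+ 2.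
  by rewrite (pythagoras V) /a /b !enorm2 -hz_hproj -hz_vproj hz_vprojE.
have g4 : (a ^+ 2 + b ^+ 2) ^+ 2 + 16 * ht g ^+ 2 <= (1 + eps) ^+ 4 * a ^+ 4.
  rewrite -gE -knorm4 -exprMn ler_pXn2r// nnegrE ?knorm_ge0//.
  by rewrite mulr_ge0// addr_ge0.
have a20 := sqr_ge0 a; have b20 := sqr_ge0 b; have t20 := sqr_ge0 (ht g).
have e4 : (1 + eps) ^+ 4 <= 1 + 15 * eps.
  have : eps ^+ 2 <= eps by rewrite expr2 ler_piMl.
  have : eps ^+ 3 <= eps by rewrite exprS ler_piMr// exprn_ile1.
  have : eps ^+ 4 <= eps by rewrite exprS ler_piMr// exprn_ile1.
  by rewrite (_ : (1 + eps) ^+ 4 = 1 + 4 * eps + 6 * eps ^+ 2 + 4 * eps ^+ 3 + eps ^+ 4);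
    [lra|ring].
have a4 : (1 + eps) ^+ 4 * a ^+ 4 <= (1 + L ^+ 2 / 4) * (a ^+ 2 * a ^+ 2).
  rewrite -exprD ler_wpM2r ?exprn_ge0//; lra.
have L20 := sqr_ge0 L.
have bL : b <= L * a.
  rewrite -(ler_pXn2r (ltn0Sn 1)) ?nnegrE ?mulr_ge0// exprMn.
  have [az|az] := eqVneq (a ^+ 2) 0.
    rewrite az; rewrite az in g4 a4; nra.
  have apos : 0 < a ^+ 2 by rewrite lt_def az.
  rewrite -(ler_pM2r apos).
  have : (a ^+ 2 + b ^+ 2) ^+ 2 = a ^+ 2 * a ^+ 2 + 2 * (b ^+ 2 * a ^+ 2) + b ^+ 2 * b ^+ 2.
    by ring.
  have : 0 <= b ^+ 2 * b ^+ 2 by rewrite mulr_ge0.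
  have : 0 <= L ^+ 2 * (a ^+ 2 * a ^+ 2) by rewrite !mulr_ge0.
  by lra.
have tL : `|ht g| <= L / 8 * a ^+ 2.
  rewrite -(ler_pXn2r (ltn0Sn 1)) ?nnegrE ?mulr_ge0 ?divr_ge0//.
  rewrite real_normK ?num_real//.
  have : (a ^+ 2 + b ^+ 2) ^+ 2 = a ^+ 2 * a ^+ 2 + 2 * (b ^+ 2 * a ^+ 2) + b ^+ 2 * b ^+ 2.
    by ring.
  have : 0 <= b ^+ 2 * b ^+ 2 by rewrite mulr_ge0.
  have : 0 <= b ^+ 2 * a ^+ 2 by rewrite mulr_ge0.
  rewrite (_ : (L / 8 * a ^+ 2) ^+ 2 = L ^+ 2 * (a ^+ 2 * a ^+ 2) / 64); last by field.
  by lra.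
split => //.
rewrite -ht_vproj -/g ht_vprojE.
(* the vertical coordinate of vproj V g differs from that of g by a twist *)
have om : `|omega (orthproj V (hz g)) (hz g)| <= L / 2 * a ^+ 2.
  have -> : omega (orthproj V (hz g)) (hz g) =
      omega (orthproj V (hz g)) (hz g - orthproj V (hz g)).
    by rewrite omegaDr omegaNr omegaxx oppr0 addr0.
  apply: le_trans (omega_le _ _) _.
  have -> : orthproj V (hz g) = pv (coords x) - pv (coords y) by rewrite -hz_hproj.
  have -> : hz g - (pv (coords x) - pv (coords y)) = pw (coords x) - pw (coords y).
    by rewrite /g hz_diff /=; apply/rowP => i; rewrite !mxE; ring.
  rewrite -/a -/b; have : a * b <= a * (L * a) by rewrite ler_wpM2l.
  rewrite expr2; lra.
apply: le_trans (ler_normB _ _) _.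
have : 0 <= L * a ^+ 2 by rewrite mulr_ge0.
by lra.
Qed.

(** Points at distance at most L r cannot be separated at scale r, in whichever
    direction they lie. *)
Lemma cone_near x y (L r : R) : 0 <= L <= 1 -> 0 <= r -> mdist x y <= L * r ->
  cone L r (coords x) (coords y).
Proof.
move=> /andP[L0 L1] r0; rewrite -[mdist x y]/(knorm (y^-1 * x)%g) => xy.
set g := (y^-1 * x)%g in xy.
have Lr : 0 <= L * r by rewrite mulr_ge0.
have zg : enorm (hz g) <= L * r := le_trans (enorm_hz_le g) xy.
have pv_le : enorm (pv (coords x) - pv (coords y)) <= L * r.
  by rewrite -hz_hproj (le_trans (enorm_orthproj _ _)).
have pw_le : enorm (pw (coords x) - pw (coords y)) <= L * r.
  apply: enorm_le => //; rewrite -hz_vproj.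
  apply: le_trans (_ : enorm (hz g) ^+ 2 <= _).
    rewrite enorm2 [leRHS](pythagoras V).
    by rewrite hz_vprojE lerDr dotvv_ge0.
  by rewrite ler_pXn2r// nnegrE enorm_ge0.
have LLr : (L * r) ^+ 2 <= L * r ^+ 2.
  by rewrite exprMn ler_wpM2r ?sqr_ge0// expr2 ler_piMl.
split => //; first by rewrite (le_trans pv_le)// ler_piMl.
rewrite -ht_vproj -/g ht_vprojE.
apply: le_trans (ler_normB _ _) _.
have tg := ht_le g.
have k2 : knorm g ^+ 2 <= (L * r) ^+ 2 by rewrite ler_pXn2r// nnegrE ?knorm_ge0.
have o := omega_le (orthproj V (hz g)) (hz g).
have : enorm (orthproj V (hz g)) * enorm (hz g) <= (L * r) * (L * r).
  by rewrite ler_pM ?enorm_ge0// (le_trans (enorm_orthproj _ _)).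
by have := sqr_ge0 (L * r); rewrite -expr2; lra.
Qed.

End Coordinates.

(** * Distances, diameters and cubes *)

Section MetricFacts.
Context {R : realType} {M : metricType R}.
Implicit Types (A B : set M) (x y : M).

Lemma dist_set_ge0 x A : (0 <= dist_set x A)%E.
Proof. by apply: le_ereal_inf_tmp => _ [a _ <-]; rewrite lee_fin mdist_ge0. Qed.

Lemma dist_set_le x a A : A a -> (dist_set x A <= (mdist x a)%:E)%E.
Proof. by move=> Aa; apply: ge_ereal_inf; exists (mdist x a)%:E => //; exists a. Qed.

Lemma dist_set_lt x A (r : R) : (dist_set x A < r%:E)%E ->
  exists2 a, A a & mdist x a < r.
Proof.
move=> /ereal_inf_lt[_ [a Aa <-]]; rewrite lte_fin => ar.
by exists a.
Qed.

Lemma dist_setS x A B : A `<=` B -> (dist_set x B <= dist_set x A)%E.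
Proof. by move=> AB; apply: ereal_inf_le_tmp; exact: image_subset. Qed.

Lemma mdist_le_diam x y A : A x -> A y -> ((mdist x y)%:E <= diam A)%E.
Proof. by move=> Ax Ay; apply: ereal_sup_ubound; right; exists (x, y). Qed.

Lemma diam_ge0 A : (0 <= diam A)%E.
Proof. by apply: ereal_sup_ubound; left. Qed.

Lemma diam_le A (r : R) : 0 <= r -> (forall x y, A x -> A y -> mdist x y <= r) ->
  (diam A <= r%:E)%E.
Proof.
move=> r0 Ar; apply: ge_ereal_sup => _ [->|[[x y] [/= Ax Ay] <-]].
  by rewrite lee_fin.
by rewrite lee_fin Ar.
Qed.

Lemma diamS A B : A `<=` B -> (diam A <= diam B)%E.
Proof.
move=> AB; apply: ereal_sup_le; apply: setUS; apply: image_subset.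
by move=> p [] /AB ? /AB.
Qed.

Lemma diam_set0 : diam (set0 : set M) = 0%E.
Proof.
apply/eqP; rewrite eq_le diam_ge0 andbT.
by apply: (@diam_le _ 0) => // x y [].
Qed.

End MetricFacts.

Section Cubes.
Context {R : realType} {M : metricType R} {k : nat} {E : set M}.
Variable Dy : dyadic_system k E.
Implicit Types (Q T : set M).
Local Notation rho := (ds_rho Dy).
Local Notation D := (ds_D Dy).

Lemma rho_gt0 : 0 < rho. Proof. by case/andP: (ds_rho01 Dy). Qed.
Lemma rho_lt1 : rho < 1. Proof. by case/andP: (ds_rho01 Dy). Qed.
Lemma D_gt0 : 0 < D. Proof. exact: lt_trans (ds_D1 Dy). Qed.

Lemma cube_sub Q : cubes Dy Q -> Q `<=` E.
Proof. by case=> j jJ Qj; rewrite (ds_cover jJ); exact: bigcup_sup. Qed.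

Definition rdiam Q : R := fine (diam Q).

Lemma cube_diamE Q : cubes Dy Q -> diam Q = (rdiam Q)%:E.
Proof.
case=> j jJ Qj; have [_ h] := ds_diam jJ Qj; rewrite /rdiam fineK//.
by rewrite ge0_fin_numE ?diam_ge0// (le_lt_trans h)// ltry.
Qed.

Lemma cube_diam_bounds j Q : ds_index Dy j -> ds_gen Dy j Q ->
  D^-1 * rho ^ j <= rdiam Q <= D * rho ^ j.
Proof.
move=> jJ Qj; have := ds_diam jJ Qj; rewrite cube_diamE; last by exists j.
by rewrite !lee_fin => -[-> ->].
Qed.

Lemma cube_rdiam_gt0 Q : cubes Dy Q -> 0 < rdiam Q.
Proof.
case=> j jJ Qj; have /andP[h _] := cube_diam_bounds jJ Qj.
by rewrite (lt_le_trans _ h)// mulr_gt0 ?invr_gt0 ?D_gt0// exprz_gt0// rho_gt0.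
Qed.

Lemma cube_nonempty Q : cubes Dy Q -> Q !=set0.
Proof.
move=> cQ; apply/set0P; apply/eqP => Q0; have := cube_rdiam_gt0 cQ.
by rewrite /rdiam Q0 diam_set0 ltxx.
Qed.

Lemma rdiamS Q T : cubes Dy Q -> cubes Dy T -> Q `<=` T -> rdiam Q <= rdiam T.
Proof.
by move=> cQ cT /diamS; rewrite (cube_diamE cQ) (cube_diamE cT) lee_fin.
Qed.

Lemma cube_nested Q T : cubes Dy Q -> cubes Dy T -> Q `&` T !=set0 ->
  Q `<=` T \/ T `<=` Q.
Proof. by move=> [i iJ Qi] [j jJ Tj]; exact: ds_nested iJ jJ Qi Tj. Qed.

Lemma is_topP S T : is_top S T -> is_top S (top S).
Proof. by move=> ST; apply: (@getPex _ (is_top S)); exists T. Qed.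

Lemma top_unique S T : is_top S T -> top S = T.
Proof.
move=> tT; have [S1 m1] := is_topP tT; case: tT => S2 m2.
by apply/seteqP; split; [exact: m2|exact: m1].
Qed.

Section Tree.
Variable S : set (set M).
Hypothesis Scubes : S `<=` cubes Dy.
Hypothesis Scoh : coherent Dy S.

Lemma top_in : S (top S).
Proof. by case: Scoh => -[T /is_topP[]]. Qed.

Lemma sub_top Q : S Q -> Q `<=` top S.
Proof. by case: Scoh => -[T /is_topP[_ h]] _ _; exact: h. Qed.

Lemma tree_height_le x Q : S Q -> (tree_height S x <= dist_set x Q + diam Q)%E.
Proof. by move=> SQ; apply: ge_ereal_inf; exists (dist_set x Q + diam Q)%E => //; exists Q. Qed.

Lemma tree_height_ge0 x : (0 <= tree_height S x)%E.
Proof.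
apply: le_ereal_inf_tmp => _ [Q _ <-].
by rewrite adde_ge0 ?dist_set_ge0 ?diam_ge0.
Qed.

Lemma tree_height_fin x : tree_height S x = (fine (tree_height S x))%:E.
Proof.
rewrite fineK// ge0_fin_numE ?tree_height_ge0//.
apply: le_lt_trans (tree_height_le x top_in) _.
have ct := Scubes top_in; have [a ta] := cube_nonempty ct.
rewrite (cube_diamE ct); apply: le_lt_trans (leeD2r _ (dist_set_le x ta)) _.
by rewrite -EFinD ltry.
Qed.

End Tree.

End Cubes.

(** * From planes to graphs *)

Section PlanesToGraphs.
Context {R : realType} {n k : nat} {E : set (heis R n)}.
Variable Dy : dyadic_system k E.

(** The coronization is kept. On a tree, points of the enlarged top that are far
    apart compared with their heights are almost isometric to their projections,
    and the others are close; either way they lie in small cones of each other, at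
    the scale of their distance plus their heights. So [lipschitz_extension]
    applies to them, with the height of the tree as the height of the data, and
    this height is at most 2 diam Q at the points near a cube Q of the tree. *)
Lemma planes_to_graphs (K0 : R) : 2 <= K0 ->
  corona_planes Dy K0 -> corona_ilg Dy.
Proof.
move=> K02 planes eta eta0.
have [K K1 ext] := @lipschitz_extension R n.
have K_gt0 : 0 < K by exact: lt_le_trans K1.
have ge0 (b c d : R) : 0 <= b -> 0 <= c -> 0 <= d -> 0 <= b + c + d by lra.
have ge1 (b c d : R) : 0 <= c -> 0 <= d -> b <= b + c + d by lra.
have ge2 (b c d : R) : 0 <= b -> 0 <= d -> c <= b + c + d by lra.
pose lam : R := Num.min 1 ((eta / 2) ^+ 2 / 20).
have lam0 : 0 < lam by rewrite lt_min ltr01 divr_gt0// exprn_gt0// divr_gt0.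
have lam1 : lam <= 1 by rewrite ge_min lexx.
have lam01 : 0 <= lam <= 1 by rewrite (ltW lam0).
have laml : lam <= (eta / 2) ^+ 2 / 20 by rewrite ge_min lexx orbT.
have e20 : 0 <= eta / 2 by rewrite divr_ge0// ltW.
pose L : R := lam / K.
have L0 : 0 < L by rewrite divr_gt0.
have KL : K * L = lam by rewrite /L mulrC divfK// gt_eqF.
have L1 : L <= 1.
  by rewrite /L ler_pdivrMr// mul1r (le_trans lam1).
have L01 : 0 <= L <= 1 by rewrite (ltW L0).
pose eps : R := Num.min (L / 2) (L ^+ 2 / 200).
have L20 : 0 < L ^+ 2 by rewrite exprn_gt0.
have eps0 : 0 < eps by rewrite lt_min; clear -Dy L0 L20; apply/andP; split; lra.
have epsL : eps <= L / 2 by rewrite ge_min lexx.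
have epsL2 : eps <= L ^+ 2 / 200 by rewrite ge_min lexx orbT.
clearbody eps.
have e21 : 0 <= 2 * eps <= 1 by clear -Dy eps0 epsL L1; apply/andP; split; lra.
have e60 : 60 * (2 * eps) <= L ^+ 2 by clear -Dy epsL2 L20; lra.
have epsL1 : eps <= L by clear -Dy epsL L0; lra.
clearbody L; clearbody lam.
have [C C0 [G [B [F [cor FV]]]]] := planes eps eps0.
exists C => //; exists G, B, F; split => // S FS.
have [_ _ [GF _] coh _] := cor.
have Scoh := coh _ FS.
have Scubes : S `<=` cubes Dy.
  case: cor => -[-> _] _ _ _ _ Q SQ; left; rewrite GF; by exists S.
have ct := Scubes _ (top_in Scoh); have topd := cube_diamE ct.
have topd0 := cube_rdiam_gt0 ct.
have [a [V [[dimV isoV] Vd]]] := FV _ FS.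
pose hh x := fine (tree_height S x).
have hhE x : tree_height S x = (hh x)%:E := tree_height_fin Scubes Scoh x.
have hh0 x : 0 <= hh x by rewrite -lee_fin -hhE tree_height_ge0.
clearbody hh.
pose Xs := dilate E K0 (top S).
pose X := [set coords V x | x in Xs].
have Xs_near Q x : S Q -> E x -> (dist_set x Q <= diam Q)%E -> Xs x.
  move=> SQ Ex xQ; split => //.
  apply: le_trans (dist_setS x (sub_top Scoh SQ)) _; apply: (le_trans xQ).
  apply: le_trans (diamS (sub_top Scoh SQ)) _.
  by rewrite topd -EFinM lee_fin; apply: ler_peMl; [exact: ltW|by clear -Dy K02; lra].
have X0 : X !=set0.
  have [x tx] := cube_nonempty ct; exists (coords V x), x => //.
  apply: (Xs_near (top S)) => //; [exact: (top_in Scoh)|exact: (cube_sub ct tx)|].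
  apply: le_trans (diam_ge0 _); apply: le_trans (dist_set_le x tx) _.
  by rewrite mdistxx.
have Xcone p q : X p -> X q ->
    cone L (enorm (pv p - pv q) + hh (of_coords p) + hh (of_coords q)) p q.
  move=> [x Xx <-] [y Xy <-]; rewrite !coordsK.
  have hx := hh0 x; have hy := hh0 y.
  have e0 := enorm_ge0 (pv (coords V x) - pv (coords V y)).
  have [far|near] := ltP (eps * Num.min (hh x) (hh y)) (mdist x y).
    have xy : mdist x y <= (1 + 2 * eps) * mdist (affproj a V x) (affproj a V y).
      apply: Vd Xx Xy _; rewrite !hhE -EFin_min -EFinM lte_fin.
      exact: far.
    rewrite affproj_dist// in xy.
    have c : cone L (enorm (pv (coords V x) - pv (coords V y))) (coords V x) (coords V y).
      exact: (cone_planar isoV e21 (ltW L0) e60 xy).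
    exact: cone_le (ltW L0) (ge1 _ _ _ hx hy) c.
  apply: (cone_near isoV L01 (ge0 _ _ _ e0 hx hy)); apply: le_trans near _.
  apply: (@le_trans _ _ (L * Num.min (hh x) (hh y))).
    by apply: ler_wpM2r => //; rewrite le_min hx hy.
  apply: (ler_wpM2l (ltW L0)); apply: (@le_trans _ _ (hh x)).
    by rewrite ge_min lexx.
  exact: ge2.
have XV p : X p -> pv p \in V /\ forall z, z \in V -> dotv (pw p) z = 0.
  move=> [x _ <-]; split; first exact: coords_in.
  by move=> z; exact: coords_perp.
have [f [fv fw flip fX]] := ext V X (fun p => hh (of_coords p)) L isoV X0
  (fun p _ => hh0 _) XV L01 Xcone.
rewrite KL in flip fX.
pose phi (v : heis R n) := Heis (pw (f (hz v))) (pt (f (hz v))).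
have graphE v : hsubgroup V v -> graph_map phi v = of_coords (f (hz v)).
  case: v => z t [/= zV ->]; rewrite /graph_map /phi /of_coords /= fv.
  by congr Heis; rewrite /= add0r.
have fK v : v \in V -> coords V (of_coords (f v)) = f v.
  by move=> vV; apply: of_coordsK; rewrite ?fv// => z; exact: fw.
have ilb : ilip_bound V phi eta.
  split => // v v' Vv Vv'; rewrite !graphE//; case: Vv => vV _; case: Vv' => v'V _.
  rewrite knorm_hproj !fK// !fv.
  apply: vproj_le_small (lam) _ _ lam01 _ _ => //; first exact: ltW.
    apply: le_trans laml _; rewrite exprMn.
    by clear -Dy; have := sqr_ge0 eta; lra.
  by rewrite !fK//; exact: flip.
exists (graph_map phi @` hsubgroup V).
  exists V, phi; split => //.
  - by move=> v [vV _] z zV /=; exact: fw.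
  - by exists eta.
  - apply: ge_inf => //; exists 0 => L' [/ltW].
    by [].
move=> Q x SQ Ex xQ.
have Xx := Xs_near _ _ SQ Ex xQ.
have cQ := Scubes _ SQ; have dQ := cube_diamE cQ.
have hxQ : hh x <= 2 * rdiam Q.
  rewrite -lee_fin -hhE; apply: le_trans (tree_height_le x SQ) _.
  apply: le_trans (leeD2r _ xQ) _.
  by rewrite dQ -EFinD lee_fin mulr2n mulrDl mul1r.
have vV : pv (coords V x) \in V by exact: coords_in.
pose y := of_coords (f (pv (coords V x))).
have Gy : (graph_map phi @` hsubgroup V) y.
  exists (Heis (pv (coords V x)) 0); first by split.
  by rewrite graphE.
apply: le_trans (dist_set_le x Gy) _; rewrite dQ -EFinM lee_fin.
have c : cone lam (hh x) (coords V y) (coords V x).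
  have := fX (coords V x) (imageP _ Xx); rewrite coordsK => c.
  by rewrite /y fK.
have := dist_same_foot isoV e20 lam01 laml _ c.
rewrite /y fK// fv => /(_ erefl) h; apply: le_trans h _.
rewrite [leRHS](_ : _ = eta / 2 * (2 * rdiam Q)) ?ler_wpM2l//.
by rewrite mulrA divfK ?pnatr_eq0.
Qed.

End PlanesToGraphs.

(** * Packing in the Heisenberg group *)

Section HeisPacking.
Context {R : realType} {n : nat}.

Lemma dotv_row_mx (m1 m2 : nat) (u u' : 'rV[R]_m1) (v v' : 'rV[R]_m2) :
  dotv (row_mx u v) (row_mx u' v') = dotv u u' + dotv v v'.
Proof.
by rewrite /dotv big_split_ord /=; congr (_ + _); apply: eq_bigr => i _;
  rewrite ?row_mxEl ?row_mxEr.
Qed.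

(** Rescaled anisotropically by 1 / r and 1 / r ^ 2, r-separated points of a
    ball of radius a r become separated in a Euclidean ball. *)
Lemma heis_packing (a : R) : 0 <= a -> exists N : nat,
  forall (s : seq (heis R n)) (y : heis R n) (r : R), 0 < r -> uniq s ->
    {in s, forall x, mdist x y <= a * r} ->
    {in s &, forall x x', x != x' -> r <= mdist x x'} -> (size s <= N)%N.
Proof.
move=> a0; pose c : R := (8 * (1 + a))^-1.
have c8 : c * (1 + a) = 8^-1.
  by rewrite /c; field; rewrite gt_eqF//; lra.
have c0 : 0 < c by rewrite invr_gt0; lra.
have c1 : c <= 8^-1 by rewrite -c8 ler_peMr//; [exact: ltW|lra].
clearbody c.
have [N packN] := euclidean_packing (n + n + 1) ((a + a ^+ 2) / c).
exists N => s y r r0 us sy ss.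
pose g x : heis R n := (y^-1 * x)%g.
pose F x : 'rV[R]_(n + n + 1) :=
  row_mx (r^-1 *: hz (g x)) (const_mx (ht (g x) / r ^+ 2)).
have dot1 (u v : R) : dotv (const_mx u : 'rV_1) (const_mx v) = u * v.
  by rewrite /dotv big_ord1 !mxE.
have FB x x' : dotv (F x - F x') (F x - F x') =
    (enorm (hz (g x) - hz (g x')) / r) ^+ 2
    + ((ht (g x) - ht (g x')) / r ^+ 2) ^+ 2.
  rewrite /F opp_row_mx add_row_mx dotv_row_mx -scalerBr dotvZl dotvZr.
  rewrite expr_div_n enorm2; congr (_ + _).
    by rewrite mulrA -expr2 exprVn mulrC.
  rewrite (_ : _ - _ = const_mx ((ht (g x) - ht (g x')) / r ^+ 2)) ?dot1 ?expr2//.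
  by apply/rowP => i; rewrite !mxE mulrBl.
have sep x x' : x \in s -> x' \in s -> x != x' -> c <= enorm (F x - F x').
  move=> xs xs' xx'; have := ss _ _ xs xs' xx'; rewrite leNgt => far.
  rewrite leNgt; apply: contra far => near.
  have gx' : knorm (g x') <= a * r by have := sy _ xs'.
  have {near} : dotv (F x - F x') (F x - F x') < c ^+ 2.
    by rewrite -enorm2 ltr_pXn2r// nnegrE ?enorm_ge0// ltW.
  rewrite FB; set d := enorm _; set t := ht _ - ht _ => near.
  have d0 : 0 <= d := enorm_ge0 _.
  have dc : d <= c * r.
    rewrite -ler_pdivrMr// -(ler_pXn2r (ltn0Sn 1)) ?nnegrE ?divr_ge0// ?(ltW c0)// ?(ltW r0)//.
    by have := sqr_ge0 (t / r ^+ 2); lra.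
  have tc : `|t| <= c * r ^+ 2.
    have r20 : 0 < r ^+ 2 by rewrite exprn_gt0.
    rewrite -ler_pdivrMr// -(gtr0_norm r20) -normf_div.
    rewrite -(ler_pXn2r (ltn0Sn 1)) ?nnegrE// ?(ltW c0)//.
    rewrite real_normK ?num_real//.
    by have := sqr_ge0 (d / r); lra.
  rewrite -[mdist x x']/(knorm (x'^-1 * x)%g).
  have -> : (x'^-1 * x)%g = ((g x')^-1 * g x)%g.
    by rewrite /g invgM invgK -mulgA mulVKg.
  rewrite -(ltr_pXn2r (ltn0Sn 3)) ?nnegrE ?knorm_ge0 ?(ltW r0)//.
  rewrite knorm4 hz_diff -enorm2 -/d.
  have htE : ht ((g x')^-1 * g x)%g = t - omega (hz (g x')) (hz (g x) - hz (g x')).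
    rewrite /t omegaDr omegaNr omegaxx oppr0 addr0.
    by move: (g x) (g x') => [z u] [z' u'] /=; rewrite omegaNl (addrC (- u')).
  have om : `|omega (hz (g x')) (hz (g x) - hz (g x'))| <= 2^-1 * (a * c * r ^+ 2).
    apply: le_trans (omega_le _ _) _; rewrite -/d.
    have : enorm (hz (g x')) * d <= (a * r) * (c * r).
      by rewrite ler_pM ?enorm_ge0// (le_trans (enorm_hz_le _)).
    by rewrite (_ : a * r * (c * r) = a * c * r ^+ 2); [lra|ring].
  have h1 : `|ht ((g x')^-1 * g x)%g| <= 8^-1 * r ^+ 2.
    rewrite htE -c8; apply: le_trans (ler_normB _ _) _.
    have : 0 <= a * c * r ^+ 2 by rewrite mulr_ge0 ?sqr_ge0// mulr_ge0// ltW.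
    by lra.
  move: (ht _) h1 => T h1.
  have h2 : T ^+ 2 <= 64^-1 * r ^+ 4.
    rewrite -real_normK ?num_real//.
    rewrite [leRHS](_ : _ = (8^-1 * r ^+ 2) ^+ 2); last by field.
    by rewrite ler_pXn2r// nnegrE// mulr_ge0 ?sqr_ge0.
  have h3 : d ^+ 2 <= 64^-1 * r ^+ 2.
    rewrite [leRHS](_ : _ = (8^-1 * r) ^+ 2); last by field.
    rewrite ler_pXn2r// ?nnegrE ?mulr_ge0 ?(ltW r0)// (le_trans dc)// ler_wpM2r//.
    exact: ltW.
  have h4 : (d ^+ 2) ^+ 2 <= 4096^-1 * r ^+ 4.
    rewrite [leRHS](_ : _ = (64^-1 * r ^+ 2) ^+ 2); last by field.
    by rewrite ler_pXn2r// nnegrE ?sqr_ge0// mulr_ge0 ?sqr_ge0.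
  have r40 : 0 < r ^+ 4 by rewrite exprn_gt0.
  by clear -h2 h4 r40; lra.
have Finj : {in s &, injective F}.
  move=> x x' xs xs' xx'; apply/eqP; apply: contraT => ne.
  by have := sep _ _ xs xs' ne; rewrite xx' subrr enorm0 leNgt c0.
rewrite -(size_map F); apply: (packN _ 0 c) => //.
- by rewrite map_inj_in_uniq.
- move=> _ /mapP[x xs ->]; rewrite subr0 divfK ?gt_eqF//.
  have gx : knorm (g x) <= a * r by have := sy _ xs.
  apply: enorm_le; first by rewrite addr_ge0// sqr_ge0.
  rewrite /F dotv_row_mx dotvZl dotvZr dot1 -enorm2.
  have z1 : enorm (hz (g x)) / r <= a.
    by rewrite ler_pdivrMr// (le_trans (enorm_hz_le _)).
  have t1 : `|ht (g x)| / r ^+ 2 <= a ^+ 2.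
    rewrite ler_pdivrMr ?exprn_gt0// -exprMn.
    have : knorm (g x) ^+ 2 <= (a * r) ^+ 2.
      by rewrite ler_pXn2r// nnegrE ?knorm_ge0// mulr_ge0// ltW.
    by have := ht_le (g x); have := normr_ge0 (ht (g x)); lra.
  have z2 : (enorm (hz (g x)) / r) ^+ 2 <= a ^+ 2.
    by rewrite ler_pXn2r// nnegrE ?divr_ge0 ?enorm_ge0// ltW.
  have t2 : (ht (g x) / r ^+ 2) ^+ 2 <= (a ^+ 2) ^+ 2.
    rewrite -real_normK ?num_real// normf_div (ger0_norm (sqr_ge0 r)).
    by rewrite ler_pXn2r// nnegrE ?divr_ge0 ?sqr_ge0.
  rewrite -expr2 [X in X + _](_ : _ = (enorm (hz (g x)) / r) ^+ 2); last first.
    by rewrite expr_div_n mulrA -expr2 exprVn mulrC.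
  have : 0 <= a * a ^+ 2 by rewrite mulr_ge0 ?sqr_ge0.
  by rewrite sqrrD; lra.
- move=> _ _ /mapP[x xs ->] /mapP[x' xs' ->] ne; apply: sep => //.
  by apply: contra_neq ne => ->.
Qed.

End HeisPacking.

(** * Cubes of a given scale *)

Section Scales.
Context {R : realType}.
Variable rho : R.
Hypothesis rho01 : 0 < rho < 1.

Let rho0 : 0 < rho. Proof. by case/andP: rho01. Qed.
Let rho1 : rho < 1. Proof. by case/andP: rho01. Qed.

Lemma exprz_anti (i j : int) : i <= j -> rho ^ j <= rho ^ i.
Proof.
move=> ij; have e l : rho ^ l = rho^-1 ^ (- l) by rewrite exprz_inv opprK.
rewrite (e i) (e j).
by apply: ler_weXz2l; [rewrite invf_ge1 ?(ltW rho1)|rewrite lerN2].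
Qed.

Lemma expr_small (r : R) : 0 < r -> exists m : nat, rho ^ m%:Z < r.
Proof.
move=> r0; have rho_norm : `|rho| < 1 by rewrite gtr0_norm.
have /cvgrPdist_lt /(_ _ r0) [m _ /(_ m (leqnn m))] := cvg_expr rho_norm.
rewrite /= sub0r normrN ger0_norm; last by rewrite exprn_ge0// ltW.
by move=> h; exists m.
Qed.

Lemma exprz_succ (i : int) : rho ^ (i + 1) = rho * rho ^ i.
Proof. by rewrite expfzDr ?gt_eqF// expr1z mulrC. Qed.

Lemma scale_exists (r : R) : 0 < r -> exists i : int, rho ^ (i + 1) < r <= rho ^ i.
Proof.
move=> r0; have ir0 : 0 < r^-1 by rewrite invr_gt0.
have [m' hm'] := expr_small ir0; have [m hm] := expr_small r0.
pose P (j : nat) := rho ^ (j%:Z - m'%:Z) < r.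
have exP : exists j, P j.
  exists (m + m')%N; rewrite /P (_ : _ - _ = m%:Z)//.
  by rewrite PoszD addrK.
have [[|j] Pj jmin] := ex_minnP exP.
  move: Pj; rewrite /P sub0r -exprz_inv ltNge => /negP; case.
  rewrite exprz_inv -invr_expz -[leLHS]invrK lef_pV2 ?posrE ?invr_gt0 ?exprz_gt0//.
  exact: ltW.
exists (j%:Z - m'%:Z); apply/andP; split.
  by rewrite (_ : _ + 1 = j.+1%:Z - m'%:Z)// -addn1 PoszD addrAC.
by rewrite leNgt; apply/negP => /jmin; rewrite ltnn.
Qed.

End Scales.

Section CubeScales.
Context {R : realType} {M : metricType R} {k : nat} {E : set M}.
Variable Dy : dyadic_system k E.
Implicit Types (Q T P : set M).
Local Notation rho := (ds_rho Dy).
Local Notation D := (ds_D Dy).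

Let rho0 : 0 < rho. Proof. exact: rho_gt0. Qed.
Let D0 : 0 < D. Proof. exact: D_gt0. Qed.

(** The ratio within which the diameters of cubes realise any given scale. *)
Definition scale_ratio : R := D ^+ 2 / rho.

Lemma scale_ratio_ge1 : 1 <= scale_ratio.
Proof.
rewrite ler_pdivlMr// mul1r (le_trans (ltW (rho_lt1 Dy)))//.
by rewrite exprn_ege1// ltW// ds_D1.
Qed.

(** The generation whose scale is just above D r does it, unless its index lies
    below the range of a bounded set E; then r is comparable with the diameter of
    E. *)
Lemma cube_at_scale x (r : R) : E x -> 0 < r ->
  (exists P, [/\ cubes Dy P, P x & r <= rdiam P <= scale_ratio * r]) \/
  (diam E <= (scale_ratio * r)%:E)%E.
Proof.
move=> Ex r0; have Dr : 0 < D * r by rewrite mulr_gt0.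
have [i /andP[i1 i2]] := scale_exists (ds_rho01 Dy) Dr.
have up : D * rho ^ i <= scale_ratio * r.
  move: i1; rewrite exprz_succ ?ds_rho01// => i1.
  rewrite /scale_ratio [leRHS](_ : _ = D * (D * r / rho)); last first.
    by field; rewrite gt_eqF.
  by rewrite ler_wpM2l ?(ltW D0)// ler_pdivlMr// mulrC ltW.
have [iJ|niJ] := pselect (ds_index Dy i).
  left; have [P Pi Px] : (\bigcup_(Q in ds_gen Dy i) Q) x by rewrite -(ds_cover iJ).
  have cP : cubes Dy P by exists i.
  exists P; split => //; have /andP[h1 h2] := cube_diam_bounds iJ Pi.
  rewrite (le_trans h2 up) andbT (le_trans _ h1)//.
  by rewrite ler_pdivlMl.
right; have Efin : diam E <> +oo%E.
  by move=> /(@ds_index_unbounded _ _ _ _ Dy) iT; apply: niJ; rewrite iT.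
have [J0 [JE _ EJ0]] := ds_index_bounded Dy Efin.
have iJ0 : i + 1 <= J0.
  by move: niJ; rewrite JE /= => /negP; rewrite -ltNge => ?; lia.
apply: (le_trans (ltW EJ0)); rewrite lee_fin.
apply: le_trans (exprz_anti (ds_rho01 Dy) iJ0) _.
apply: le_trans (ltW i1) _; rewrite ler_wpM2r ?(ltW r0)//.
rewrite /scale_ratio ler_pdivlMr// expr2.
rewrite ler_wpM2l ?(ltW D0)// (le_trans (ltW (rho_lt1 Dy)))// ltW//.
exact: ds_D1.
Qed.

Section Tree.
Variable S : set (set M).
Hypothesis Scubes : S `<=` cubes Dy.
Hypothesis Scoh : coherent Dy S.

Lemma tree_convex Q P : S Q -> cubes Dy P -> Q `<=` P -> P `<=` top S -> S P.
Proof. by case: Scoh => _ conv _; exact: conv. Qed.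

(** Going up in a tree from a cube to the top, every intermediate diameter is
    met up to a bounded factor. The argument compares diameters only, since a
    cube may belong to several generations. *)
Lemma intermediate_cube Q (r : R) : S Q -> 0 < r -> rdiam Q <= r ->
  r <= rdiam (top S) ->
  exists P, [/\ S P, Q `<=` P & r <= rdiam P <= scale_ratio * r].
Proof.
move=> SQ r0 Qr rt; have St := top_in Scoh.
have cQ := Scubes SQ; have ct := Scubes St.
have rC : r <= scale_ratio * r by rewrite ler_peMl ?scale_ratio_ge1// ltW.
have [x Qx] := cube_nonempty cQ.
have tx : top S x := sub_top Scoh SQ Qx.
have [[P [cP Px /andP[rP Pr]]]|Er] := cube_at_scale (cube_sub cQ Qx) r0; last first.
  exists (top S); split => //; first exact: (sub_top Scoh SQ).
  rewrite rt -lee_fin -(cube_diamE ct) (le_trans _ Er)// diamS//.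
  exact: (cube_sub ct).
have [QP|PQ] : Q `<=` P \/ P `<=` Q by apply: (cube_nested cQ cP); exists x.
  have [Pt|tP] : P `<=` top S \/ top S `<=` P by apply: (cube_nested cP ct); exists x.
    by exists P; rewrite rP; split => //; exact: (tree_convex SQ).
  exists (top S); rewrite rt; split => //; first exact: (sub_top Scoh SQ).
  exact: le_trans (rdiamS ct cP tP) Pr.
exists Q; split => //; rewrite (le_trans rP (rdiamS cP cQ PQ))/=.
exact: le_trans Qr rC.
Qed.

End Tree.

End CubeScales.

(** Reindexing a window of generations by natural numbers, so that a sum over it
    is a sum over ordinals. *)
Lemma window_index (m : nat) (x i : int) : i - m%:Z <= x <= i + m%:Z ->
  (absz (x - (i - m%:Z))%R < (2 * m).+1)%N /\
  x = (absz (x - (i - m%:Z))%R)%:Z + (i - m%:Z).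
Proof. by move=> /andP[h1 h2]; split; lia. Qed.

Section CubeCount.
Context {R : realType} {n k : nat} {E : set (heis R n)}.
Variable Dy : dyadic_system k E.
Local Notation cube := (set (heis R n)).
Local Notation rho := (ds_rho Dy).
Local Notation D := (ds_D Dy).

Let rho0 : 0 < rho. Proof. exact: rho_gt0. Qed.
Let D0 : 0 < D. Proof. exact: D_gt0. Qed.

(** A cube contains boundedly many cubes of comparable diameter: these belong to
    boundedly many generations, and within a generation their centres are
    separated. *)
Lemma cube_count (d : R) : 0 < d -> exists N : nat,
  forall (T : cube) (s : seq cube), cubes Dy T -> uniq s ->
    {in s, forall Q, [/\ cubes Dy Q, Q `<=` T & d * rdiam T <= rdiam Q]} ->
    (size s <= N)%N.
Proof.
move=> d0; have dD : 0 <= d^-1 * D ^+ 2 by rewrite mulr_ge0 ?invr_ge0 ?sqr_ge0// ltW.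
have [N packN] := @heis_packing R n _ dD.
have c0 : 0 < Num.min d 1 / D ^+ 2 by rewrite divr_gt0 ?exprn_gt0// lt_min d0 ltr01.
have [m hm] := expr_small (ds_rho01 Dy) c0.
exists ((2 * m).+1 * N)%N => T s cT us sT.
have [i iJ Ti] := cT; have /andP[Ti1 Ti2] := cube_diam_bounds iJ Ti.
have /choice[g gP] : forall Q : cube, exists j, cubes Dy Q -> ds_index Dy j /\ ds_gen Dy j Q.
  by move=> Q; have [[j ? ?]|?] := pselect (cubes Dy Q); [exists j|exists 0].
have grange Q : Q \in s -> i - m%:Z <= g Q <= i + m%:Z.
  move=> /sT[cQ QT dQ]; have [jJ Qj] := gP _ cQ.
  have /andP[Qj1 Qj2] := cube_diam_bounds jJ Qj.
  have hD : rho ^ m%:Z * D ^+ 2 < Num.min d 1 by rewrite -ltr_pdivlMr// exprn_gt0.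
  have rr (a b : int) : rho ^ (a + b) = rho ^ a * rho ^ b by rewrite expfzDr// gt_eqF.
  have D20 : 0 < D ^+ 2 by rewrite exprn_gt0.
  apply/andP; split; rewrite leNgt; apply/negP => out.
  - (* a generation much coarser than that of T: the diameter is too large *)
    have h1 : g Q + m%:Z <= i by rewrite -lerBrDr ltW.
    have := exprz_anti (ds_rho01 Dy) h1; rewrite rr => h2.
    have QTd := rdiamS cQ cT QT.
    have h3 : rho ^ g Q <= D ^+ 2 * rho ^ i.
      have : D^-1 * rho ^ g Q <= D * rho ^ i by lra.
      by rewrite ler_pdivrMl// mulrA -expr2.
    have g0 : 0 < rho ^ g Q by rewrite exprz_gt0.
    have h4 : rho ^ g Q <= (rho ^ m%:Z * D ^+ 2) * rho ^ g Q.
      apply: le_trans h3 _.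
      rewrite [leRHS](_ : _ = D ^+ 2 * (rho ^ g Q * rho ^ m%:Z)); last by ring.
      by rewrite ler_pM2l.
    rewrite -[leLHS]mul1r ler_pM2r// in h4; have := le_lt_trans h4 hD.
    by rewrite lt_min ltxx andbF.
  - have h1 : i + m%:Z <= g Q := ltW out.
    have := exprz_anti (ds_rho01 Dy) h1; rewrite rr => h2.
    have i0 : 0 < rho ^ i by rewrite exprz_gt0.
    have h3 : d * rho ^ i <= D ^+ 2 * rho ^ g Q.
      have : d * (D^-1 * rho ^ i) <= D * rho ^ g Q.
        by rewrite (le_trans _ Qj2)// (le_trans _ dQ)// ler_wpM2l// ltW.
      by rewrite mulrCA ler_pdivrMl// mulrA -expr2.
    have h4 : d * rho ^ i <= (rho ^ m%:Z * D ^+ 2) * rho ^ i.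
      apply: le_trans h3 _.
      rewrite [leRHS](_ : _ = D ^+ 2 * (rho ^ i * rho ^ m%:Z)); last by ring.
      by rewrite ler_pM2l.
    rewrite ler_pM2r// in h4; have := le_lt_trans h4 hD.
    by rewrite lt_min ltxx.
pose f (Q : cube) : 'I_(2 * m).+1 := inord (absz (g Q - (i - m%:Z))%R).
rewrite -sum1_size (partition_big f predT)//=.
apply: (@leq_trans (\sum_(j < (2 * m).+1) N)); last first.
  by rewrite sum_nat_const card_ord.
apply: leq_sum => j _; rewrite sum1_count -size_filter.
set sj := seq.filter _ s.
have usj : uniq sj by exact: filter_uniq.
have sjP Q : Q \in sj -> Q \in s /\ g Q = (j : nat)%:Z + (i - m%:Z).
  rewrite mem_filter => /andP[/eqP fQ Qs]; split => //.
  have [lt gE] := window_index (grange _ Qs).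
  by move: fQ => /(congr1 val); rewrite /f /= inordK// => <-.
set l := (j : nat)%:Z + (i - m%:Z) in sjP.
have [sj0|[Q0 Q0s]] : sj = [::] \/ exists Q, Q \in sj.
  by case: (sj) => [|Q r]; [left|right; exists Q; rewrite inE eqxx].
  by rewrite sj0.
have lP Q : Q \in sj -> ds_index Dy l /\ ds_gen Dy l Q.
  by move=> /sjP[/sT[cQ _ _] <-]; exact: gP.
have [lJ Q0l] := lP _ Q0s.
have r0 : 0 < D^-1 * rho ^ l by rewrite mulr_gt0 ?invr_gt0// exprz_gt0.
have /choice[c cP] : forall Q : cube, exists x, Q \in sj ->
    E x /\ cball x (D^-1 * rho ^ l) `&` E `<=` Q.
  move=> Q; have [Qs|] := boolP (Q \in sj); last by exists (hone : heis R n).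
  have [_ Ql] := lP _ Qs.
  by have [x Ex xQ] := ds_center lJ Ql; exists x.
have cin Q : Q \in sj -> Q (c Q).
  move=> /cP[Ec]; apply; split => //.
  by rewrite /cball /= mdistxx ltW.
have sep Q Q' : Q \in sj -> Q' \in sj -> Q != Q' ->
    D^-1 * rho ^ l <= mdist (c Q) (c Q').
  move=> Qs Q's QQ'; rewrite leNgt; apply: contra QQ' => near.
  have [_ Ql] := lP _ Qs; have [_ Q'l] := lP _ Q's.
  apply/eqP/(ds_disjoint lJ) => //; exists (c Q'); split; last exact: cin.
  have [_ sub] := cP _ Qs; apply: sub; split; first exact: ltW.
  by have [] := cP _ Q's.
have cinj : {in sj &, injective c}.
  move=> Q Q' Qs Q's cc; apply/eqP; apply: contraT => ne.
  by have := sep _ _ Qs Q's ne; rewrite cc mdistxx leNgt r0.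
rewrite -(size_map c); have [y Ty] := cube_nonempty cT.
apply: (packN _ y _ r0).
- by rewrite map_inj_in_uniq.
- move=> _ /mapP[Q Qs ->]; have [Qss _] := sjP _ Qs; have [cQ QT dQ] := sT _ Qss.
  have cQT : T (c Q) by apply: QT; exact: cin.
  have := mdist_le_diam cQT Ty; rewrite (cube_diamE cT) lee_fin => h.
  apply: (le_trans h); have [_ Ql] := lP _ Qs.
  have /andP[_ Qu] := cube_diam_bounds lJ Ql.
  rewrite [leRHS](_ : _ = d^-1 * (D * rho ^ l)); last first.
    by field; rewrite !gt_eqF.
  by rewrite ler_pdivlMl// (le_trans dQ).
- move=> _ _ /mapP[Q Qs ->] /mapP[Q' Q's ->] ne; apply: sep => //.
  by apply: contra_neq ne => ->.
Qed.

End CubeCount.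

(** * Sums over families of sets *)

Section SumsOverSets.
Context {R : realType}.

Lemma esum_disjoint_bigcup (I T : choiceType) (K : set I) (J : I -> set T)
    (a : T -> \bar R) : trivIset K J -> (forall x, (0 <= a x)%E) ->
  (\esum_(x in \bigcup_(i in K) J i) a x = \esum_(i in K) \esum_(x in J i) a x)%E.
Proof.
move=> tJ a0; rewrite esum_esum//; apply: reindex_esum => //; split.
- by move=> [/= i j] [Ki Jij]; exists i.
- move=> [/= i1 j1] [/= i2 j2]; rewrite ?inE/=.
  move=> [K1 J1] [K2 J2] j12; congr (_, _) => //.
  by apply: tJ => //; exists j1; split=> //; rewrite j12.
- by move=> j [i Ki Jij]/=; exists (i, j).
Qed.

Lemma esum_subset (T : choiceType) (I J : set T) (a : T -> \bar R) :
  (forall x, (0 <= a x)%E) -> I `<=` J ->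
  (\esum_(x in I) a x <= \esum_(x in J) a x)%E.
Proof.
move=> a0 IJ; rewrite (esumID I J)// (_ : J `&` I = I).
  by rewrite leeDl// esum_ge0.
by apply/seteqP; split => [x []//|x Ix]; split => //; exact: IJ.
Qed.

Lemma esum_setU_le (T : choiceType) (I J : set T) (a : T -> \bar R) :
  (forall x, (0 <= a x)%E) ->
  (\esum_(x in I `|` J) a x <= \esum_(x in I) a x + \esum_(x in J) a x)%E.
Proof.
move=> a0; rewrite (esumID I (I `|` J))//; apply: leeD; apply: esum_subset => //.
by move=> x [[Ix|//]] nIx; case: nIx.
Qed.

Lemma esum_bounded_card (T : choiceType) (I : set T) (a : T -> \bar R) (N : nat)
    (b : \bar R) : (0 <= b)%E -> (forall x, I x -> (a x <= b)%E) ->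
  (forall s : seq T, uniq s -> {in s, forall x, I x} -> (size s <= N)%N) ->
  (\esum_(x in I) a x <= \sum_(i < N) b)%E.
Proof.
move=> b0 ab IN; apply: ge_ereal_sup => _ [X [finX XI] <-].
rewrite fsbig_finite//=; set sX := finmap.enum_fset _.
have sXP x : x \in sX -> I x by move=> xX; apply: XI; rewrite -(fset_setK finX).
have sN : (size sX <= N)%N.
  by apply: IN => //; exact: finmap.fset_uniq.
apply: (@le_trans _ _ (\sum_(x <- sX) b)%E).
  by rewrite !big_seq; apply: lee_sum => x /sXP /ab.
rewrite [leRHS]big_const_ord [leLHS]big_const_seq count_predT -(subnK sN) iterD.
elim: (N - _)%N => [|q ih] //=.
by apply: le_trans ih _; rewrite leeDr.
Qed.

End SumsOverSets.

Lemma hausdorffS (R : realType) (M : metricType R) (k : nat) (A B : set M) :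
  A `<=` B -> (hausdorff k A <= hausdorff k B)%E.
Proof.
move=> AB; apply: ge_ereal_sup => _ [d d0 <-].
apply: le_ereal_sup_tmp; exists (hausdorff_pre k d B); first by exists d.
apply: ereal_inf_le_tmp; apply: image_subset => U [BU Ud]; split => //.
exact: subset_trans BU.
Qed.

Lemma hausdorff_ge0 (R : realType) (M : metricType R) (k : nat) (A : set M) :
  (0 <= hausdorff k A)%E.
Proof.
apply: le_ereal_sup_tmp; exists (hausdorff_pre k 1 A); first by exists 1 => //=.
apply: le_ereal_inf_tmp => _ [U _ <-]; apply: nneseries_ge0 => i _ _.
by rewrite expe_ge0// diam_ge0.
Qed.

(** * Pruning the trees of a coronization *)

Section Pruning.
Context {R : realType} {n k : nat} {E : set (heis R n)}.
Variable Dy : dyadic_system k E.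
Local Notation cube := (set (heis R n)).
Variables (C : R) (G B : set cube) (F : set (set cube)) (d : R).
Hypothesis C0 : 0 < C.
Hypothesis cor : coronization Dy C G B F.
Hypothesis d01 : 0 < d <= 1.
Implicit Types (S : set cube) (Q T P M : cube).

Let d0 : 0 < d. Proof. by case/andP: d01. Qed.
Let Fcoh S : F S -> coherent Dy S. Proof. by case: cor => _ _ _ h _; exact: h. Qed.
Let GF : G = \bigcup_(S in F) S. Proof. by case: cor => _ _ []. Qed.
Let Ftriv : trivIset F id. Proof. by case: cor => _ _ []. Qed.
Let Fcubes S : F S -> S `<=` cubes Dy.
Proof. by move=> FS T ST; case: cor => -[-> _] _ _ _ _; left; rewrite GF; exists S. Qed.
Let Ftop S : F S -> cubes Dy (top S).
Proof. by move=> FS; apply: (Fcubes FS); exact: top_in (Fcoh FS). Qed.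
Let Funique S S' T : F S -> F S' -> S T -> S' T -> S = S'.
Proof. by move=> FS FS' ST S'T; apply: Ftriv => //; exists T. Qed.
Let H0 T : (0 <= hausdorff k T)%E. Proof. exact: hausdorff_ge0. Qed.

(** If the top of a tree lies in T, the selected cubes of that tree are counted
    against the top, by [cube_count]. If it does not and some selected cube lies in
    T, then T is itself a cube of the tree, by convexity; there is only one such
    tree, and its selected cubes in T are counted against T. *)
Lemma carleson_selection (d' : R) (W : set cube -> set cube) : 0 < d' ->
  (forall S, F S -> W S `<=` S) ->
  (forall S Q, F S -> W S Q -> d' * rdiam (top S) <= rdiam Q) ->
  exists2 C' : R, 0 < C' & forall T, cubes Dy T ->
    (\esum_(Q in [set Q | (exists2 S, F S & W S Q) /\ Q `<=` T]) hausdorff k Q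
      <= C'%:E * hausdorff k T)%E.
Proof.
move=> d'0 WS Wd; have [N count] := cube_count Dy d'0.
exists (\sum_(i < N) (C + 1) + 1).
  by apply: ltr_wpDl => //; apply: sumr_ge0 => i _; rewrite addr_ge0// ltW.
move=> T cT.
pose J S := W S `&` [set Q | Q `<=` T].
have -> : [set Q | (exists2 S, F S & W S Q) /\ Q `<=` T] = \bigcup_(S in F) J S.
  apply/seteqP; split => Q.
    by move=> [[S FS WQ] QT]; exists S.
  by move=> [S FS [WQ QT]]; split => //; exists S.
rewrite esum_disjoint_bigcup//; last first.
  move=> S S' FS FS' [Q [[WQ _] [WQ' _]]].
  by apply: (Funique FS FS') (WS _ FS _ WQ) (WS _ FS' _ WQ').
pose b1 S := if S \in [set S | top S `<=` T] then hausdorff k (top S) else 0%E.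
pose b2 S := if S \in [set S | S T] then hausdorff k T else 0%E.
have b10 S : (0 <= b1 S)%E by rewrite /b1; case: ifP.
have b20 S : (0 <= b2 S)%E by rewrite /b2; case: ifP.
have inner S : F S -> (\esum_(Q in J S) hausdorff k Q <= \sum_(i < N) (b1 S + b2 S))%E.
  move=> FS; have [tT|ntT] := pselect (top S `<=` T).
    apply: esum_bounded_card; first by rewrite adde_ge0.
      move=> Q [WQ QT]; apply: (@le_trans _ _ (b1 S)); last by rewrite leeDl.
      rewrite /b1 ifT ?inE//; apply: hausdorffS.
      by apply: (sub_top (Fcoh FS)); exact: WS WQ.
    move=> s us sJ; apply: (count (top S) s (Ftop FS) us) => Q /sJ [WQ QT].
    split; [exact: (Fcubes FS (WS _ FS _ WQ))|exact: (sub_top (Fcoh FS) (WS _ FS _ WQ))|].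
    exact: Wd.
  have up Q : J S Q -> T `<=` top S.
    move=> [WQ QT]; have SQ := WS _ FS _ WQ.
    have [x Qx] := cube_nonempty (Fcubes FS SQ).
    have [|//] : top S `<=` T \/ T `<=` top S.
      apply: (cube_nested (Ftop FS) cT); exists x; split; last exact: QT.
      exact: (sub_top (Fcoh FS) SQ).
    by [].
  have inS Q : J S Q -> S T.
    move=> JQ; have [WQ QT] := JQ.
    exact: (tree_convex (Fcoh FS) (WS _ FS _ WQ) cT QT (up _ JQ)).
  apply: esum_bounded_card; first by rewrite adde_ge0.
    move=> Q JQ; apply: (@le_trans _ _ (b2 S)); last by rewrite leeDr.
    by rewrite /b2 ifT ?inE; [apply: hausdorffS; case: JQ|exact: inS JQ].
  move=> s us sJ; apply: (count T s cT us) => Q /sJ JQ; have [WQ QT] := JQ.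
  have SQ := WS _ FS _ WQ; split => //; first exact: (Fcubes FS).
  apply: le_trans (Wd _ _ FS WQ); rewrite ler_wpM2l ?(ltW d'0)//.
  exact: (rdiamS cT (Ftop FS) (up _ JQ)).
apply: (le_trans (le_esum inner)); rewrite esum_sum; last first.
  by move=> S i _ _; rewrite adde_ge0.
rewrite esumD//.
have B1 : (\esum_(S in F) b1 S <= C%:E * hausdorff k T)%E.
  rewrite -esum_mkcondr; case: cor => _ _ _ _ /(_ T cT); apply: le_trans.
  by apply: esum_subset => // S [].
have B2 : (\esum_(S in F) b2 S <= hausdorff k T)%E.
  rewrite -esum_mkcondr.
  have [[S0 [FS0 S0T]]|none] := pselect (exists S0, F S0 /\ S0 T).
    rewrite (_ : F `&` _ = [set S0]) ?esum_set1//.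
    apply/seteqP; split => [S [FS ST]|S ->] //=.
    exact: (Funique FS FS0 ST S0T).
  by rewrite esum1// => S [FS ST]; case: none; exists S.
have C10 : (0 <= (C + 1)%:E)%E by rewrite lee_fin addr_ge0// ltW.
have b12 : (\esum_(S in F) b1 S + \esum_(S in F) b2 S <= (C + 1)%:E * hausdorff k T)%E.
  apply: (le_trans (leeD B1 B2)); rewrite EFinD ge0_muleDl ?mul1e//.
  by rewrite lee_fin (ltW C0).
apply: (le_trans (lee_sum _ (fun _ _ => b12))).
have -> : (\sum_(i < N) ((C + 1)%:E * hausdorff k T) =
    (\sum_(i < N) (C + 1)%:E) * hausdorff k T)%E by rewrite ge0_sume_distrl.
by rewrite sumEFin lee_wpmul2r// lee_fin lerDl.
Qed.

Definition small S : set cube := [set T | S T /\ rdiam T <= d * rdiam (top S)].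

Definition maximal_small S M : Prop :=
  small S M /\ forall P, small S P -> M `<=` P -> P `<=` M.

Definition below S M : set cube := [set T | S T /\ T `<=` M].

Definition pruned : set (set cube) :=
  [set S' | exists S M, [/\ F S, maximal_small S M & S' = below S M]].

Let small_below S M T : F S -> small S M -> S T -> T `<=` M -> small S T.
Proof.
move=> FS [SM Mt] ST TM; split => //; apply: le_trans Mt.
by apply: (rdiamS _ _ TM); exact: (Fcubes FS).
Qed.

(** The chain of small cubes above T is finite, by [cube_count]. *)
Lemma maximal_small_exists S T : F S -> small S T ->
  exists2 M, maximal_small S M & T `<=` M.
Proof.
move=> FS sT; apply: contrapT => none.
have cT : cubes Dy T by case: sT => /(Fcubes FS).
pose c := rdiam T / rdiam (top S).
have t0 := cube_rdiam_gt0 (Ftop FS).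
have c0 : 0 < c by rewrite divr_gt0// (cube_rdiam_gt0 cT).
have [N count] := cube_count Dy c0.
have chain m : exists s : seq cube, [/\ size s = m, uniq s,
    {in s, forall Q, small S Q /\ T `<=` Q} &
    exists P, [/\ small S P, T `<=` P & {in s, forall Q, Q `<=` P /\ ~ P `<=` Q}]].
  elim: m => [|m [s [ss us sS [P [sP TP Ps]]]]].
    by exists [::]; split => //; exists T; split.
  have [P' [sP' PP' nP']] : exists P', [/\ small S P', P `<=` P' & ~ P' `<=` P].
    apply: contrapT => nP; apply: none; exists P => //; split => // P' sP' PP'.
    by apply: contrapT => nP'; apply: nP; exists P'.
  exists (P :: s); split.
  - by rewrite /= ss.
  - by rewrite /= us andbT; apply/negP => /Ps[].
  - by move=> Q; rewrite inE => /predU1P[->|/sS].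
  - exists P'; split => //; first exact: subset_trans PP'.
    move=> Q; rewrite inE => /predU1P[->//|/Ps[QP nPQ]]; split.
      exact: subset_trans PP'.
    by move=> P'Q; apply: nPQ; exact: subset_trans P'Q.
have [s [ss us sS _]] := chain N.+1.
have : (size s <= N)%N.
  apply: (count (top S) s (Ftop FS) us) => Q /sS[[SQ _] TQ].
  have cQ := Fcubes FS SQ; split => //; first exact: (sub_top (Fcoh FS) SQ).
  by rewrite /c divfK ?gt_eqF//; exact: (rdiamS cT cQ TQ).
by rewrite ss ltnn.
Qed.

Let ratio := scale_ratio Dy.

(** A cube containing M of about twice its diameter is not small, or reaches
    beyond the top; either way M is not much smaller than the top. *)
Lemma maximal_small_diam S M : F S -> maximal_small S M ->
  d / (2 * ratio) * rdiam (top S) <= rdiam M.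
Proof.
move=> FS [sM maxM]; have [SM _] := sM.
have cM := Fcubes FS SM; have ct := Ftop FS.
have M0 := cube_rdiam_gt0 cM; have t0 := cube_rdiam_gt0 ct.
have r0 : 0 < ratio by apply: lt_le_trans (scale_ratio_ge1 Dy).
have r20 : 0 < 2 * ratio by apply: mulr_gt0.
rewrite mulrAC ler_pdivrMr//.
have [x Mx] := cube_nonempty cM.
have Mt := sub_top (Fcoh FS) SM.
have big : rdiam (top S) <= ratio * (2 * rdiam M) ->
    d * rdiam (top S) <= rdiam M * (2 * ratio).
  move=> h; apply: le_trans (_ : rdiam (top S) <= _).
    by rewrite ler_piMl ?(ltW t0)//; case/andP: d01.
  by rewrite (le_trans h)// (_ : ratio * _ = rdiam M * (2 * ratio))//; ring.
have M20 : 0 < 2 * rdiam M by rewrite mulr_gt0.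
have [[P [cP Px /andP[MP PM]]]|Er] := cube_at_scale Dy (cube_sub cM Mx) M20;
    last first.
  apply: big; rewrite -lee_fin -(cube_diamE ct); apply: le_trans Er.
  by apply: diamS; exact: cube_sub ct.
have MsubP : M `<=` P.
  have [//|PsubM] : M `<=` P \/ P `<=` M by apply: (cube_nested cM cP); exists x.
  have := rdiamS cP cM PsubM; rewrite leNgt (lt_le_trans _ MP)//.
  by rewrite ltr_pMl// ltr1n.
have [Pt|tP] : P `<=` top S \/ top S `<=` P.
- by apply: (cube_nested cP ct); exists x; split => //; exact: Mt.
- have SP := tree_convex (Fcoh FS) SM cP MsubP Pt.
  have : ~ small S P.
    move=> sP; have := rdiamS cP cM (maxM _ sP MsubP).
    by rewrite leNgt (lt_le_trans _ MP)// ltr_pMl// ltr1n.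
  move=> nsP; have dP : d * rdiam (top S) <= rdiam P.
    by rewrite leNgt; apply/negP => /ltW h; apply: nsP.
  by rewrite (le_trans dP)// (le_trans PM)// (_ : ratio * _ = rdiam M * (2 * ratio))//; ring.
- by apply: big; exact: le_trans (rdiamS ct cP tP) PM.
Qed.

Let below_top S M : F S -> maximal_small S M -> is_top (below S M) M.
Proof. by move=> FS [[SM _] _]; split; [split|move=> Q []]. Qed.

Lemma pruned_top S M : F S -> maximal_small S M -> top (below S M) = M.
Proof. by move=> FS /(below_top FS)/top_unique. Qed.

Lemma pruned_coherent S' : pruned S' -> coherent Dy S'.
Proof.
move=> [S [M [FS mM ->]]]; have [[SM Mt] maxM] := mM; split.
- by exists M; exact: below_top.
- move=> Q T [SQ QM] cT QT; rewrite pruned_top// => TM; split => //.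
  apply: (tree_convex (Fcoh FS) SQ cT QT).
  exact: subset_trans (sub_top (Fcoh FS) SM).
- move=> j Q [SQ QM] jJ Qj.
  case: (Fcoh FS) => _ _ /(_ j Q SQ jJ Qj)[all|none].
    left=> T Tj; split; first exact: all.
    by case: Tj => _ TQ; exact: subset_trans QM.
  by right=> T /none nT [].
Qed.

Definition pruned_good : set cube := \bigcup_(S in pruned) S.

Definition removed : set cube := [set T | exists2 S, F S & S T /\ ~ small S T].

Let pruned_goodP T : pruned_good T <-> exists2 S, F S & small S T.
Proof.
split=> [[S' [S [M [FS mM ->]]] [ST TM]]|[S FS sT]].
  by exists S => //; case: mM => sM _; exact: small_below FS sM ST TM.
have [M mM TM] := maximal_small_exists FS sT.
by exists (below S M); [exists S, M|split => //; case: sT].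
Qed.

(** The large cubes that are removed, and the maximal small cubes, which are the
    new tops, are all comparable in size with the tops of their trees, so that
    [carleson_selection] applies to both. *)
Lemma pruned_coronization : exists2 C' : R, 0 < C' &
  coronization Dy C' pruned_good (B `|` removed) pruned.
Proof.
have [cG cB _ _ cT] := cor; have [cubesE GB] := cG.
have r0 : 0 < ratio by apply: lt_le_trans (scale_ratio_ge1 Dy).
have [C1 C10 car1] := @carleson_selection d (fun S => S `&` ~` small S) d0
  (fun S _ Q => @proj1 _ _)
  (fun S Q FS '(conj SQ nsQ) => ltac:(
     rewrite leNgt; apply/negP => /ltW h; exact: nsQ (conj SQ h))).
have d'0 : 0 < d / (2 * ratio) by apply: divr_gt0 => //; exact: mulr_gt0.
have [C2 C20 car2] := @carleson_selection (d / (2 * ratio)) maximal_small d'0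
  (fun S _ Q '(conj (conj SQ _) _) => SQ)
  (fun S Q FS mQ => maximal_small_diam FS mQ).
exists (C + C1 + C2); first by rewrite !addr_gt0.
split.
- split.
    apply/seteqP; split => T.
      rewrite cubesE => -[GT|BT]; last by right; left.
      move: GT; rewrite GF => -[S FS ST].
      have [sT|nsT] := pselect (small S T).
        by left; apply/pruned_goodP; exists S.
      by right; right; exists S.
    move=> [/pruned_goodP[S FS [ST _]]|[BT|[S FS [ST _]]]].
    + exact: (Fcubes FS).
    + by rewrite cubesE; right.
    + exact: (Fcubes FS).
  apply/seteqP; split => // T [/pruned_goodP[S FS sT] [BT|[S' FS' [S'T nsT]]]].
    have : (G `&` B) T by split => //; rewrite GF; exists S => //; case: sT.
    by rewrite GB.
  by apply: nsT; have [ST _] := sT; rewrite -(Funique FS FS' ST S'T).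
- move=> T cTT.
  have -> : [set Q | (B `|` removed) Q /\ Q `<=` T] = [set Q | B Q /\ Q `<=` T]
      `|` [set Q | (exists2 S, F S & (S `&` ~` small S) Q) /\ Q `<=` T].
    apply/seteqP; split => Q.
      by move=> [[BQ|[S FS SQ]] QT]; [left|right; split => //; exists S].
    by move=> [[BQ QT]|[[S FS SQ] QT]]; split => //; [left|right; exists S].
  apply: le_trans (esum_setU_le _ _ _) _ => //.
  apply: (le_trans (leeD (cB T cTT) (car1 T cTT))).
  rewrite -ge0_muleDl ?lee_fin ?(ltW C0) ?(ltW C10)// -EFinD lee_wpmul2r// lee_fin.
  by rewrite lerDl ltW.
- split => // S1 S2 [S [M [FS mM ->]]] [S' [M' [FS' mM' ->]]] [T [[ST TM] [S'T TM']]].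
  have SS' := Funique FS FS' ST S'T; subst S'.
  have [[SM sM] maxM] := mM; have [[SM' sM'] maxM'] := mM'.
  have [x Tx] := cube_nonempty (Fcubes FS ST).
  suff -> : M = M' by [].
  have [h|h] : M `<=` M' \/ M' `<=` M.
    apply: (cube_nested (Fcubes FS SM) (Fcubes FS SM')).
    by exists x; split; [exact: TM|exact: TM'].
  + by apply/seteqP; split => //; apply: maxM.
  + by apply/seteqP; split => //; apply: maxM'.
- exact: pruned_coherent.
- move=> T cTT.
  pose A := [set S' | pruned S' /\ top S' `<=` T].
  have injA : set_inj A (@top R (heis R n)).
    move=> S1 S2; rewrite !inE => -[[S [M [FS mM ->]]] _] [[S' [M' [FS' mM' ->]]] _].
    rewrite !pruned_top// => MM'; subst M'.
    have [[SM _] _] := mM; have [[SM' _] _] := mM'.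
    by rewrite (Funique FS FS' SM SM').
  have := esum_image A (@top R (heis R n)) (fun Q => hausdorff k Q) injA.
  rewrite -/A => <-.
  apply: (@le_trans _ _ (C2%:E * hausdorff k T)%E); last first.
    by rewrite lee_wpmul2r// lee_fin lerDr addr_ge0// ltW.
  apply: le_trans (car2 T cTT); apply: esum_subset => //.
  move=> _ [S' [[S [M [FS mM ->]]] tT] <-]; split => //.
  by exists S => //; rewrite pruned_top.
Qed.

Lemma pruned_sub S' : pruned S' -> exists S,
  [/\ F S, S' `<=` S & rdiam (top S') <= d * rdiam (top S)].
Proof.
move=> [S [M [FS mM ->]]]; exists S; split => //; first by move=> T [].
by rewrite pruned_top//; case: mM => -[].
Qed.

End Pruning.

(** * From graphs to planes *)

Section GraphsToPlanes.
Context {R : realType} {n k : nat} {E : set (heis R n)}.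
Variable Dy : dyadic_system k E.

Lemma ilip_graph_dist (V : {vspace 'rV[R]_(n + n)}) phi (L : R) x y :
  ilip_bound V phi L -> (graph_map phi @` hsubgroup V) x ->
  (graph_map phi @` hsubgroup V) y ->
  mdist x y <= (1 + L) * enorm (pv (coords V x) - pv (coords V y)).
Proof.
move=> [_ lip] [v Vv <-] [v' Vv' <-]; have := lip v v' Vv Vv'.
rewrite knorm_hproj => h; rewrite -[mdist _ _]/(knorm (_^-1 * _)%g).
set g := (_^-1 * _)%g in h *.
have gE : g = (hproj V g * vproj V g)%g by rewrite /vproj mulVKg.
rewrite {1}gE; apply: le_trans (knormM _ _) _.
by rewrite mulrDl mul1r lerD// knorm_hproj.
Qed.

Lemma foot_le_dist (V : {vspace 'rV[R]_(n + n)}) (x y : heis R n) :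
  enorm (pv (coords V x) - pv (coords V y)) <= mdist x y.
Proof.
by rewrite -hz_hproj (le_trans (enorm_orthproj _ _))// enorm_hz_le.
Qed.

Lemma two_errors (d a b e p q t : R) : d <= a + b -> b <= e + q -> a <= t ->
  e <= p -> q <= t -> d <= p + 2 * t.
Proof. lra. Qed.

(** Absorption: here dx is the distance of two points, p that of their
    projections, p' that of the projections of two points of the graph within
    kap dx of them, and 1 + L the Lipschitz constant of the graph map. *)
Lemma near_graph_dist (p p' dx kap L eta : R) : 0 <= eta <= 1 -> 0 <= dx ->
  0 <= L -> L <= eta / 4 -> kap <= eta / 20 -> 0 <= kap ->
  p' <= p + 2 * (kap * dx) ->
  dx <= (1 + L) * p' + 2 * (kap * dx) -> dx <= (1 + 2 * eta) * p.
Proof.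
move=> /andP[e0 e1] d0 L0 Le ke k0 pp dp.
have kd0 : 0 <= kap * dx by rewrite mulr_ge0.
have h1 : (1 + L) * p' <= (1 + L) * (p + 2 * (kap * dx)) by rewrite ler_wpM2l//; lra.
have h2 : L * (kap * dx) <= 1 * (kap * dx) by rewrite ler_wpM2r//; lra.
have h3 : kap * dx <= eta / 20 * dx by rewrite ler_wpM2r.
have h4 : (1 - 6 * (eta / 20)) * dx <= (1 + L) * p by lra.
have p0 : 0 <= p.
  rewrite leNgt; apply/negP => pneg.
  have : 0 <= (1 - 6 * (eta / 20)) * dx by rewrite mulr_ge0//; lra.
  have : (1 + L) * p < 0 by rewrite pmulr_rlt0//; lra.
  lra.
have h5 : (1 + L) * p <= (1 + eta / 4) * p by rewrite ler_wpM2r//; lra.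
have c0 : 0 < 1 - 6 * (eta / 20) by lra.
rewrite -(ler_pM2l c0); apply: (le_trans h4); apply: (le_trans h5).
rewrite [leRHS]mulrA ler_wpM2r//.
have : eta * eta <= eta * 1 by rewrite ler_wpM2l.
lra.
Qed.

(** The trees are pruned so that the enlarged top of a new tree stays near the top
    of the old one. Two points of it that are far apart compared with one of their
    heights have a cube P of the old tree nearby whose diameter is comparable with
    their distance dx; there the graph approximates both points up to a small
    fraction of dx, and the projection along the graph is almost isometric. *)
Lemma graphs_to_planes (K0 : R) : 2 <= K0 ->
  corona_ilg Dy -> corona_planes Dy K0.
Proof.
move=> K02 graphs eta eta0.
have ratio1 := scale_ratio_ge1 Dy.
pose eta1 : R := Num.min eta 1.
have eta10 : 0 < eta1 by rewrite lt_min eta0 ltr01.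
have eta11 : eta1 <= 1 by rewrite ge_min lexx orbT.
have eta1e : eta1 <= eta by rewrite ge_min lexx.
clearbody eta1.
have ieta1 : 1 <= eta1^-1 by rewrite invf_ge1.
pose ratio := scale_ratio Dy; rewrite -/ratio in ratio1.
pose c : R := ratio * (eta1^-1 + 1).
have c1 : 1 <= c.
  by rewrite /c mulr_ege1//; lra.
pose kap : R := eta1 / 20.
pose eps : R := kap / (2 * c).
have c0 : 0 < c by lra.
have kap0 : 0 < kap by rewrite /kap; lra.
have eps0 : 0 < eps by apply: divr_gt0 => //; lra.
have epsc : 2 * (eps * c) = kap by rewrite /eps; field; rewrite gt_eqF.
have epsL : 2 * eps <= eta1 / 4.
  have : eps <= eps * c by rewrite ler_peMr// ltW.
  by rewrite /kap in epsc; lra.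
have kape : kap <= eta1 / 20 by [].
have eta101 : 0 <= eta1 <= 1 by rewrite (ltW eta10).
have kap00 := ltW kap0.
clearbody eps kap.
have K0_gt0 : 0 < K0 by lra.
have K01 : 0 < K0^-1 <= 1 by rewrite invr_gt0 K0_gt0 invf_le1//; lra.
have K0t (t : R) : 0 < t -> (K0 - 1) * (K0^-1 * t) <= t.
  move=> t0; rewrite mulrA mulrBl mul1r divff ?gt_eqF// mulrBl mul1r.
  by rewrite gerBl mulr_ge0 ?invr_ge0// ltW.
have K0M1 : 0 <= K0 - 1 by lra.
have [C C0 [G [B [F [cor FG]]]]] := graphs eps eps0.
have [C' C'0 cor'] := pruned_coronization C0 cor K01.
exists C' => //; exists (pruned_good F K0^-1), (B `|` removed F K0^-1), (pruned F K0^-1).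
split => // S' FS'.
have [S [FS S'S topS']] := pruned_sub FS'.
have coh' := pruned_coherent cor FS'.
have Scoh : coherent Dy S by case: cor => _ _ _ h _; exact: h.
have Scubes : S `<=` cubes Dy.
  case: cor => -[-> _] _ [GF _] _ _ Q SQ; left; rewrite GF; by exists S.
have S'cubes : S' `<=` cubes Dy by move=> Q /S'S /Scubes.
have St := top_in Scoh; have ct := Scubes _ St; have topd := cube_diamE ct.
have t0 := cube_rdiam_gt0 ct.
have S't := top_in coh'; have ct' := S'cubes _ S't; have topd' := cube_diamE ct'.
have [Gam [V [phi [[dimV isoV] phiVW [L0 lipL0] ilc ->]]] Gnear] := FG _ FS.
have [L [Lpos lip] Leps] : exists2 L, ilip_bound V phi L & L < 2 * eps.
  have hinf : has_inf [set L | ilip_bound V phi L].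
    by split; [exists L0|exists 0 => L' [/ltW]].
  have [L bL Llt] := inf_adherent eps0 hinf.
  exists L => //; apply: (lt_le_trans Llt).
  by rewrite -/(ilip_constant V phi) mulr2n mulrDl mul1r lerD2r.
exists (hone : heis R n), V; split => // x y Dx Dy' hxy.
rewrite affproj_dist//.
pose hh z := fine (tree_height S' z).
have hhE z : tree_height S' z = (hh z)%:E := tree_height_fin S'cubes coh' z.
have hh0 z : 0 <= hh z by rewrite -lee_fin -hhE tree_height_ge0.
rewrite !hhE -EFin_min -EFinM lte_fin in hxy.
clearbody hh.
set dx := mdist x y in hxy *.
have dx0 : 0 < dx.
  apply: le_lt_trans hxy; apply: mulr_ge0; first exact: ltW.
  by rewrite le_min !hh0.
(* r bounds the diameter of a cube that almost realises the height, and the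
   distances of x and y to a point of it *)
pose r := (eta1^-1 + 1) * dx.
have r0 : 0 < r by rewrite mulr_gt0//; clear -Dy ieta1; lra.
have near_top z : dilate E K0 (top S') z -> (dist_set z (top S) <= diam (top S))%E.
  move=> [_ zt]; apply: le_trans (dist_setS z (sub_top Scoh (S'S _ S't))) _.
  apply: (le_trans zt); rewrite topd topd' -EFinM lee_fin.
  by apply: le_trans (K0t _ t0); rewrite ler_wpM2l.
have cube_around u v : dilate E K0 (top S') u -> dilate E K0 (top S') v ->
    mdist u v = dx -> eta * hh u < dx ->
    exists P, [/\ S P, (dist_set u P <= diam P)%E, (dist_set v P <= diam P)%E &
      rdiam P <= ratio * r].
  move=> Du Dv uv hu.
  have hu1 : hh u < eta1^-1 * dx.
    rewrite ltr_pdivlMl// (le_lt_trans _ hu)// ler_wpM2r//.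
  have : (tree_height S' u < (eta1^-1 * dx)%:E)%E by rewrite hhE lte_fin.
  move=> /ereal_inf_lt[_ [Q S'Q <-]] Qlt.
  have SQ := S'S _ S'Q; have cQ := Scubes _ SQ.
  rewrite (cube_diamE cQ) in Qlt.
  have Qd : rdiam Q < eta1^-1 * dx.
    rewrite -lte_fin; apply: le_lt_trans Qlt.
    by rewrite leeDr// dist_set_ge0.
  have [a Qa ua] : exists2 a, Q a & mdist u a < eta1^-1 * dx.
    apply: dist_set_lt; apply: le_lt_trans Qlt.
    by rewrite leeDl// lee_fin ltW// (cube_rdiam_gt0 cQ).
  have rE : r = eta1^-1 * dx + dx by rewrite /r mulrDl mul1r.
  have ur : mdist u a <= r by rewrite rE; apply: ltW; apply: (lt_le_trans ua); rewrite lerDl ltW.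
  have vr : mdist v a <= r.
    apply: le_trans (metric_triangle v u a) _; rewrite metric_sym uv rE addrC.
    by rewrite lerD2r ltW.
  have Qr : rdiam Q <= r.
    by rewrite rE; apply: ltW; apply: (lt_le_trans Qd); rewrite lerDl ltW.
  have [rt|tr] := leP r (rdiam (top S)).
    have [P [SP QP /andP[rP Pr]]] := intermediate_cube Scubes Scoh SQ r0 Qr rt.
    exists P; split => //; rewrite (cube_diamE (Scubes _ SP));
      apply: le_trans (dist_set_le _ (QP _ Qa)) _; rewrite lee_fin.
      exact: le_trans rP.
    exact: le_trans rP.
  exists (top S); split => //; try exact: near_top.
  by apply: (le_trans (ltW tr)); rewrite ler_peMl// ltW.
have [P [SP xP yP Pr]] : exists P, [/\ S P, (dist_set x P <= diam P)%E,
    (dist_set y P <= diam P)%E & rdiam P <= ratio * r].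
  have [xy|yx] := leP (hh x) (hh y).
    by apply: cube_around => //; rewrite min_l in hxy.
  have [|P [SP yP xP Pr]] := cube_around y x Dy' Dx (metric_sym _ _).
    by rewrite min_r in hxy => //; exact: ltW.
  by exists P.
have cP := Scubes _ SP.
have graph_point z : E z -> (dist_set z P <= diam P)%E ->
    exists2 z', (graph_map phi @` hsubgroup V) z' & mdist z z' < kap * dx.
  move=> Ez zP; apply: dist_set_lt; apply: le_lt_trans (Gnear _ _ SP Ez zP) _.
  rewrite (cube_diamE cP) -EFinM lte_fin -epsc.
  have h1 : eps * rdiam P <= eps * (ratio * r) by rewrite ler_wpM2l// ltW.
  apply: (le_lt_trans h1).
  rewrite [ratio * r](_ : _ = c * dx); last by rewrite /c /r; ring.
  have : 0 < eps * c * dx by apply: mulr_gt0 => //; exact: mulr_gt0.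
  by move=> pos; rewrite [ltLHS]mulrA -[ltRHS]mulrA ltr_pMl// ltr1n.
have [x' Gx' xx'] := graph_point x (proj1 Dx) xP.
have [y' Gy' yy'] := graph_point y (proj1 Dy') yP.
have xy' := ilip_graph_dist (conj Lpos lip) Gx' Gy'.
have px : enorm (pv (coords V x') - pv (coords V x)) <= kap * dx.
  by apply: le_trans (foot_le_dist V x' x) _; rewrite metric_sym ltW.
have py : enorm (pv (coords V y) - pv (coords V y')) <= kap * dx.
  by apply: le_trans (foot_le_dist V y y') _; rewrite ltW.
set p := enorm (pv (coords V x) - pv (coords V y)).
set p' := enorm (pv (coords V x') - pv (coords V y')) in xy'.
have pp' : p' <= p + 2 * (kap * dx).
  exact: two_errors (enorm_triangle (pv (coords V x)) _ _)
    (enorm_triangle (pv (coords V y)) _ _) px (lexx _) py.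
have dd : dx <= (1 + L) * p' + 2 * (kap * dx).
  rewrite metric_sym in yy'.
  exact: two_errors (metric_triangle x x' y) (metric_triangle x' y' y)
    (ltW xx') xy' (ltW yy').
have := near_graph_dist eta101 (ltW dx0) (ltW Lpos) (le_trans (ltW Leps) epsL)
  kape kap00 pp' dd.
move=> h; apply: (le_trans h); rewrite ler_wpM2r ?enorm_ge0//.
by rewrite lerD2l ler_wpM2l.
Qed.

End GraphsToPlanes.

Theorem theorem1p6 (R : realType) :
  exists Kmin : nat -> R -> R,
    (forall (k : nat) (C_E : R), 2 <= Kmin k C_E) /\
    forall (n k : nat) (C_E : R) (E : set (heis R n)),
      (1 <= k <= n)%N -> regular_set k C_E E ->
      forall (Dy : dyadic_system k E) (K0 : R), Kmin k C_E <= K0 ->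
        (corona_planes Dy K0 <-> corona_ilg Dy).
Proof.
exists (fun _ _ => 2); split => // n k C_E E _ _ Dy K0 K02.
by split; [exact: planes_to_graphs|exact: graphs_to_planes].
Qed.
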